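(* Let $Q$ be the configuration manifold, let $L_d:(Q\times Q)\times(\mathbb{R}\times\mathbb{R})\to\mathbb{R}$ be a discrete Lagrangian, let $F^{\mathrm{fr}\pm},F^{\mathrm{ext}\pm}:(Q\times Q)\times(\mathbb{R}\times\mathbb{R})\to T^*Q$ be discrete friction and external forces (fiber preserving), let $P_d:(Q\times Q)\times(\mathbb{R}\times\mathbb{R})\to\mathbb{R}$, and put $F_d^\pm=F^{\mathrm{fr}\pm}+F^{\mathrm{ext}\pm}$ and $C_K^d=\{(q_0,q_1,S_0,S_1)\mid P_d(q_0,q_1,S_0,S_1)=0\}$. Consider the numerical scheme (arising from the discrete variational formulation, recalled in the context, for the nonequilibrium thermodynamics of a simple system) $$ \left\{\begin{aligned} &D_1L_d(q_k,q_{k+1},S_k,S_{k+1})+D_2L_d(q_{k-1},q_k,S_{k-1},S_k)\\ &\qquad+F_d^-(q_k,q_{k+1},S_k,S_{k+1})+F_d^+(q_{k-1},q_k,S_{k-1},S_k)=0,\\ &(q_k,q_{k+1},S_k,S_{k+1})\in C_K^d . \end{aligned}\right. $$ Assume that for all $r=(q_0,q_1,S_0,S_1)$ the matrix $$ \begin{bmatrix} D_2D_1L_d(r)+D_2F_d^-(r) & D_4D_1L_d(r)+D_4F_d^-(r)\\ D_2P_d(r)&D_4P_d(r) \end{bmatrix} $$ is invertible. Then the scheme induces a well-defined discrete flow $$F_{L_d}:C_K^d\to C_K^d,\qquad (q_k,q_{k+1},S_k,S_{k+1})\mapsto(q_{k+1},q_{k+2},S_{k+1},S_{k+2}).$$ Moreover,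 this flow satisfies $$ \big(F_{L_d}^{(N-1)}\big)^*\Omega^+_{L_d,F_d}-\Omega^-_{L_d,F_d}=-\mathbf{d}\sum_{k=0}^{N-1}\big(F_{L_d}^{(k)}\big)^*\big(\omega_d^{\mathrm{fr}}+\omega_d^{\mathrm{ext}}+\omega_d^{\tau}\big), $$ where $F_{L_d}^{(k)}=F_{L_d}\circ\cdots\circ F_{L_d}$ ($k$ times). This is a discrete version of the property $F_T^*\Omega_L=\Omega_L-\mathbf{d}\int_0^TF_t^*(\omega^{\mathrm{fr}}+\omega^{\mathrm{ext}}+\omega^{\tau})\,dt$ of the flow $F_t$ of a (continuous) simple closed system, and an extension to nonequilibrium thermodynamics of the symplecticity $F_{L_d}^*\Omega_{L_d}=\Omega_{L_d}$ of the flow of a variational integrator in classical mechanics.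
   Context: The setting is the discretization of a simple closed thermodynamic system with mechanical variable $q\in Q$ and one entropy variable $S\in\mathbb{R}$; $L_d(q_k,q_{k+1},S_k,S_{k+1})$ approximates the time integral over one time step of a continuous Lagrangian $L(q,\dot q,S)$. $D_i$ denotes the partial derivative with respect to the $i$-th variable of a function of $(q_0,q_1,S_0,S_1)$; thus $D_1L_d\in T^*_{q_0}Q$, $D_2L_d\in T^*_{q_1}Q$. Fiber preserving means that $F^{\mathrm{fr}-},F^{\mathrm{ext}-}$ evaluated at $(q_0,q_1,S_0,S_1)$ lie in $T^*_{q_0}Q$ and $F^{\mathrm{fr}+},F^{\mathrm{ext}+}$ evaluated at $(q_0,q_1,S_0,S_1)$ lie in $T^*_{q_1}Q$. Discrete variational formulation: find $\{(q_k,S_k)\}_{k=0}^N$ with $(q_k,q_{k+1},S_k,S_{k+1})\in C_K^d$ such that $\delta\sum_{k=0}^{N-1}L_d(q_k,q_{k+1},S_k,S_{k+1})+\sum_{k=0}^{N-1}\big(\langle F^{\mathrm{ext}-},\delta q_k\rangle+\langle F^{\mathrm{ext}+},\delta q_{k+1}\rangle\big)=0$ for variations (with $\delta q_0=\delta q_N=0$) satisfying $D_3L_d\,\delta S_k+D_4L_d\,\delta S_{k+1}=\langle F^{\mathrm{fr}-},\delta q_k\rangle+\langle F^{\mathrm{fr}+},\delta q_{k+1}\rangle$, where all functions are evaluated at $(q_k,q_{k+1},S_k,S_{k+1})$. It yields the scheme in the claim. Discrete forms on $(Q\times Q)\times(\mathbb{R}\times\mathbb{R})$, all functions being evaluated at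 $(q_0,q_1,S_0,S_1)$: $$ \Theta^-_{L_d,F_d}=-D_1L_d\,dq_0-F_d^-\,dq_0,\qquad \Theta^+_{L_d,F_d}=D_2L_d\,dq_1+F_d^+\,dq_1,\qquad \Omega^\pm_{L_d,F_d}=-\mathbf{d}\Theta^\pm_{L_d,F_d}, $$ $$ \omega_d^{\mathrm{fr}}=F^{\mathrm{fr}-}dq_0+F^{\mathrm{fr}+}dq_1,\qquad \omega_d^{\mathrm{ext}}=F^{\mathrm{ext}-}dq_0+F^{\mathrm{ext}+}dq_1,\qquad \omega_d^{\tau}=-D_3L_d\,dS_0-D_4L_d\,dS_1 , $$ where $\mathbf{d}$ is the exterior derivative. Since $F_{L_d}$ is a map of $C_K^d$, the forms in the identity are understood on $C_K^d$ (pulled back by inclusion); $F_{L_d}^{(0)}$ is the identity. In the comparison with the continuous case, for a Lagrangian $L:TQ\times\mathbb{R}\to\mathbb{R}$ and forces $F^{\mathrm{fr}},F^{\mathrm{ext}}:TQ\times\mathbb{R}\to T^*Q$ one has $\Omega_L=-\mathbf{d}\big(\tfrac{\partial L}{\partial v}dq\big)$, $\omega^{\mathrm{fr}}=F^{\mathrm{fr}}dq$, $\omega^{\mathrm{ext}}=F^{\mathrm{ext}}dq$, $\omega^{\tau}=-\tfrac{\partial L}{\partial S}dS$, and $F_t$ is the flow on $TQ\times\mathbb{R}$ of $\frac{d}{dt}\frac{\partial L}{\partial\dot q}-\frac{\partial L}{\partial q}=F^{\mathrm{ext}}+F^{\mathrm{fr}}$, $\frac{\partial L}{\partial S}\dot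 S=\langle F^{\mathrm{fr}},\dot q\rangle-P_H^{\mathrm{ext}}$, where $P_H^{\mathrm{ext}}$ is the power due to heat transfer with the exterior. In classical mechanics, $\Omega_{L_d}$ is the pull-back of the canonical symplectic form on $T^*Q$ by the discrete Legendre transform $(q_0,q_1)\mapsto(q_1,D_2L_d(q_0,q_1))$ of a discrete Lagrangian $L_d:Q\times Q\to\mathbb{R}$.
   Formalization: ''Well-defined discrete flow'' is read locally: near each pair of consecutive states the scheme is the graph of a smooth map (a global F on C_K^d can fail: L_d=q0·atan q1, P_d=S1−S0); the identity is proved for every continuous flow of the scheme on an open part of C_K^d, or all of it. *)

(* Defs.v *)
From HB Require Import structures.
From mathcomp Require Import all_boot all_order all_algebra.
From mathcomp Require Import all_classical all_reals all_analysis.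
Import Order.TTheory GRing.Theory Num.Theory.
Import numFieldNormedType.Exports.
Set Implicit Arguments.
Unset Strict Implicit.
Unset Printing Implicit Defensive.
Local Open Scope classical_set_scope.
Local Open Scope ring_scope.

(* A smooth structure is given by one preferred chart around each point (from
    any atlas one may select a chart around each point, and the selected charts
    form an atlas of the same structure).  The tangent space at [x] is then the
    model space [V], a vector being represented by its components in the chart
    preferred at [x]. *)

(* The map [fwd] is relevant on [dom] only and [bwd] on [fwd @` dom] only. *)
Record chart (T V : Type) := Chart {
  dom : set T;
  fwd : T -> V;
  bwd : V -> T }.

Definition charted (T V : Type) := T -> chart T V.

Definition id_charts (V : Type) : charted V V :=
  fun=> Chart setT idfun idfun.
Arguments id_charts : clear implicits.

Definition prod_charts (T V T' V' : Type) (A : charted T V)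
    (B : charted T' V') : charted (T * T') (V * V') :=
  fun x => Chart (dom (A x.1) `*` dom (B x.2))
    (fun y => (fwd (A x.1) y.1, fwd (B x.2) y.2))
    (fun z => (bwd (A x.1) z.1, bwd (B x.2) z.2)).

(* C^oo near [z]: near [z], all the iterated directional derivatives of [g]
   exist and are Frechet differentiable. *)
Definition Coo_at (R : realType) (V W : normedModType R) (g : V -> W) (z : V) :=
  \forall w \near z, forall vs : seq V,
    differentiable (foldr (fun v h => 'D_v h) g vs) w.

(* The continuity of [f] at [x] follows from the two conditions, so that no
   topology is needed on [T] and [T']. *)
Definition smooth_at (R : realType) (V V' : normedModType R) (T T' : Type)
    (A : charted T V) (B : charted T' V') (f : T -> T') (x : T) :=
  (\forall z \near fwd (A x) x, dom (B (f x)) (f (bwd (A x) z))) /\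
  Coo_at (fwd (B (f x)) \o f \o bwd (A x)) (fwd (A x) x).

Definition is_manifold (R : realType) (V : normedModType R)
    (T : topologicalType) (A : charted T V) :=
  [/\ hausdorff_space T, @second_countable T,
      forall x, [/\ dom (A x) x, open (dom (A x)), open (fwd (A x) @` dom (A x)),
        forall y, dom (A x) y -> bwd (A x) (fwd (A x) y) = y &
        (forall y, dom (A x) y -> {for y, continuous (fwd (A x))}) /\
        (forall z, (fwd (A x) @` dom (A x)) z ->
           {for z, continuous (bwd (A x))})] &
      forall x y z, (fwd (A x) @` (dom (A x) `&` dom (A y))) z ->
        Coo_at (fwd (A y) \o bwd (A x)) z].

(* [B] (relevant at the points of [C] only) is an atlas of slice charts that
   makes the subset [C] of [T] an embedded submanifold modelled on [E]: around
   each of its points, [C] is diffeomorphic to an open subset of [E], where a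
   map on a subset of [T] is smooth if it has a smooth local extension to [T].
   The chart preferred at [x] has domain [dom (B x) `&` C]. *)
Definition is_submanifold (R : realType) (V E : normedModType R)
    (T : topologicalType) (A : charted T V) (C : set T) (B : charted T E) :=
  forall x, C x ->
    [/\ open (dom (B x)) /\ dom (B x) x,
        forall y, dom (B x) y -> smooth_at A (id_charts E) (fwd (B x)) y,
        open (fwd (B x) @` (dom (B x) `&` C)),
        forall z, (fwd (B x) @` (dom (B x) `&` C)) z ->
          smooth_at (id_charts E) A (bwd (B x)) z &
        forall y, (dom (B x) `&` C) y -> bwd (B x) (fwd (B x) y) = y].

Definition form1 (R : Type) (T V : Type) := T -> V -> R.
Definition form2 (R : Type) (T V : Type) := T -> V -> V -> R.

Section forms.
Context (R : realType) (V V' : normedModType R) (T T' : Type).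
Context (A : charted T V) (B : charted T' V').

Definition tangent_map (f : T -> T') (x : T) : V -> V' :=
  'd (fwd (B (f x)) \o f \o bwd (A x)) (fwd (A x) x).

Definition pull1 (f : T -> T') (a : form1 R T' V') : form1 R T V :=
  fun x u => a (f x) (tangent_map f x u).

Definition pull2 (f : T -> T') (a : form2 R T' V') : form2 R T V :=
  fun x u v => a (f x) (tangent_map f x u) (tangent_map f x v).

End forms.

(* The exterior derivative at [x] is computed on the coordinate expression
   of the form in the chart preferred at [x]. *)
Definition extd (R : realType) (V : normedModType R) (T : Type)
    (A : charted T V) (a : form1 R T V) : form2 R T V :=
  fun x u v =>
    let b := pull1 (id_charts V) A (bwd (A x)) a in
    'D_u (b ^~ v) (fwd (A x) x) - 'D_v (b ^~ u) (fwd (A x) x).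

(* A covector at [q] is given by its components in the chart preferred
    at [q]. *)

Section cotangent.
Context (R : realType) (n : nat) (Q : Type) (A : charted Q 'rV[R]_n).

Definition pairing (xi v : 'rV[R]_n) : R := \sum_(i < n) xi 0 i * v 0 i.

Definition basis_vec (i : 'I_n) : 'rV[R]_n := delta_mx 0 i.

Definition cotangent_bundle := (Q * 'rV[R]_n)%type.

(* [coord_jac p q q'] is the differential at [q'] of the coordinate change from
   the chart preferred at [p] to that preferred at [q]. *)
Definition coord_jac (p q q' : Q) : 'rV[R]_n -> 'rV[R]_n :=
  'd (fwd (A q) \o bwd (A p)) (fwd (A p) q').

Definition cotangent_charts : charted cotangent_bundle ('rV[R]_n * 'rV[R]_n) :=
  fun x => let q := x.1 in
    Chart [set y | dom (A q) y.1]
      (fun y => (fwd (A q) y.1,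
         \row_i pairing y.2 (coord_jac q y.1 y.1 (basis_vec i))))
      (fun z => let q' := bwd (A q) z.1 in
         (q', \row_i pairing z.2 (coord_jac q' q q' (basis_vec i)))).

End cotangent.

Section discrete.
Context (R : realType) (n : nat) (Q : topologicalType).
Context (A : charted Q 'rV[R]_n).

Definition dstate := ((Q * Q) * (R * R))%type.
Definition dmodel := (('rV[R]_n * 'rV[R]_n) * (R * R))%type.

Definition dcharts : charted dstate dmodel :=
  prod_charts (prod_charts A A) (prod_charts (id_charts R) (id_charts R)).

Definition pos0 (r : dstate) : Q := r.1.1.
Definition pos1 (r : dstate) : Q := r.1.2.
Definition ent0 (r : dstate) : R := r.2.1.
Definition ent1 (r : dstate) : R := r.2.2.

Definition D1 (f : dstate -> R) (r : dstate) : 'rV[R]_n :=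
  \row_i 'D_(basis_vec R i)
    (fun z => f ((bwd (A (pos0 r)) z, pos1 r), (ent0 r, ent1 r)))
    (fwd (A (pos0 r)) (pos0 r)).

Definition D2 (f : dstate -> R) (r : dstate) : 'rV[R]_n :=
  \row_i 'D_(basis_vec R i)
    (fun z => f ((pos0 r, bwd (A (pos1 r)) z), (ent0 r, ent1 r)))
    (fwd (A (pos1 r)) (pos1 r)).

Definition D3 (f : dstate -> R) (r : dstate) : R :=
  derive1 (fun s : R => f ((pos0 r, pos1 r), (s, ent1 r))) (ent0 r).

Definition D4 (f : dstate -> R) (r : dstate) : R :=
  derive1 (fun s : R => f ((pos0 r, pos1 r), (ent0 r, s))) (ent1 r).

(* For [xi r] in the cotangent space at [pos0 r], which does not vary with
   [pos1 r] and [ent1 r]; the rows are indexed by the components of [xi]. *)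
Definition D2cov (xi : dstate -> 'rV[R]_n) (r : dstate) : 'M[R]_n :=
  \matrix_(i, j) D2 (fun s => xi s 0 i) r 0 j.

Definition D4cov (xi : dstate -> 'rV[R]_n) (r : dstate) : 'cV[R]_n :=
  \col_i D4 (fun s => xi s 0 i) r.

Definition smooth_function (f : dstate -> R) :=
  forall r, smooth_at dcharts (id_charts R) f r.

Definition force := dstate -> cotangent_bundle R n Q.

Definition smooth_force (F : force) :=
  forall r, smooth_at dcharts (cotangent_charts A) F r.

Definition force_minus (F : force) :=
  smooth_force F /\ forall r, (F r).1 = pos0 r.

Definition force_plus (F : force) :=
  smooth_force F /\ forall r, (F r).1 = pos1 r.

(* The covector part of the fibrewise sum of two forces over the same point. *)
Definition total_force (Ffr Fext : force) (r : dstate) : 'rV[R]_n :=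
  (Ffr r).2 + (Fext r).2.

Definition constraint (P : dstate -> R) : set dstate := [set r | P r = 0].

(* [scheme r s] for [r] = (q_(k-1), q_k, S_(k-1), S_k) and
   [s] = (q_k, q_(k+1), S_k, S_(k+1)). *)
Definition scheme (L P : dstate -> R)
    (Ffrm Ffrp Fextm Fextp : force) (r s : dstate) :=
  [/\ pos0 s = pos1 r /\ ent0 s = ent1 r,
      D1 L s + D2 L r + total_force Ffrm Fextm s
        + total_force Ffrp Fextp r = 0 &
      constraint P r /\ constraint P s].

Definition regularity_matrix (L P : dstate -> R) (Ffrm Fextm : force)
    (r : dstate) : 'M[R]_(n + 1) :=
  let Fdm := total_force Ffrm Fextm in
  block_mx (D2cov (D1 L) r + D2cov Fdm r) (D4cov (D1 L) r + D4cov Fdm r)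
           (D2 P r)                       (D4 P r)%:M.

(* In the preferred charts, the values of dq_0, dq_1, dS_0, dS_1 on a tangent
   vector [u : dmodel] are [u.1.1], [u.1.2], [u.2.1], [u.2.2]. *)
Definition Theta_minus (L : dstate -> R) (Ffrm Fextm : force) :
    form1 R dstate dmodel :=
  fun r u => - pairing (D1 L r) u.1.1
             - pairing (total_force Ffrm Fextm r) u.1.1.

Definition Theta_plus (L : dstate -> R) (Ffrp Fextp : force) :
    form1 R dstate dmodel :=
  fun r u => pairing (D2 L r) u.1.2 + pairing (total_force Ffrp Fextp r) u.1.2.

Definition Omega_minus (L : dstate -> R) (Ffrm Fextm : force) :
    form2 R dstate dmodel :=
  fun r u v => - extd dcharts (Theta_minus L Ffrm Fextm) r u v.

Definition Omega_plus (L : dstate -> R) (Ffrp Fextp : force) :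
    form2 R dstate dmodel :=
  fun r u v => - extd dcharts (Theta_plus L Ffrp Fextp) r u v.

Definition omega_force (Fm Fp : force) : form1 R dstate dmodel :=
  fun r u => pairing (Fm r).2 u.1.1 + pairing (Fp r).2 u.1.2.

Definition omega_tau (L : dstate -> R) : form1 R dstate dmodel :=
  fun r u => - (D3 L r * u.2.1) - D4 L r * u.2.2.

(* The constraint set C = {P = 0} is a hypersurface of the
   (2n+2)-dimensional [dstate]. *)
Definition cmodel := 'rV[R]_(n + n + 1).

(* The map [F] is relevant on the relatively open subset [C `&` U] of C. *)
Definition discrete_flow (L P : dstate -> R)
    (Ffrm Ffrp Fextm Fextp : force) (U : set dstate) (F : dstate -> dstate) :=
  [/\ open U, {within constraint P `&` U, continuous F} &
      forall r, constraint P r -> U r ->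
        scheme L P Ffrm Ffrp Fextm Fextp r (F r)].

(* Around each pair of consecutive states the scheme is the graph of a unique
   map, smooth on the manifold C.  Invertibility of the matrices does not give
   more: for Q = R, L = q0 * atan q1, P = S1 - S0 and no force, the next
   position q2 must satisfy atan q2 + q0 / (1 + q1 ^ 2) = 0, which is not
   always solvable. *)
Definition well_defined_flow (L P : dstate -> R)
    (Ffrm Ffrp Fextm Fextp : force) (cC : charted dstate cmodel) :=
  forall r s, scheme L P Ffrm Ffrp Fextm Fextp r s ->
  exists (U W : set dstate) (F : dstate -> dstate),
    [/\ open U /\ U r, open W /\ W s,
        forall x, constraint P x -> U x ->
          W (F x) /\
          forall y, W y -> (scheme L P Ffrm Ffrp Fextm Fextp x y <-> y = F x) &
        forall x, constraint P x -> U x -> smooth_at cC cC F x].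

(* The identity between 2-forms on C, on the domain of the iterate N-1 of [F].
   The forms on [dstate] are first pulled back by the inclusion of C, that is
   by [id] from the charts of C to those of [dstate]. *)
Definition flow_identity (L : dstate -> R) (P : dstate -> R)
    (Ffrm Ffrp Fextm Fextp : force) (cC : charted dstate cmodel)
    (U : set dstate) (F : dstate -> dstate) (N : nat) :=
  let res1 := pull1 cC dcharts id in
  let res2 := pull2 cC dcharts id in
  let omega : form1 R dstate dmodel := fun r u =>
    omega_force Ffrm Ffrp r u + omega_force Fextm Fextp r u
    + omega_tau L r u in
  forall r, constraint P r -> (forall k, (k < N.-1)%N -> U (iter k F r)) ->
  forall u v : cmodel,
    pull2 cC cC (iter N.-1 F) (res2 (Omega_plus L Ffrp Fextp)) r u v
      - res2 (Omega_minus L Ffrm Fextm) r u v =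
    - extd cC (fun s w =>
        \sum_(0 <= k < N) pull1 cC cC (iter k F) (res1 omega) s w) r u v.

End discrete.

(* Main.v *)
Require Import Defs.
From HB Require Import structures.
From mathcomp Require Import all_boot all_order all_algebra.
From mathcomp Require Import all_classical all_reals all_analysis.
From mathcomp Require Import ring lra.
Import Order.TTheory GRing.Theory Num.Theory.
Import numFieldNormedType.Exports.
Set Implicit Arguments.
Unset Strict Implicit.
Unset Printing Implicit Defensive.
Local Open Scope classical_set_scope.
Local Open Scope ring_scope.

(* By the invertibility of the matrices, the implicit function theorem turns the
   hypersurface P = 0 into a graph and solves the scheme for (q_(k+2), S_(k+2)).
   For the identity, let g_k be the k-th iterate of the flow read in a chart of
   the hypersurface.  Since dL_d = D_1L_d dq_0 + D_2L_d dq_1 + D_3L_d dS_0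
   + D_4L_d dS_1,
     omega^fr + omega^ext + omega^tau = Theta^+ - Theta^- - dL_d,
   while the scheme says that g_(k+1)^* Theta^- = g_k^* Theta^+.  Hence the sum
   over k < N telescopes to g_(N-1)^* Theta^+ - g_0^* Theta^- up to an exact form,
   and taking exterior derivatives gives the claim. *)

(** * Iterated directional derivatives *)

Section ck.
Context {R : realType}.
Implicit Types (U V W X : normedModType R).

(** Components are taken in the chart preferred at each point, which moves with the point, so
    [D1 L], [D2 L] and the covector of a force need not even be continuous. Whatever is
    differentiated is first rewritten in one fixed chart; the change of components is a transition
    Jacobian, which is invertible and so preserves vanishing. A second obstacle is that a given flow
    is only known to be continuous, on part of the hypersurface C. The local solution of the scheme
    is smooth on an open set of the ambient space, because the equations for the next state make
    sense off C as well; continuity and local uniqueness identify it with the flow on C. The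
    iterates are therefore treated as maps g_k from the model space of C into the ambient states,
    and since charts of C invert on C only, the chain rules ask for inversion just along the map. C
    is a regular hypersurface because (D_2 P_d, D_4 P_d) is a row of an invertible matrix.
    Smoothness being phrased by iterated directional derivatives, the chain rule has to expand a
    moving direction along fixed vectors, whence [finite_dim]. *)

(** Little-o is traded for an explicit estimate, the form in which the implicit function is
    differentiated; uniqueness of the differential identifies [df] at the same time. *)
Lemma differentiable_eps V W (f : V -> W) (df : {linear V -> W}) x :
  continuous df ->
  (forall e, 0 < e -> \forall h \near 0, `|f (h + x) - f x - df h| <= e * `|h|) ->
  differentiable f x /\ 'd f x = df :> (V -> W).
Proof.
move=> dfc H.
have E : f \o shift x = cst (f x) + df +o_ 0 id.
  apply/eqaddoP => e e0; move: (H e e0); apply: filterS => h /=.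
  rewrite -![(_ + _ : _ -> _) _]/(_ + _) -![(- _ : _ -> _) _]/(- _) /=.
  by rewrite opprD addrA.
have dE := diff_unique dfc E.
by split => //; apply/diff_locallyP; rewrite dE.
Qed.

Lemma diff_eps V W (f : V -> W) x : differentiable f x ->
  forall e, 0 < e ->
    \forall h \near 0, `|f (h + x) - f x - 'd f x h| <= e * `|h|.
Proof.
move=> /diff_locallyP[_ /eqaddoP H] e e0; move: (H e e0); apply: filterS => h /=.
rewrite -![(_ + _ : _ -> _) _]/(_ + _) -![(- _ : _ -> _) _]/(- _) /=.
by rewrite opprD addrA.
Qed.

Lemma near_shift0 V (P : set V) x : (\forall y \near x, P y) ->
  \forall h \near 0, P (h + x).
Proof. by rewrite (near_shift 0) /= subr0. Qed.

Lemma near_eq_diff V W (f g : V -> W) x :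
  (\forall y \near x, f y = g y) -> differentiable f x ->
  differentiable g x /\ 'd g x = 'd f x :> (V -> W).
Proof.
move=> fg df; apply: differentiable_eps; first exact: diff_continuous.
move=> e e0; have := diff_eps df e0; apply: filter_app.
have := near_shift0 fg; apply: filter_app; near=> h.
by move=> -> ; rewrite (nbhs_singleton fg).
Unshelve. all: by end_near. Qed.

(** Directional derivatives instead of a differential valued in linear maps: no operator norm is
    needed and the link with [Coo_at] is direct. The order [k] makes inductions possible, and
    Frechet differentiability at every level makes the chain rule available in them. *)
Fixpoint Ck V W (k : nat) (D : set V) (f : V -> W) : Prop :=
  (forall x, D x -> differentiable f x) /\
  if k is k'.+1 then forall v, Ck k' D ('D_v f) else True.

Definition Cinf V W (D : set V) (f : V -> W) := forall k, Ck k D f.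

Lemma Ck_diff V W k (D : set V) (f : V -> W) x :
  Ck k D f -> D x -> differentiable f x.
Proof. by case: k => [|k] [H _]; apply: H. Qed.

Lemma CkS V W k (D : set V) (f : V -> W) : Ck k.+1 D f -> Ck k D f.
Proof.
elim: k f => [|k IH] f [df Df]; first by split.
by split => // v; apply/IH/Df.
Qed.

Lemma Cinf_diff V W (D : set V) (f : V -> W) x :
  Cinf D f -> D x -> differentiable f x.
Proof. by move=> /(_ 0%N)/Ck_diff; apply. Qed.

Lemma Cinf_derive V W (D : set V) (f : V -> W) v : Cinf D f -> Cinf D ('D_v f).
Proof. by move=> H k; have [_] := H k.+1; apply. Qed.

Lemma Ck_sub V W k (D D' : set V) (f : V -> W) : D' `<=` D -> Ck k D f -> Ck k D' f.
Proof.
move=> OO; elim: k f => [|k IH] f [df Df]; first by split => // x /OO/df.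
by split => [x /OO/df //|v]; exact/IH/Df.
Qed.

Lemma Cinf_sub V W (D D' : set V) (f : V -> W) : D' `<=` D -> Cinf D f -> Cinf D' f.
Proof. by move=> OO H k; apply: Ck_sub (H k). Qed.

Lemma Ck_eq V W k (D : set V) (f g : V -> W) : open D ->
  (forall x, D x -> f x = g x) -> Ck k D f -> Ck k D g.
Proof.
move=> oO; have nO x : D x -> \forall y \near x, D y by move=> Ox; apply: open_nbhs_nbhs; split.
have dg f0 g0 : (forall x, D x -> f0 x = g0 x) ->
    (forall x, D x -> differentiable f0 x) -> forall x, D x -> differentiable g0 x.
  move=> fg df x Ox; apply: (near_eq_diff _ (df x Ox)).1.
  by apply: filterS (nO x Ox) => y /fg.
elim: k f g => [|k IH] f g fg [df Df]; first by split => //; exact: dg df.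
split => [|v]; first exact: dg df.
apply: IH (Df v) => x Ox; apply: near_eq_derive.
by apply: filterS (nO x Ox) => y /fg.
Qed.

Lemma Cinf_eq V W (D : set V) (f g : V -> W) : open D ->
  (forall x, D x -> f x = g x) -> Cinf D f -> Cinf D g.
Proof. by move=> oO fg H k; apply: Ck_eq (H k). Qed.

Lemma Coo_atP V W (f : V -> W) z :
  Coo_at f z <-> exists D, [/\ open D, D z & Cinf D f].
Proof.
have key (D : set V) : (Cinf D f <-> forall w, D w -> forall vs : seq V,
    differentiable (foldr (fun v h => 'D_v h) f vs) w).
  split => [H w Ow vs|H k].
    (* In [foldr] the last vector of the list is differentiated first, hence the induction from the
       right. *)
    elim/last_ind: vs f H => [|vs v IH] g H /=; first exact: Cinf_diff Ow.
    by rewrite foldr_rcons; apply: IH; apply: Cinf_derive.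
  elim: k f H => [|k IH] g H.
    by split => // x Ox; exact: (H x Ox [::]).
  split => [x Ox|v]; first exact: (H x Ox [::]).
  by apply: IH => w Ow vs; have := H w Ow (rcons vs v); rewrite foldr_rcons.
split.
  rewrite /Coo_at /prop_near1 nbhsE => -[D [oO Oz] H]; exists D; split => //.
  by apply/key => w Ow vs; apply: H.
move=> [D [oO Oz] /key H].
by apply: filterS (open_nbhs_nbhs (conj oO Oz)) => w Ow; apply: H.
Qed.

Lemma Coo_at_diff V W (f : V -> W) z : Coo_at f z -> differentiable f z.
Proof. by move=> /Coo_atP[D [_ Oz /Cinf_diff]]; apply. Qed.

Lemma Coo_at_near V W (f : V -> W) z : Coo_at f z ->
  \forall w \near z, Coo_at f w.
Proof.
move=> /Coo_atP[D [oO Oz H]].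
apply: filterS (open_nbhs_nbhs (conj oO Oz)) => w Ow.
by apply/Coo_atP; exists D.
Qed.

Lemma Coo_at_eq V W (f g : V -> W) z :
  (\forall w \near z, f w = g w) -> Coo_at f z -> Coo_at g z.
Proof.
rewrite /prop_near1 nbhsE => -[D1 [oO1 O1z] fg] /Coo_atP[D [oO Oz H]].
apply/Coo_atP; exists (D `&` D1); split => //; first exact: openI.
apply: (@Cinf_eq _ _ _ f); first exact: openI.
- by move=> x [_ /fg].
- by apply: Cinf_sub H => ? [].
Qed.

Lemma Coo_at_derive V W (f : V -> W) z v : Coo_at f z -> Coo_at ('D_v f) z.
Proof.
by move=> /Coo_atP[D [oO Oz H]]; apply/Coo_atP; exists D; split => //; exact: Cinf_derive.
Qed.

Lemma Coo_at_continuous V W (f : V -> W) z : Coo_at f z -> {for z, continuous f}.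
Proof. by move=> /Coo_at_diff/differentiable_continuous. Qed.

Lemma Ck_cst V W k (D : set V) (c : W) : open D -> Ck k D (cst c).
Proof.
move=> oO; elim: k c => [|k IH] c; first by split.
split => // v; apply: (@Ck_eq _ _ _ _ (cst 0)) => // x Ox.
by rewrite derive_cst.
Qed.

Lemma CkD V W k (D : set V) (f g : V -> W) : open D ->
  Ck k D f -> Ck k D g -> Ck k D (fun x => f x + g x).
Proof.
move=> oO; elim: k f g => [|k IH] f g [df Df] [dg Dg].
  by split => // x Ox; apply: differentiableD; [exact: df|exact: dg].
split => [x Ox|v]; first by apply: differentiableD; [exact: df|exact: dg].
apply: (@Ck_eq _ _ _ _ (fun x => 'D_v f x + 'D_v g x)) => //.
  move=> x Ox; rewrite -[fun _ => _]/(f + g) deriveD //.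
    by apply: diff_derivable; exact: df.
  by apply: diff_derivable; exact: dg.
by apply: IH; [exact: Df|exact: Dg].
Qed.

Lemma Ck_sum V W k (D : set V) I (r : seq I) (F : I -> V -> W) : open D ->
  (forall i, Ck k D (F i)) -> Ck k D (fun x => \sum_(i <- r) F i x).
Proof.
move=> oO H; elim: r => [|i r IH].
  apply: (@Ck_eq _ _ _ _ (cst 0)) => // [x Ox|]; first by rewrite big_nil.
  exact: Ck_cst.
apply: (@Ck_eq _ _ _ _ (fun x => F i x + \sum_(i <- r) F i x)) => //.
  by move=> x Ox; rewrite big_cons.
exact: CkD.
Qed.

Lemma diff_scale V W (a : V -> R) (f : V -> W) x :
  differentiable a x -> differentiable f x ->
  differentiable (fun x => a x *: f x) x /\
  forall v, 'd (fun x => a x *: f x) x v = 'd a x v *: f x + a x *: 'd f x v.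
Proof.
move=> da df.
(* The Leibniz rule is the differential of the continuous bilinear map [*:] composed with the pair
   of [a] and [f]. *)
have bil : bilinear_for
    (GRing.Scale.Law.clone _ _ *:%R _) (GRing.Scale.Law.clone _ _ *:%R _)
    (@GRing.scale R W).
  split => [u|u] b x1 y1 /=; first by rewrite scalerDl scalerA.
  by rewrite scalerDr !scalerA mulrC.
pose bM := bilinear_isBilinear.Build R R W W _ _ (@GRing.scale R W) bil.
pose bL : {bilinear R -> W -> W} := HB.pack (@GRing.scale R W) bM.
have bc : continuous (fun p : R * W => bL p.1 p.2) by exact: scale_continuous.
have dbL := differentiable_bilin (a x, f x) bc.
have := diff_bilin (a x, f x) bc => /= dbE.
have -> : (fun x => a x *: f x) = (fun p => bL p.1 p.2) \o (fun x => (a x, f x)) by [].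
have dp := differentiable_pair da df.
split; first exact: differentiable_comp.
by move=> v; rewrite diff_comp //= dbE /= diff_pair //= addrC.
Qed.

Lemma CkZ V W k (D : set V) (a : V -> R) (f : V -> W) : open D ->
  Ck k D a -> Ck k D f -> Ck k D (fun x => a x *: f x).
Proof.
move=> oO; elim: k a f => [|k IH] a f [da Da] [df Df].
  by split => // x Ox; apply: (diff_scale _ _).1; [exact: da|exact: df].
split => [x Ox|v].
  by apply: (diff_scale _ _).1; [exact: da|exact: df].
apply: (@Ck_eq _ _ _ _ (fun x => 'D_v a x *: f x + a x *: 'D_v f x)) => //.
  move=> x Ox; have [d1 d2] := diff_scale (da x Ox) (df x Ox).
  by rewrite [RHS]deriveE// d2 !deriveE//; [exact: df|exact: da].
have Ca : Ck k D a by apply: (@CkS _ _ k); split.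
have Cf : Ck k D f by apply: (@CkS _ _ k); split.
by apply: CkD => //; apply: IH => //; [exact: Da|exact: Df].
Qed.

Lemma Ck_lin V W X k (D : set V) (f : V -> W) (l : {linear W -> X}) :
  open D -> continuous l -> Ck k D f -> Ck k D (l \o f).
Proof.
move=> oO cl; have dl x : differentiable l x by exact: linear_differentiable.
elim: k f => [|k IH] f [df Df].
  by split => // x Ox; apply: differentiable_comp => //; exact: df.
split => [x Ox|v].
  by apply: differentiable_comp => //; exact: df.
apply: (@Ck_eq _ _ _ _ (l \o 'D_v f)) => //.
  move=> x Ox; have dfx := df x Ox; rewrite [RHS]deriveE; last exact: differentiable_comp.
  by rewrite diff_comp//= diff_lin// deriveE.
by apply: IH; exact: Df.
Qed.

Lemma Ck_linear V W k (D : set V) (l : {linear V -> W}) :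
  open D -> continuous l -> Ck k D l.
Proof.
move=> oO cl.
have dl x : differentiable l x by exact: linear_differentiable.
case: k => [|k]; split => // v.
apply: (@Ck_eq _ _ _ _ (cst (l v))) => // [x Ox|]; last exact: Ck_cst.
by rewrite deriveE// diff_lin.
Qed.

Lemma Ck_id V k (D : set V) : open D -> Ck k D id.
Proof. by move=> oO; apply: (@Ck_linear _ _ _ _ idfun) => // x P. Qed.

Lemma Ck_pair V W X k (D : set V) (f : V -> W) (g : V -> X) : open D ->
  Ck k D f -> Ck k D g -> Ck k D (fun x => (f x, g x)).
Proof.
move=> oO; elim: k f g => [|k IH] f g [df Df] [dg Dg].
  by split => // x Ox; apply: differentiable_pair; [exact: df|exact: dg].
split => [x Ox|v]; first by apply: differentiable_pair; [exact: df|exact: dg].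
apply: (@Ck_eq _ _ _ _ (fun x => ('D_v f x, 'D_v g x))) => //.
  move=> x Ox; have dfx := df x Ox; have dgx := dg x Ox.
  by rewrite [RHS]deriveE ?diff_pair ?deriveE //; exact: differentiable_pair.
by apply: IH; [exact: Df|exact: Dg].
Qed.

(** * Products, inverses and determinants *)

Lemma Ck_prod V k (D : set V) I (r : seq I) (F : I -> V -> R) : open D ->
  (forall i, Ck k D (F i)) -> Ck k D (fun x => \prod_(i <- r) F i x).
Proof.
move=> oD H; elim: r => [|i r IH].
  apply: (@Ck_eq _ _ _ _ (cst (1 : R))) => // [x Dx|]; first by rewrite big_nil.
  exact: Ck_cst.
apply: (@Ck_eq _ _ _ _ (fun x => F i x *: \prod_(i <- r) F i x)) => //.
  by move=> x Dx; rewrite big_cons.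
exact: CkZ.
Qed.

(** The derivative of the inverse involves the inverse again, but only to order [k], so the
    induction closes. *)
Lemma Ck_inv V k (D : set V) (a : V -> R) : open D ->
  (forall x, D x -> a x != 0) -> Ck k D a -> Ck k D (fun x => (a x)^-1).
Proof.
move=> oD a0; elim: k a a0 => [|k IH] a a0 [da Da].
  by split => // x Dx; apply: differentiableV; [exact: da|exact: a0].
split => [x Dx|v]; first by apply: differentiableV; [exact: da|exact: a0].
have Ca : Ck k D a by apply: (@CkS _ _ k); split.
apply: (@Ck_eq _ _ _ _ (fun x => (-1) *: ((a x)^-1 *: ((a x)^-1 *: 'D_v a x)))) => //.
  move=> x Dx; have dax := da x Dx; have ax := a0 x Dx.
  rewrite [RHS]deriveE; last exact: differentiableV.
  rewrite diffV//= deriveE// !scalerA; congr (_ *: _).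
  by rewrite expr2 invfM mulN1r.
have Ci := IH a a0 Ca.
apply: CkZ => //; first exact: Ck_cst.
by do 2!apply: CkZ => //; exact: Da.
Qed.

Lemma Ck_det V k (D : set V) n (M : V -> 'M[R]_n) : open D ->
  (forall i j, Ck k D (fun x => M x i j)) -> Ck k D (fun x => \det (M x)).
Proof.
move=> oD H; apply: Ck_sum => // s.
apply: (@CkZ _ _ _ _ (cst _)) => //; first exact: Ck_cst.
exact: Ck_prod.
Qed.

Lemma Ck_mx V k (D : set V) m n (M : V -> 'M[R]_(m, n)) : open D ->
  (forall i j, Ck k D (fun x => M x i j)) -> Ck k D M.
Proof.
move=> oD H.
apply: (@Ck_eq _ _ _ _ (fun x => \sum_i \sum_j M x i j *: delta_mx i j)) => //.
  by move=> x Dx; rewrite -matrix_sum_delta.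
apply: Ck_sum => // i; apply: Ck_sum => // j; apply: CkZ => //.
exact: Ck_cst.
Qed.

(** By Cramer's formula the inverse is the adjugate, polynomial in the entries, divided by a
    determinant that does not vanish on [D]. *)
Lemma Ck_invmx V k (D : set V) n (M : V -> 'M[R]_n) : open D ->
  (forall x, D x -> M x \in unitmx) ->
  (forall i j, Ck k D (fun x => M x i j)) -> Ck k D (fun x => invmx (M x)).
Proof.
move=> oD uM H.
apply: (@Ck_eq _ _ _ _ (fun x => (\det (M x))^-1 *: \adj (M x))) => //.
  by move=> x Dx; rewrite /invmx uM.
apply: CkZ => //.
  by apply: Ck_inv => // [x /uM|]; [rewrite unitmxE unitfE|exact: Ck_det].
apply: Ck_mx => // i j.
apply: (@Ck_eq _ _ _ _ (fun x => cofactor (M x) j i)) => //.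
  by move=> x Dx; rewrite mxE.
apply: (@CkZ _ _ _ _ (cst _)) => //; first exact: Ck_cst.
apply: Ck_det => // i' j'; apply: (@Ck_eq _ _ _ _ (fun x => M x (lift j i') (lift i j'))) => //.
by move=> x Dx; rewrite !mxE.
Qed.

(** A finite spanning family with continuous linear coordinates, the exact data needed to expand a
    variable direction along fixed ones. *)
Definition finite_dim V := exists m (e : 'I_m -> V) (c : 'I_m -> {linear V -> R}),
  (forall i, continuous (c i)) /\ forall w, w = \sum_i c i w *: e i.

(** The derivative of the composite along [v] is that of [g] along ['D_v f x], a direction that
    depends on [x]. Expanding it along the family [e] leaves derivatives of [g] in fixed directions
    with smooth coefficients, to which the induction applies. *)
Lemma Ck_comp U V W k (A : set U) (B : set V) (f : U -> V) (g : V -> W) :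
  finite_dim V -> open A -> open B -> (forall x, A x -> B (f x)) ->
  Ck k A f -> Ck k B g -> Ck k A (g \o f).
Proof.
move=> [m [e [c [cc ec]]]] oA oB AB; elim: k g => [|k IH] g Hf Hg.
  split=> // x Ax; apply: differentiable_comp; first exact: (Ck_diff Hf).
  by apply: (Ck_diff Hg); exact: AB.
have dgf x : A x -> differentiable f x /\ differentiable g (f x).
  by move=> Ax; split; [exact: (Ck_diff Hf)|apply: (Ck_diff Hg); exact: AB].
split => [x /dgf[]|v]; first exact: differentiable_comp.
apply: (@Ck_eq _ _ _ _ (fun x => \sum_i c i ('D_v f x) *: 'D_(e i) g (f x))) => //.
  move=> x /dgf[df dg]; rewrite [RHS]deriveE; last exact: differentiable_comp.
  have -> : 'd (g \o f) x v = 'd g (f x) ('D_v f x) by rewrite diff_comp//= -(deriveE v df).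
  rewrite [in RHS](ec ('D_v f x)) linear_sum.
  by apply: eq_bigr => i _; rewrite linearZ/= (deriveE (e i) dg).
apply: Ck_sum => // i; apply: CkZ => //.
  by apply: Ck_lin => //; exact: Hf.2.
by apply: (IH ('D_(e i) g)); [exact: CkS|exact: Hg.2].
Qed.

Lemma Coo_comp U V W (f : U -> V) (g : V -> W) z : finite_dim V ->
  Coo_at f z -> Coo_at g (f z) -> Coo_at (g \o f) z.
Proof.
move=> fV /Coo_atP[A [oA Az fA]] /Coo_atP[B [oB Bz gB]].
have : \forall x \near z, A x /\ B (f x).
  apply: filterI; first exact: open_nbhs_nbhs.
  have /differentiable_continuous := Cinf_diff fA Az; apply.
  exact: open_nbhs_nbhs.
rewrite /prop_near1 nbhsE => -[C [oC Cz] CAB]; apply/Coo_atP; exists C; split => // k.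
apply: (@Ck_comp _ _ _ _ C B) => //; first by move=> x /CAB[].
by apply: Ck_sub (fA k) => x /CAB[].
Qed.

Lemma Coo_cst V W (c : W) (z : V) : Coo_at (cst c) z.
Proof. by apply/Coo_atP; exists setT; split => // [|k]; [exact: openT|apply: Ck_cst; exact: openT]. Qed.

Lemma Coo_lift2 V W X (Y : normedModType R) (f : V -> W) (g : V -> X) (h : V -> Y) z :
  (forall k (D : set V), open D -> Ck k D f -> Ck k D g -> Ck k D h) ->
  Coo_at f z -> Coo_at g z -> Coo_at h z.
Proof.
move=> H /Coo_atP[A [oA Az fA]] /Coo_atP[B [oB Bz gB]].
apply/Coo_atP; exists (A `&` B); split => // [|k]; first exact: openI.
apply: H; first exact: openI.
  by apply: Ck_sub (fA k) => ? [].
by apply: Ck_sub (gB k) => ? [].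
Qed.

Lemma CooD V W (f g : V -> W) z :
  Coo_at f z -> Coo_at g z -> Coo_at (fun x => f x + g x) z.
Proof. by apply: Coo_lift2 => k D; exact: CkD. Qed.

Lemma CooZ V W (a : V -> R) (f : V -> W) z :
  Coo_at a z -> Coo_at f z -> Coo_at (fun x => a x *: f x) z.
Proof. by apply: Coo_lift2 => k D; exact: CkZ. Qed.

Lemma Coo_pair V W X (f : V -> W) (g : V -> X) z :
  Coo_at f z -> Coo_at g z -> Coo_at (fun x => (f x, g x)) z.
Proof. by apply: Coo_lift2 => k D; exact: Ck_pair. Qed.

Lemma Coo_sum V W I (r : seq I) (F : I -> V -> W) z :
  (forall i, Coo_at (F i) z) -> Coo_at (fun x => \sum_(i <- r) F i x) z.
Proof.
move=> H; elim: r => [|i r IH].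
  by apply: Coo_at_eq (Coo_cst 0 z); near=> x; rewrite big_nil.
by apply: Coo_at_eq (CooD (H i) IH); near=> x; rewrite big_cons.
Unshelve. all: by end_near. Qed.

Lemma Coo_mx V m n (M : V -> 'M[R]_(m, n)) z :
  (forall i j, Coo_at (fun x => M x i j) z) -> Coo_at M z.
Proof.
move=> H; have : Coo_at (fun x => \sum_i \sum_j M x i j *: delta_mx i j) z.
  do 2!apply: Coo_sum => ?; apply: CooZ => //; exact: Coo_cst.
by apply: Coo_at_eq; near=> x; rewrite -matrix_sum_delta.
Unshelve. all: by end_near. Qed.

(** Linearity implies continuity here, since the map is a finite sum of continuous coordinates times
    fixed vectors. Projections and block constructions, given as bare functions, thus enter the
    calculus. *)
Lemma linear_packed V W (f : V -> W) : finite_dim V -> linear f ->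
  exists2 l : {linear V -> W}, continuous l & f = l.
Proof.
move=> [m [e [c [cc ec]]]] lf.
pose fL : {linear V -> W} := HB.pack f (GRing.isLinear.Build _ _ _ _ _ lf).
exists fL => // x; apply: (@Coo_at_continuous V W).
apply: (@Coo_at_eq _ _ (fun x => \sum_i c i x *: f (e i))).
  near=> y; rewrite -[RHS]/(fL y) [in RHS](ec y) linear_sum.
  by apply: eq_bigr => i _; rewrite linearZ.
apply: Coo_sum => i; apply: CooZ; last exact: Coo_cst.
apply/Coo_atP; exists setT; split => // [|k]; first exact: openT.
by apply: Ck_linear => //; exact: openT.
Unshelve. all: by end_near. Qed.

Lemma Ck_linear_comp U V W k (D : set U) (f : U -> V) (l : V -> W) : open D ->
  finite_dim V -> linear l -> Ck k D f -> Ck k D (fun x => l (f x)).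
Proof. by move=> oD fd ll; have [L cL ->] := linear_packed fd ll; exact: Ck_lin. Qed.

Lemma Coo_lin V W (f : V -> W) z : finite_dim V -> linear f -> Coo_at f z.
Proof.
move=> fd lf; apply/Coo_atP; exists setT; split => // [|k]; first exact: openT.
by apply: (@Ck_linear_comp _ _ _ _ _ id) => //; [exact: openT|apply: Ck_id; exact: openT].
Qed.

Lemma diff_linear V W (f : V -> W) z : finite_dim V -> linear f ->
  'd f z = f :> (V -> W).
Proof. by move=> fd lf; have [L cL ->] := linear_packed fd lf; exact: diff_lin. Qed.

Lemma Coo_lin_comp U V W (f : U -> V) (l : V -> W) z : finite_dim V -> linear l ->
  Coo_at f z -> Coo_at (fun x => l (f x)) z.
Proof. by move=> fd ll Cf; apply: (Coo_comp fd Cf); exact: Coo_lin. Qed.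

Lemma Coo_id V (z : V) : Coo_at id z.
Proof. by apply/Coo_atP; exists setT; split => // [|k]; [exact: openT|apply: Ck_id; exact: openT]. Qed.

Lemma finite_dimR : finite_dim (R : normedModType R).
Proof.
exists 1%N, (fun=> 1), (fun=> idfun); split => [i x P //|w].
by rewrite big_ord1 /= [RHS]mulr1.
Qed.

Lemma finite_dim_mx m n : finite_dim ('M[R]_(m, n) : normedModType R).
Proof.
have lin i j : linear (fun M : 'M[R]_(m, n) => M i j : R).
  by move=> a x y; rewrite !mxE.
pose L i j : {linear 'M[R]_(m, n) -> R} := HB.pack (fun M : 'M[R]_(m, n) => M i j : R) (GRing.isLinear.Build _ _ _ _ _ (lin i j)).
exists #|{: 'I_m * 'I_n}|, (fun k => delta_mx (enum_val k).1 (enum_val k).2),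
  (fun k => L (enum_val k).1 (enum_val k).2); split => [k|w].
  exact: coord_continuous.
rewrite [LHS]matrix_sum_delta pair_big /=.
rewrite (reindex (fun k : 'I_#|{: 'I_m * 'I_n}| => enum_val k)) //=.
by apply: onW_bij; exact: enum_val_bij.
Qed.

Lemma finite_dim_prod V W : finite_dim V -> finite_dim W -> finite_dim (V * W)%type.
Proof.
move=> [m [e [c [cc ec]]]] [m' [e' [c' [cc' ec']]]].
have lin1 i : linear (fun p : V * W => c i p.1) by move=> a x y; rewrite /= linearP.
have lin2 i : linear (fun p : V * W => c' i p.2) by move=> a x y; rewrite /= linearP.
pose L1 i : {linear (V * W)%type -> R} := HB.pack (fun p : V * W => c i p.1) (GRing.isLinear.Build _ _ _ _ _ (lin1 i)).
pose L2 i : {linear (V * W)%type -> R} := HB.pack (fun p : V * W => c' i p.2) (GRing.isLinear.Build _ _ _ _ _ (lin2 i)).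
exists (m + m')%N, (fun k : 'I_(m + m') => match fintype.split k with inl i => (e i, 0) | inr j => (0, e' j) end),
  (fun k : 'I_(m + m') => match fintype.split k with inl i => L1 i | inr j => L2 j end); split.
  move=> k; case: (fintype.split k) => i /= p.
    apply: (@continuous_comp _ _ _ (@fst V W) (c i)); first exact: cvg_fst.
    exact: cc.
  apply: (@continuous_comp _ _ _ (@snd V W) (c' i)); first exact: cvg_snd.
  exact: cc'.
move=> [v w]; rewrite big_split_ord /=.
under eq_bigr => i _ do rewrite (unsplitK (inl i)) /=.
under [X in _ = _ + X]eq_bigr => i _ do rewrite (unsplitK (inr i)) /=.
have fstS (I : Type) r (F : I -> V * W) : (\sum_(i <- r) F i).1 = \sum_(i <- r) (F i).1.
  by apply: (big_morph (@fst V W)).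
have sndS (I : Type) r (F : I -> V * W) : (\sum_(i <- r) F i).2 = \sum_(i <- r) (F i).2.
  by apply: (big_morph (@snd V W)).
apply: injective_projections => /=; rewrite ?fstS ?sndS /=.
  rewrite [X in _ + X]big1 ?addr0 => [|i _]; last by rewrite scaler0.
  exact: ec.
rewrite [X in X + _]big1 ?add0r => [|i _]; last by rewrite scaler0.
exact: ec'.
Qed.

End ck.

(** * Symmetry of second derivatives *)

Section mean_value.
Context {R : realType}.
Implicit Types (V W X : normedModType R).

Lemma derive_line V W (f : V -> W) (z v : V) (s : R) :
  differentiable f (z + s *: v) ->
  is_derive s 1 (fun s => f (z + s *: v)) ('D_v f (z + s *: v)).
Proof.
move=> df.
have dl : is_diff s (cst z + *:%R^~ v : R -> V) (0 + *:%R^~ v) by apply: is_diffD.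
have dc : differentiable (f \o (cst z + *:%R^~ v : R -> V)) s.
  by apply: differentiable_comp.
apply: DeriveDef; first exact: diff_derivable.
rewrite [LHS]deriveE // diff_comp //= diff_val /= deriveE //.
by congr ('d f _ _); rewrite fctE /= add0r scale1r.
Qed.

Lemma line_MVT V (f : V -> R) (z v : V) (t : R) : 0 <= t ->
  (forall s : R, 0 <= s <= t -> differentiable f (z + s *: v)) ->
  exists2 s : R, 0 <= s <= t & f (z + t *: v) - f z = t * 'D_v f (z + s *: v).
Proof.
move=> t0 df.
have dd (x : R) : x \in `]0, t[ ->
    is_derive x 1 (fun s => f (z + s *: v)) ('D_v f (z + x *: v)).
  rewrite in_itv /= => /andP[x0 xt]; apply: derive_line; apply: df.
  by rewrite !ltW.
have cc : {within `[0, t], continuous (fun s => f (z + s *: v))}.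
  apply: derivable_within_continuous => x; rewrite in_itv /= => xi.
  by have [] := derive_line (df x xi).
have [c c0t E] := MVT_segment t0 dd cc.
exists c; first by move: c0t; rewrite in_itv.
by move: E; rewrite scale0r addr0 subr0 mulrC.
Qed.

(** The mean value theorem is used twice: along [u] for the increment of [f] by [t *: v], then along
    [v] for ['D_u f]. *)
Lemma second_difference V (f : V -> R) (z u v : V) (t : R) : 0 <= t ->
  (forall a b : R, 0 <= a <= t -> 0 <= b <= t ->
     differentiable f (z + a *: u + b *: v) /\
     differentiable ('D_u f) (z + a *: u + b *: v)) ->
  exists a b : R, [/\ 0 <= a <= t, 0 <= b <= t &
    f (z + t *: u + t *: v) - f (z + t *: u) - (f (z + t *: v) - f z) =
    t * (t * 'D_v ('D_u f) (z + a *: u + b *: v))].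
Proof.
move=> t0 H; have tt : 0 <= t <= t by rewrite t0 lexx.
have oo : 0 <= (0 : R) <= t by rewrite t0 lexx.
pose g w := f (w + t *: v) - f w.
have dsh w : differentiable f (w + t *: v) ->
    differentiable (fun w => f (w + t *: v)) w /\
    forall v', 'D_v' (fun w => f (w + t *: v)) w = 'D_v' f (w + t *: v).
  move=> df.
  have ds : is_diff w (id + cst (t *: v) : V -> V) (id + 0) by apply: is_diffD.
  have dc : differentiable (f \o (id + cst (t *: v))) w by apply: differentiable_comp.
  split => // v'; rewrite [LHS]deriveE// diff_comp //= diff_val deriveE //.
  by congr ('d f _ _); rewrite fctE /= addr0.
have dg (a : R) : 0 <= a <= t -> differentiable g (z + a *: u) /\
    'D_u g (z + a *: u) = 'D_u f (z + a *: u + t *: v) - 'D_u f (z + a *: u).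
  move=> at0; have [d1 d1E] := dsh _ (H a t at0 tt).1.
  have d2 : differentiable f (z + a *: u).
    by have := (H a 0 at0 oo).1; rewrite scale0r addr0.
  split; first exact: differentiableB.
  rewrite -d1E -[g]/((fun w => f (w + t *: v)) - f) deriveB //; exact: diff_derivable.
have [a at0 Ea] := line_MVT t0 (fun s si => (dg s si).1).
have [b bt0 Eb] := @line_MVT _ ('D_u f) (z + a *: u) v t t0 (fun s si => (H a s at0 si).2).
by exists a, b; split => //; rewrite -Eb -(dg a at0).2 -Ea /g.
Qed.

(** The second difference on a small parallelogram is symmetric in [u] and [v], so the two mixed
    derivatives take the same value at two points close to [z]; their continuity at [z]
    concludes. *)
Lemma schwarz_scalar V (f : V -> R) (z u v : V) : Coo_at f z ->
  'D_u ('D_v f) z = 'D_v ('D_u f) z.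
Proof.
move=> Cf; apply/eqP; rewrite -subr_eq0 -normr_le0; apply/ler_addgt0Pl => e e0.
rewrite addr0.
have e2 : 0 < e / 2 by rewrite divr_gt0.
clear e0.
have tri (x y q : R) : `|x - q| < e / 2 -> `|y - q| < e / 2 -> `|x - y| <= e.
  move=> xq yq; rewrite -(subrKA q) (le_trans (ler_normD _ _)) // [e]splitr lerD ?ltW//.
  by rewrite distrC.
have cvg (w : V -> R) : Coo_at w z -> \forall y \near z, `|w z - w y| < e / 2.
  move=> /Coo_at_continuous/cvgrPdist_lt; exact.
have : \forall y \near z, [/\ Coo_at f y,
    `|'D_u ('D_v f) z - 'D_u ('D_v f) y| < e / 2 &
    `|'D_v ('D_u f) z - 'D_v ('D_u f) y| < e / 2].
  have C1 := cvg _ (Coo_at_derive u (Coo_at_derive v Cf)).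
  have C2 := cvg _ (Coo_at_derive v (Coo_at_derive u Cf)).
  apply: filterS3 (Coo_at_near Cf) C1 C2 => y y1 y2 y3.
  split; [exact: y1|exact: y2|exact: y3].
move=> /nbhs_normP[r r0 Hr].
(* With [t] equal to [r / 2 / M], every point of the parallelogram is within [r / 2] of [z]; the
   summand 1 keeps [M] positive when both directions vanish. *)
pose M := `|u| + `|v| + 1.
have M0 : 0 < M by rewrite /M ltr_wpDl// addr_ge0.
pose t := r / 2 / M.
have t0 : 0 < t by rewrite !divr_gt0.
have near_z (a b : R) : 0 <= a <= t -> 0 <= b <= t ->
    `|z - (z + a *: u + b *: v)| < r.
  move=> /andP[a0 at0] /andP[b0 bt0].
  rewrite -addrA opprD addrA subrr add0r normrN.
  apply: (le_lt_trans (ler_normD _ _)); rewrite !normrZ !ger0_norm//.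
  apply: (@le_lt_trans _ _ (t * M)).
    rewrite /M !mulrDr mulr1; apply: ler_wpDr; first exact: ltW.
    by apply: lerD; apply: ler_wpM2r.
  by rewrite /t divfK ?gt_eqF// ltr_pdivrMr// ltr_pMr// ltr1n.
clearbody t.
have C (a b : R) : 0 <= a <= t -> 0 <= b <= t -> Coo_at f (z + a *: u + b *: v).
  by move=> ai bi; have [] := Hr _ (near_z a b ai bi).
have [a [b [ai bi E1]]] := @second_difference _ f z u v t (ltW t0) (fun a b ai bi =>
   conj (Coo_at_diff (C a b ai bi)) (Coo_at_diff (Coo_at_derive u (C a b ai bi)))).
have C' (a' b' : R) : 0 <= a' <= t -> 0 <= b' <= t -> Coo_at f (z + a' *: v + b' *: u).
  by move=> *; rewrite addrAC; exact: C.
have [b' [a' [bi' ai' E2]]] := @second_difference _ f z v u t (ltW t0) (fun a b ai bi =>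
   conj (Coo_at_diff (C' a b ai bi)) (Coo_at_diff (Coo_at_derive v (C' a b ai bi)))).
have E : 'D_v ('D_u f) (z + a *: u + b *: v) = 'D_u ('D_v f) (z + a' *: u + b' *: v).
  have tn0 : t != 0 by rewrite gt_eqF.
  apply: (mulfI tn0); apply: (mulfI tn0).
  apply: (etrans (esym E1)); rewrite (addrAC z (a' *: u)); apply: (etrans _ E2).
  rewrite (addrAC z (t *: v)).
  by move: (f _) (f _) (f _) (f _) => p1 p2 p3 p4; ring.
have [_ _ H1] := Hr _ (near_z a b ai bi).
have [_ H2 _] := Hr _ (near_z a' b' ai' bi').
move: H1; rewrite E => H1.
set p := 'D_u ('D_v f) _ in H1 H2.
exact: (tri _ _ _ H2 H1).
Qed.

Lemma schwarz V W (f : V -> W) (z u v : V) : finite_dim W -> Coo_at f z ->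
  'D_u ('D_v f) z = 'D_v ('D_u f) z.
Proof.
move=> [m [e [c [cc ec]]]] Cf.
have lD i (g : V -> W) w y : differentiable g y -> c i ('D_w g y) = 'D_w (c i \o g) y.
  move=> dg; have dc x : differentiable (c i) x by exact: linear_differentiable.
  by rewrite [RHS]deriveE; [rewrite diff_comp//= diff_lin// deriveE|exact: differentiable_comp].
suff H i : c i ('D_u ('D_v f) z) = c i ('D_v ('D_u f) z).
  by rewrite [LHS]ec [RHS]ec; apply: eq_bigr => i _; rewrite H.
rewrite !lD; try by apply: Coo_at_diff; exact: Coo_at_derive.
have E w : \forall y \near z, (c i \o 'D_w f) y = 'D_w (c i \o f) y.
  by apply: filterS (Coo_at_near Cf) => y /Coo_at_diff; exact: lD.
rewrite (near_eq_derive _ (E v)) (near_eq_derive _ (E u)).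
apply: schwarz_scalar; have /Coo_atP[D [oD Dz H]] := Cf.
by apply/Coo_atP; exists D; split => // k; apply: Ck_lin.
Qed.

End mean_value.

(** * The implicit function theorem *)

(** Row vectors become a complete normed module, as Banach's fixed point theorem requires. *)
HB.instance Definition _ (R : realType) (m n : nat) := Complete.on 'M[R]_(m, n).

Section implicit.
Context {R : realType} {X : normedModType R} {m : nat}.
Hypothesis fdX : finite_dim X.
Local Notation Y := 'rV[R]_m.
Implicit Types (x : X) (y : Y).

Lemma rV_norm_leP (w : Y) (K : R) : 0 <= K ->
  (forall i, `|w 0 i| <= K) -> `|w| <= K.
Proof.
move=> K0 H; rewrite [leLHS]/Num.Def.normr /= mx_normrE bigmax_le // => -[i j] _ /=.
by rewrite (ord1 i).
Qed.

Lemma rV_coord_norm (w : Y) i : `|w 0 i| <= `|w|.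
Proof.
rewrite [leRHS]/Num.Def.normr /= mx_normrE.
exact: (le_bigmax _ (fun ij : 'I_1 * 'I_m => `|w ij.1 ij.2|) (0, i)).
Qed.

Lemma fdXY : finite_dim (X * Y)%type.
Proof. by apply: finite_dim_prod => //; exact: finite_dim_mx. Qed.

Lemma diff_coord_line (h : X * Y -> R) x y v : differentiable h (x, y) ->
  'D_(0, v) h (x, y) = \sum_j v 0 j * 'D_(0, delta_mx 0 j) h (x, y).
Proof.
move=> dh; rewrite deriveE //.
have -> : (0, v) = \sum_j v 0 j *: ((0 : X), delta_mx 0 j : Y) :> X * Y.
  have fstS (I : Type) r (F : I -> X * Y) : (\sum_(i <- r) F i).1 = \sum_(i <- r) (F i).1.
    by apply: (big_morph (@fst X Y)).
  have sndS (I : Type) r (F : I -> X * Y) : (\sum_(i <- r) F i).2 = \sum_(i <- r) (F i).2.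
    by apply: (big_morph (@snd X Y)).
  apply: injective_projections; rewrite ?fstS ?sndS /=.
    by rewrite big1 // => i _; rewrite scaler0.
  exact: row_sum_delta.
by rewrite linear_sum; apply: eq_bigr => j _; rewrite linearZ/= deriveE.
Qed.

(** Mean value theorem on the segment from [y'] to [y], which stays in the ball by convexity. Each
    of the [m] partial derivatives contributes at most [e] times the sup norm. *)
Lemma slope_bound (h : X * Y -> R) x y0 (r e : R) : 0 <= e ->
  (forall y, `|y0 - y| < r -> differentiable h (x, y) /\
    forall j, `|'D_(0, delta_mx 0 j) h (x, y)| <= e) ->
  forall y y', `|y0 - y| < r -> `|y0 - y'| < r ->
    `|h (x, y) - h (x, y')| <= m%:R * e * `|y - y'|.
Proof.
move=> e0 H y y' yr y'r.
have onl (s : R) : 0 <= s <= 1 -> `|y0 - (y' + s *: (y - y'))| < r.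
  move=> /andP[s0 s1].
  have -> : y0 - (y' + s *: (y - y')) = (1 - s) *: (y0 - y') + s *: (y0 - y).
    apply/rowP => i; rewrite !mxE; ring.
  apply: (le_lt_trans (ler_normD _ _)); rewrite !normrZ !ger0_norm ?subr_ge0//.
  (* Strictness comes from the second term, which is lost at [s = 0]. *)
  have [s_0|s_0] := eqVneq s 0; first by rewrite s_0 subr0 mul1r mul0r addr0.
  have {}s0 : 0 < s by rewrite lt_neqAle eq_sym s_0.
  have -> : r = (1 - s) * r + s * r by rewrite -mulrDl subrK mul1r.
  apply: ler_ltD; first by rewrite ler_wpM2l ?subr_ge0 // ltW.
  by rewrite ltr_pM2l.
have pE (s : R) : (x, y') + s *: (0, y - y') = (x, y' + s *: (y - y')) :> X * Y.
  by apply: injective_projections => //=; rewrite scaler0 addr0.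
have dl (s : R) : 0 <= s <= 1 -> differentiable h ((x, y') + s *: (0, y - y')).
  by move=> si; rewrite pE; exact: (H _ (onl s si)).1.
have [s si] := line_MVT ler01 dl.
rewrite !pE scale1r (addrC y') subrK mul1r => ->.
have [d1 d2] := H _ (onl s si).
rewrite diff_coord_line //; apply: (le_trans (ler_norm_sum _ _ _)).
apply: (@le_trans _ _ (\sum_(j < m) `|y - y'| * e)).
  by apply: ler_sum => j _; rewrite normrM ler_pM // rV_coord_norm.
have -> : \sum_(j < m) `|y - y'| * e = m%:R * (`|y - y'| * e).
  by rewrite sumr_const card_ord mulr_natl.
by rewrite (mulrC _ e) mulrA.
Qed.

(** A coordinate of the map sending y to y - G(x, y), whose fixed points are the zeros of G(x,
    .). *)
Let fixpoint_coord (G : X * Y -> Y) i (p : X * Y) : R := p.2 0 i - G p 0 i.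

Lemma coord_snd_Coo i (p : X * Y) : Coo_at (fun p : X * Y => p.2 0 i) p.
Proof. by apply: Coo_lin; [exact: fdXY|move=> a u v; rewrite /= !mxE]. Qed.

Lemma coord_Coo (V : normedModType R) (G : V -> Y) i z : Coo_at G z -> Coo_at (fun p : V => G p 0 i) z.
Proof.
apply: (@Coo_lin_comp _ _ _ _ _ (fun w : Y => w 0 i : R)); first exact: finite_dim_mx.
by move=> a u v; rewrite !mxE.
Qed.

Lemma derive_coord (V : normedModType R) (G : V -> Y) i z v : differentiable G z ->
  'D_v (fun p => G p 0 i) z = ('D_v G z) 0 i.
Proof. by move=> dG; rewrite derive_mx ?mxE //; exact: diff_derivable. Qed.

(** The derivative of y - G(x, y) in y vanishes at the base point and is continuous. The bound is
    such that [m] times it stays below 1/2, including for [m = 0] thanks to the added 1. *)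
Lemma implicit_contraction (G : X * Y -> Y) x0 y0 : Coo_at G (x0, y0) ->
  (forall v, 'd G (x0, y0) (0, v) = v) ->
  \forall p \near (x0, y0), Coo_at G p /\
    forall i j, `|'D_(0, delta_mx 0 j) (fixpoint_coord G i) p| <= (2 * (m%:R + 1))^-1.
Proof.
move=> CG dG; pose e : R := (2 * (m%:R + 1))^-1.
have e0 : 0 < e by rewrite invr_gt0 mulr_gt0 // ltr_wpDl.
have CH i : Coo_at (fixpoint_coord G i) (x0, y0).
  have := CooD (coord_snd_Coo i (x0, y0)) (CooZ (Coo_cst (-1 : R) _) (coord_Coo i CG)).
  by apply: Coo_at_eq; near=> p; rewrite /fixpoint_coord /= scaleN1r.
have DH i j : 'D_(0, delta_mx 0 j) (fixpoint_coord G i) (x0, y0) = 0.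
  have dG0 := Coo_at_diff CG.
  have d1 := Coo_at_diff (coord_snd_Coo i (x0, y0)).
  have d2 := Coo_at_diff (coord_Coo i CG).
  rewrite -[fixpoint_coord G i]/((fun p : X * Y => p.2 0 i) - (fun p => G p 0 i)).
  rewrite deriveB; [|exact: diff_derivable|exact: diff_derivable].
  rewrite (derive_coord i _ dG0) (deriveE _ dG0) dG deriveE // diff_linear //=.
  + by rewrite subrr.
  + exact: fdXY.
  + by move=> a u v; rewrite /= !mxE.
apply: (filterI (Coo_at_near CG)).
have nF : Filter (nbhs ((x0, y0) : X * Y)) by exact: nbhs_filter.
apply: (@filter_forall _ _ _ _ nF) => i; apply: (@filter_forall _ _ _ _ nF) => j.
have /Coo_at_continuous/cvgrPdist_lt/(_ e e0) := Coo_at_derive (0, delta_mx 0 j) (CH i).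
rewrite DH; apply: filterS => p /ltW; by rewrite sub0r normrN.
Unshelve. all: by end_near. Qed.

Lemma ltr_prod_norm (p q : X * Y) (r : R) :
  (`|p - q| < r) = (`|p.1 - q.1| < r) && (`|p.2 - q.2| < r).
Proof. by rewrite prod_normE /= gt_max. Qed.

Lemma implicit_half (G : X * Y -> Y) x0 y0 (r : R) :
  (forall p, `|(x0, y0) - p| < r -> Coo_at G p /\
    forall i j, `|'D_(0, delta_mx 0 j) (fixpoint_coord G i) p| <= (2 * (m%:R + 1))^-1) ->
  forall x y y', `|x0 - x| < r -> `|y0 - y| < r -> `|y0 - y'| < r ->
    `|(y - G (x, y)) - (y' - G (x, y'))| <= 2^-1 * `|y - y'|.
Proof.
move=> H x y y' xr yr y'r; have m1 : 0 < m%:R + 1 :> R by rewrite ltr_wpDl.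
apply: rV_norm_leP => [|i]; first by rewrite mulr_ge0 // invr_ge0.
have -> : ((y - G (x, y)) - (y' - G (x, y'))) 0 i = fixpoint_coord G i (x, y) - fixpoint_coord G i (x, y').
  by rewrite /fixpoint_coord /= !mxE.
have e0 : 0 <= (2 * (m%:R + 1))^-1 :> R by rewrite invr_ge0 mulr_ge0 // ltW.
have Hx y1 : `|y0 - y1| < r -> differentiable (fixpoint_coord G i) (x, y1) /\
    forall j, `|'D_(0, delta_mx 0 j) (fixpoint_coord G i) (x, y1)| <= (2 * (m%:R + 1))^-1.
  move=> y1r; have [|C1 C2] := H (x, y1); first by rewrite ltr_prod_norm xr y1r.
  split; last by move=> j; exact: C2.
  apply: differentiableB; apply: Coo_at_diff; first exact: coord_snd_Coo.
  exact: coord_Coo.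
apply: (le_trans (slope_bound e0 Hx yr y'r)).
rewrite ler_wpM2r // ler_pdivrMr ?mulr_gt0 // mulrA mulVf // mul1r; lra.
Qed.

(** The map y - G(x, y) moves the centre by less than rho / 4 and halves distances, so it sends the
    closed ball strictly inside itself. Banach's theorem applies, and the slack puts the fixed point
    in the open ball. *)
Lemma implicit_fixpoint (G : X * Y -> Y) x y0 (rho : R) : 0 < rho ->
  (forall y y', `|y0 - y| <= rho -> `|y0 - y'| <= rho ->
    `|(y - G (x, y)) - (y' - G (x, y'))| <= 2^-1 * `|y - y'|) ->
  `|G (x, y0)| < rho / 4 ->
  exists2 y, `|y0 - y| < rho & G (x, y) = 0.
Proof.
move=> r0 H Gx; pose T y := y - G (x, y).
have bT y : `|y0 - y| <= rho -> `|y0 - T y| < rho.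
  move=> yr; have -> : y0 - T y = T y0 - T y + G (x, y0) by rewrite /T addrAC subrK.
  apply: (le_lt_trans (ler_normD _ _)).
  have := H y0 y _ yr; rewrite subrr normr0 => /(_ (ltW r0)); rewrite -/(T y0) -/(T y).
  move: Gx yr; lra.
pose U := closed_ball_ (@Num.Def.normr R 'rV[R]_m) y0 rho.
have fU : {homo T : y / U y >-> U y} by move=> y /bT/ltW.
pose f : {fun U >-> U} := mkfun_fun fU.
have cf : is_contraction f.
  exists (2^-1)%:nng; split; first by rewrite /= invf_lt1 ?ltr1n.
  by move=> [y y'] [/= Uy Uy']; exact: H.
have clU : closed U by rewrite /U -(closed_ballE _ r0); exact: closed_ball_closed.
have neU : U !=set0 by exists y0; rewrite /U /closed_ball_ /= subrr normr0 ltW.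
have [y Uy Ey] := banach_fixed_point cf clU neU.
exists y; first by rewrite Ey; exact: bT.
by move: Ey; rewrite -[f y]/(T y) /T => /eqP; rewrite eq_sym -subr_eq0 addrAC subrr add0r oppr_eq0 => /eqP.
Qed.

(* Transposed with respect to the usual convention: it acts on row vectors from
   the right. *)
Definition partial_jacobian (G : X * Y -> Y) (p : X * Y) : 'M[R]_m :=
  \matrix_(j, i) ('D_(0, delta_mx 0 j) G p) 0 i.

Lemma partial_jacobianE (G : X * Y -> Y) p v : differentiable G p ->
  'd G p (0, v) = v *m partial_jacobian G p.
Proof.
case: p => x y dG; rewrite -deriveE //; apply/rowP => i.
have dGi : differentiable (fun p => G p 0 i) (x, y).
  apply: (@differentiable_comp _ _ _ _ G (fun w : Y => w 0 i : R)) => //.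
  exact: differentiable_coord.
rewrite -derive_coord // diff_coord_line // !mxE; apply: eq_bigr => j _.
by rewrite derive_coord // mxE.
Qed.

Lemma Ck_coord (V : normedModType R) k (D : set V) (G : V -> Y) i : open D ->
  Ck k D G -> Ck k D (fun p => G p 0 i).
Proof.
move=> oD; apply: (@Ck_linear_comp _ _ _ _ _ _ _ (fun w : Y => w 0 i : R)) => //.
  exact: finite_dim_mx.
by move=> a u v; rewrite !mxE.
Qed.

Lemma Ck_partial_jacobian (G : X * Y -> Y) (D : set (X * Y)%type) k j i : open D ->
  Cinf D G -> Ck k D (fun p => partial_jacobian G p j i).
Proof.
move=> oD CG; apply: (@Ck_eq _ _ _ _ _ (fun p => ('D_(0, delta_mx 0 j) G p) 0 i)) => //.
  by move=> x _; rewrite mxE.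
by apply: Ck_coord => //; exact: Cinf_derive.
Qed.

(* The formula for ['D_v g] is the derivative of the equation [G (x, g x) = 0]. *)
Lemma implicit_diff (G : X * Y -> Y) (g : X -> Y) x (K : R) :
  differentiable G (x, g x) -> partial_jacobian G (x, g x) \in unitmx ->
  (\forall h \near 0, `|g (h + x) - g x| <= K * `|G (h + x, g x) - G (x, g x)|) ->
  (\forall h \near 0, G (h + x, g (h + x)) = 0) ->
  differentiable g x /\ forall v,
    'D_v g x = - ('D_(v, 0) G (x, g x) *m invmx (partial_jacobian G (x, g x))).
Proof.
set y := g x; set J := partial_jacobian G (x, y); move=> dG uJ Hk HG.
have G0 : G (x, y) = 0 by have := nbhs_singleton HG; rewrite add0r.
pose D v : Y := - ('d G (x, y) (v, 0) *m invmx J).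
have linD : linear D.
  move=> a u v; rewrite /D.
  have -> : (a *: u + v, 0) = a *: (u, 0) + (v, 0) :> X * Y.
    by apply: injective_projections => //=; rewrite scaler0 addr0.
  by rewrite linearP mulmxDl opprD -scalemxAl scalerN.
have [L cL LE] := linear_packed fdX linD.
have linJ : linear (fun w : Y => w *m invmx J).
  by move=> a u v; rewrite mulmxDl scalemxAl.
have [LJ cLJ LJE] := linear_packed (@finite_dim_mx R 1 m) linJ.
have [C C0 HC] := linear_lipschitz cLJ.
have [C1 C10 HC1] := linear_lipschitz (diff_continuous dG).
(* Growth rate of [g]: the increment of [G] in [x] alone is at most [(C1 + 1)] times [|h|], where
   [C1] bounds the differential and 1 is the tolerance chosen for its remainder. *)
pose K' := `|K| * (C1 + 1).
have K'0 : 0 <= K' by rewrite mulr_ge0 // addr_ge0 // ltW.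
have pair_norm (h : X) (k : Y) : `|(h, k)| = Num.max `|h| `|k| by rewrite prod_normE.
have dG' e : 0 < e -> exists2 d : R, 0 < d & forall h k, `|h| < d -> `|k| < d ->
    `|G (h + x, k + y) - 'd G (x, y) (h, k)| <= e * `|(h, k)|.
  move=> e0; have /nbhs_norm0P[d d0 Hd] := diff_eps dG e0.
  exists d => // h k hd kd; have := Hd (h, k).
  rewrite G0 subr0; apply; by rewrite /= pair_norm gt_max hd.
have growth : \forall h \near 0, `|g (h + x) - y| <= K' * `|h|.
  have [d d0 Hd] := dG' 1 ltr01.
  have := nbhs0_lt (V := X) d0; move: Hk; apply: filterS2 => h Hh hd.
  apply: (le_trans Hh); rewrite G0 subr0.
  apply: (@le_trans _ _ (`|K| * `|G (h + x, y)|)); first by rewrite ler_wpM2r // ler_norm.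
  rewrite /K' -mulrA ler_wpM2l //.
  have := Hd h 0 hd; rewrite normr0 add0r mul1r => /(_ d0) H1.
  rewrite -[G (h + x, y)](subrK ('d G (x, y) (h, 0))) (le_trans (ler_normD _ _)) //.
  have nh : `|(h, 0 : Y)| = `|h| by rewrite pair_norm normr0; apply/max_idPl.
  have := HC1 (h, 0); rewrite nh; move: H1; rewrite nh; lra.
have [dg gE] : differentiable g x /\ 'd g x = L :> (X -> Y); last first.
  split => // v; rewrite deriveE // gE -LE /D deriveE //.
apply: differentiable_eps => // e e0.
(* The final error loses a factor [C] through [invmx J] and a factor [1 + K'] in bounding the pair
   [(h, k)] by [h]. *)
pose e' := e / (C * (1 + K')).
have CK : 0 < C * (1 + K') by rewrite mulr_gt0 // ltr_wpDr.
have [d d0 Hd] := dG' e' (divr_gt0 e0 CK).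
have dK : 0 < d / (1 + K') by rewrite divr_gt0 // ltr_wpDr.
apply: filterS3 (nbhs0_lt (V := X) dK) growth HG => h hd gr Gh.
set k := g (h + x) - y in gr *.
have kE : g (h + x) = k + y by rewrite subrK.
have h_d : `|h| < d by apply: (lt_le_trans hd); rewrite ler_pdivrMr ?ler_pMr ?lerDl // ltr_wpDr.
have k_d : `|k| < d.
  apply: (le_lt_trans gr); move: hd; rewrite ltr_pdivlMr ?ltr_wpDr // mulrC.
  by apply: le_lt_trans; rewrite ler_wpM2r // lerDr.
have := Hd h k h_d k_d; rewrite -kE Gh sub0r normrN.
(* As [G] vanishes at both ends, ['d G (x, y) (h, k)] is a pure remainder; multiplied by the inverse
   Jacobian it is exactly the error of [L]. *)
have -> : k - L h = 'd G (x, y) (h, k) *m invmx J.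
  have -> : (h, k) = (0, k) + (h, 0) :> X * Y.
    by apply: injective_projections => /=; rewrite ?add0r ?addr0.
  rewrite linearD /= partial_jacobianE // -/J mulmxDl mulmxK //.
  by rewrite -[L h]/((L : X -> Y) h) -LE /D opprK.
move=> Hhk; have -> : forall w : Y, w *m invmx J = LJ w by move=> w; rewrite -[LJ w]/((LJ : Y -> Y) w) -LJE.
apply: (le_trans (HC _)).
apply: (@le_trans _ _ (C * (e' * ((1 + K') * `|h|)))); last first.
  by rewrite mulrA (mulrC C) -mulrA (mulrA C) /e' mulrA divfK // gt_eqF.
apply: ler_wpM2l; first exact: ltW.
apply: (le_trans Hhk); apply: ler_wpM2l; first by rewrite ltW // divr_gt0.
rewrite pair_norm ge_max mulrDl mul1r lerDl mulr_ge0 //= (le_trans gr) // lerDr //.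
Qed.

(** In this normalised case Newton's iteration with frozen derivative is y - G(x, y), so no inverse
    matrix enters the contraction argument. *)
Theorem implicit_id (G : X * Y -> Y) x0 y0 (N : set Y) : Coo_at G (x0, y0) ->
  G (x0, y0) = 0 -> (forall v, 'd G (x0, y0) (0, v) = v) -> nbhs y0 N ->
  exists (A : set X) (B : set Y) (g : X -> Y),
  [/\ open A /\ A x0, open B /\ B y0, B `<=` N, Cinf A g &
      forall x, A x -> B (g x) /\ forall y, B y -> (G (x, y) = 0 <-> y = g x)].
Proof.
move=> CG G0 dG nN; have [D [oD Dp CD]] := (Coo_atP _ _).1 CG.
have J1 : partial_jacobian G (x0, y0) = 1%:M.
  have dG0 := Coo_at_diff CG.
  by apply/row_matrixP => i; rewrite !rowE -partial_jacobianE // dG mulmx1.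
have detJ : Ck 0 D (fun p => \det (partial_jacobian G p)).
  by apply: Ck_det => // i j; exact: Ck_partial_jacobian.
have nD : \forall p \near (x0, y0), D p by exact: open_nbhs_nbhs.
have nJ : \forall p \near (x0, y0), partial_jacobian G p \in unitmx.
  have /differentiable_continuous/cvgrPdist_lt/(_ 1 ltr01) := Ck_diff detJ Dp.
  rewrite J1 det1; apply: filterS => p; rewrite unitmxE unitfE.
  by apply: contraTneq => ->; rewrite subr0 normr1 ltxx.
have nN' : \forall p \near (x0, y0), N p.2 by exact: (@cvg_snd _ _ (nbhs x0) (nbhs y0)).
have : \forall p \near (x0, y0), (D p /\ partial_jacobian G p \in unitmx) /\
    (N p.2 /\ (Coo_at G p /\ forall i j,
      `|'D_(0, delta_mx 0 j) (fixpoint_coord G i) p| <= (2 * (m%:R + 1))^-1)).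
  have C := implicit_contraction CG dG.
  by apply: filterI; apply: filterI.
move=> /nbhs_normP[r r0 Hr].
have half := implicit_half (fun p pr => (Hr p pr).2.2).
pose rho := r / 2.
have rho0 : 0 < rho by rewrite divr_gt0.
have rhor : rho < r by rewrite ltr_pdivrMr // ltr_pMr // ltr1n.
have Gx0 : \forall x \near x0, `|G (x, y0)| < rho / 4.
  have dl : differentiable (fun x : X => G (x, y0)) x0.
    apply: (@differentiable_comp _ _ _ _ (fun x => (x, y0)) G); last exact: Coo_at_diff.
    exact: differentiable_pair.
  have r4 : 0 < rho / 4 by rewrite divr_gt0.
  have /differentiable_continuous/cvgrPdist_lt/(_ _ r4) := dl.
  by rewrite G0; apply: filterS => x; rewrite sub0r normrN.
have : \forall x \near x0, `|x0 - x| < r /\ `|G (x, y0)| < rho / 4.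
  by apply: filterI => //; apply/nbhs_normP; exists r.
rewrite /prop_near1 nbhsE => -[A [oA Ax0] HA].
have fixp x : A x -> exists2 y, `|y0 - y| < rho & G (x, y) = 0.
  move=> /HA[xr Gr]; apply: implicit_fixpoint => // y y' yr y'r.
  by apply: half => //; apply: le_lt_trans rhor.
(* The contraction property bounds y - y' by its half plus the increment of [G]. This gives both
   uniqueness of the zero and the constant 2 handed to [implicit_diff]. *)
have uniq x y y' : A x -> `|y0 - y| < r -> `|y0 - y'| < r ->
    `|y - y'| <= 2 * `|G (x, y) - G (x, y')|.
  move=> /HA[xr _] yr y'r; have := half x y y' xr yr y'r.
  have : `|y - y'| <= `|y - G (x, y) - (y' - G (x, y'))| + `|G (x, y) - G (x, y')|.
    have E : y - y' = (y - G (x, y) - (y' - G (x, y'))) + (G (x, y) - G (x, y')).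
      by apply/rowP => i; rewrite !mxE; ring.
    by rewrite [in leLHS]E; exact: ler_normD.
  lra.
pose g x := xget y0 [set y | `|y0 - y| < rho /\ G (x, y) = 0].
(* Over [A] a zero exists, so the default [y0] of [xget] is never returned there for want of a
   zero. *)
have gP x : A x -> `|y0 - g x| < rho /\ G (x, g x) = 0.
  move=> /fixp[y yr Gy]; rewrite /g; case: xgetP => [z _ [zr Gz]|/(_ y)] //.
  by move=> []; split.
have gr x : A x -> `|(x0, y0) - (x, g x)| < r.
  move=> Ax; rewrite ltr_prod_norm /= (HA _ Ax).1 /=.
  by apply: lt_trans rhor; have [] := gP x Ax.
have oB : open (ball y0 rho) by exact: ball_open.
have BE y : ball y0 rho y <-> `|y0 - y| < rho by rewrite -ball_normE.
have dg x : A x -> differentiable g x /\ forall v, 'D_v g x =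
    - ('D_(v, 0) G (x, g x) *m invmx (partial_jacobian G (x, g x))).
  move=> Ax; have [[Dx Jx] _] := Hr _ (gr x Ax).
  have nA : \forall h \near 0, A (h + x).
    by apply: (near_shift0 (P := A)); exact: open_nbhs_nbhs.
  apply: (@implicit_diff _ _ _ 2) => //.
  - exact: (Cinf_diff CD).
  - have [gxr Gx] := gP x Ax; apply: filterS nA => h Ah; have [ghr Gh] := gP _ Ah.
    apply: (le_trans (uniq _ _ _ Ah (lt_trans ghr rhor) (lt_trans gxr rhor))).
    by rewrite Gh Gx sub0r subr0 normrN.
  - by apply: filterS nA => h /gP[].
exists A, (ball y0 rho), g; split => //.
- by split => //; apply/BE; rewrite subrr normr0.
- move=> y /BE yr; have pr : `|(x0, y0) - (x0, y)| < r.
    by rewrite ltr_prod_norm /= subrr normr0 r0 (lt_trans yr).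
  exact: (Hr (x0, y) pr).2.1.
- pose O := [set p | ball_ (@Num.Def.normr R (X * Y)%type) (x0, y0) r p].
  have oO : open O.
    rewrite /O; have -> : [set p | ball_ (@Num.Def.normr R (X * Y)%type) (x0, y0) r p] = ball (x0, y0) r.
      by rewrite -ball_normE.
    exact: ball_open.
  have OD : O `<=` D by move=> p /Hr[[]].
  (* Bootstrap: ['D_v g] is a smooth function [Hv] of the pair of [x] and [g x], so order [k] for
     [g] gives order [k + 1]. *)
  elim => [|k IH]; first by split => // x /dg[].
  split => [x /dg[] //|v].
  pose Hv (p : X * Y) := - ('D_(v, 0) G p *m invmx (partial_jacobian G p)).
  have CHv : Ck k O Hv.
    pose S (p : X * Y) := \sum_i (- 'D_(v, 0) G p 0 i) *: row i (invmx (partial_jacobian G p)).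
    apply: (@Ck_eq _ _ _ _ _ S) => //.
      move=> p _; rewrite /S /Hv mulmx_sum_row -sumrN; apply: eq_bigr => i _.
      by rewrite scaleNr.
    apply: Ck_sum => // i; apply: CkZ => //.
      apply: (@Ck_linear_comp _ _ _ _ _ _ _ (fun w : Y => - w 0 i : R)) => //.
      + exact: finite_dim_mx.
      + by move=> a u w; rewrite !mxE opprD -mulrN.
      + by apply: Cinf_derive; apply: Cinf_sub CD.
    apply: (@Ck_linear_comp _ _ _ _ _ _ _ (row i)) => //.
    + exact: finite_dim_mx.
    + by move=> a u w; rewrite linearP.
    + apply: Ck_invmx => // [p /Hr[[]] //|i' j'].
      by apply: Ck_partial_jacobian => //; apply: Cinf_sub CD.
  apply: (@Ck_eq _ _ _ _ _ (Hv \o (fun x => (x, g x)))); [exact: oA| |].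
    by move=> x /dg[_ ->].
  apply: (@Ck_comp _ _ _ _ _ _ O).
  + exact: fdXY.
  + exact: oA.
  + exact: oO.
  + by move=> x Ax; exact: gr.
  + by apply: Ck_pair; [exact: oA|exact: Ck_id|exact: IH].
  + exact: CHv.
move=> x Ax; have [gxr Gx] := gP x Ax; split; first exact/BE.
move=> y /BE yr; split => [Gy|->//].
have := uniq x y (g x) Ax (lt_trans yr rhor) (lt_trans gxr rhor).
by rewrite Gy Gx subrr normr0 mulr0 normr_le0 subr_eq0 => /eqP.
Qed.

(** Multiplying [G] by the inverse of its partial Jacobian preserves the zeros and reduces to the
    normalised case. *)
Theorem implicit_function (G : X * Y -> Y) x0 y0 (N : set Y) :
  Coo_at G (x0, y0) -> G (x0, y0) = 0 ->
  partial_jacobian G (x0, y0) \in unitmx -> nbhs y0 N ->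
  exists (A : set X) (B : set Y) (g : X -> Y),
  [/\ open A /\ A x0, open B /\ B y0, B `<=` N, Cinf A g &
      forall x, A x -> B (g x) /\ forall y, B y -> (G (x, y) = 0 <-> y = g x)].
Proof.
move=> CG G0 uJ nN; pose J := partial_jacobian G (x0, y0).
pose l (w : Y) := w *m invmx J.
have linl : linear l by move=> a u v; rewrite /l mulmxDl scalemxAl.
have fdY := @finite_dim_mx R 1 m.
have CG' : Coo_at (fun p => l (G p)) (x0, y0) by exact: (Coo_lin_comp _ linl).
have [||A [B [g [HA HB BN Cg Hg]]]] := implicit_id CG' _ _ nN.
- by rewrite G0 /l mul0mx.
- move=> v; have dG := Coo_at_diff CG.
  have dl := Coo_at_diff (Coo_lin (G (x0, y0)) fdY linl).
  by rewrite (diff_comp dG dl) /= diff_linear // partial_jacobianE // /l mulmxK.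
exists A, B, g; split => // x Ax; have [gB gU] := Hg x Ax; split => // y By.
rewrite -(gU y By) /l; split => [->|H]; first by rewrite mul0mx.
by rewrite -[LHS](mulmxKV uJ) H mul0mx.
Qed.

End implicit.

(** * Charts and smooth maps *)

Section atlas.
Context {R : realType}.
Implicit Types (V W E : normedModType R).

Record atlas V (T : topologicalType) (A : charted T V) : Prop := Atlas {
  atlas_dom : forall x, dom (A x) x;
  atlas_open : forall x, open (dom (A x));
  atlas_image : forall x, open (fwd (A x) @` dom (A x));
  atlas_bwdK : forall x y, dom (A x) y -> bwd (A x) (fwd (A x) y) = y;
  atlas_fwd : forall x y, dom (A x) y -> {for y, continuous (fwd (A x))};
  atlas_bwd : forall x z, (fwd (A x) @` dom (A x)) z ->
    {for z, continuous (bwd (A x))};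
  atlas_change : forall x y z, (fwd (A x) @` (dom (A x) `&` dom (A y))) z ->
    Coo_at (fwd (A y) \o bwd (A x)) z }.

Lemma manifold_atlas V (T : topologicalType) (A : charted T V) :
  is_manifold A -> atlas A.
Proof. by move=> [_ _ H1 H2]; split => [x|x|x|x|x|x|//]; have [? ? ? ? []] := H1 x. Qed.

Lemma id_atlas V : atlas (id_charts V : charted V V).
Proof.
split => //=.
- by move=> x; exact: openT.
- by move=> x; rewrite image_id; exact: openT.
- by move=> x y _; exact: cvg_id.
- by move=> x z _; exact: cvg_id.
- by move=> x y z _; exact: Coo_id.
Qed.

Lemma openX (S T : topologicalType) (A : set S) (B : set T) :
  open A -> open B -> open (A `*` B).
Proof.
rewrite !openE => oA oB [x y] [/= /oA Ax /oB By].
by exists (A, B).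
Qed.

Lemma continuous_pair (T U S : topologicalType) (f : T -> U) (g : T -> S) x :
  {for x, continuous f} -> {for x, continuous g} ->
  {for x, continuous (fun y => (f y, g y))}.
Proof. by move=> cf cg; exact: (cvg_pair cf cg). Qed.

Lemma Coo_prod V W V' W' (f : V -> V') (g : W -> W') z : finite_dim V -> finite_dim W ->
  Coo_at f z.1 -> Coo_at g z.2 -> Coo_at (fun p : V * W => (f p.1, g p.2)) z.
Proof.
move=> fV fW Cf Cg; apply: Coo_pair.
  by apply: (@Coo_comp _ _ _ _ fst f) => //; apply: Coo_lin => //; exact: finite_dim_prod.
by apply: (@Coo_comp _ _ _ _ snd g) => //; apply: Coo_lin => //; exact: finite_dim_prod.
Qed.

Lemma prod_atlas V W (S T : topologicalType) (A : charted S V) (B : charted T W) :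
  finite_dim V -> finite_dim W -> atlas A -> atlas B -> atlas (prod_charts A B).
Proof.
move=> fV fW aA aB.
have imE (x : S * T) (P : set S) (Q : set T) :
    fwd (prod_charts A B x) @` (P `*` Q) = (fwd (A x.1) @` P) `*` (fwd (B x.2) @` Q).
  apply/seteqP; split => [_ [[p q] [/= Pp Qq] <-]|[v w] /= [[p Pp <-] [q Qq <-]]].
    by split; [exists p|exists q].
  by exists (p, q).
split => [x|x|x|x [y1 y2]|x [y1 y2]|x z|x y z].
- by split; exact: atlas_dom.
- by apply: openX; exact: atlas_open.
- by rewrite imE; apply: openX; exact: atlas_image.
- by move=> [/= Ay By]; rewrite /= !atlas_bwdK.
- move=> [/= Ay By].
  apply: (@continuous_pair _ _ _ (fun y => fwd (A x.1) y.1) (fun y => fwd (B x.2) y.2)).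
    apply: (@continuous_comp _ _ _ fst (fwd (A x.1))); first exact: cvg_fst.
    exact: atlas_fwd.
  apply: (@continuous_comp _ _ _ snd (fwd (B x.2))); first exact: cvg_snd.
  exact: atlas_fwd.
- rewrite imE => -[/= Az Bz].
  apply: (@continuous_pair _ _ _ (fun y => bwd (A x.1) y.1) (fun y => bwd (B x.2) y.2)).
    apply: (@continuous_comp _ _ _ fst (bwd (A x.1))); first exact: cvg_fst.
    exact: atlas_bwd.
  apply: (@continuous_comp _ _ _ snd (bwd (B x.2))); first exact: cvg_snd.
  exact: atlas_bwd.
- have -> : dom (prod_charts A B x) `&` dom (prod_charts A B y) =
      (dom (A x.1) `&` dom (A y.1)) `*` (dom (B x.2) `&` dom (B y.2)).
    apply/seteqP; split => [[p q] [[/= ? ?] [/= ? ?]]|[p q] [/= [? ?] [? ?]]] //.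
  rewrite imE => -[Az Bz].
  apply: (@Coo_prod _ _ _ _ (fwd (A y.1) \o bwd (A x.1)) (fwd (B y.2) \o bwd (B x.2))) => //.
    exact: atlas_change.
  exact: atlas_change.
Qed.

Section smooth.
Context {V W E : normedModType R} {S T : topologicalType} {M : Type}.
Context {A : charted S V} {B : charted T W} {C : charted M E}.
Hypotheses (aB : atlas B) (fW : finite_dim W).

Lemma atlas_near_dom (x y : T) : dom (B x) y -> \forall y' \near y, dom (B x) y'.
Proof. by move=> xy; apply: open_nbhs_nbhs; split => //; exact: atlas_open. Qed.

Lemma atlas_near_image (x : T) z : (fwd (B x) @` dom (B x)) z ->
  \forall z' \near z, (fwd (B x) @` dom (B x)) z'.
Proof. by move=> xz; apply: open_nbhs_nbhs; split => //; exact: atlas_image. Qed.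

Lemma smooth_chart (x y : T) : dom (B x) y -> smooth_at B (id_charts W) (fwd (B x)) y.
Proof.
move=> xy; split; first by near=> z.
apply: atlas_change => //; exists y => //; split => //; exact: atlas_dom.
Unshelve. all: by end_near. Qed.

Lemma smooth_chart_inv (x : T) z : (fwd (B x) @` dom (B x)) z ->
  smooth_at (id_charts W) B (bwd (B x)) z.
Proof.
move=> xz; split; last first.
  apply: atlas_change => //; have [y xy <-] := xz; exists y => //; split => //.
  by rewrite atlas_bwdK //; exact: atlas_dom.
by apply: (atlas_bwd aB xz); apply: atlas_near_dom; exact: atlas_dom.
Qed.

(** [smooth_at] speaks of coordinates only; continuity for the topology of [T] returns because [f]
    is locally the continuous inverse chart after its coordinate expression. *)
Lemma smooth_continuous (f : E -> T) z :
  smooth_at (id_charts E) B f z -> {for z, continuous f}.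
Proof.
move=> [/= Df /Coo_at_continuous Cf].
have : {for z, continuous (bwd (B (f z)) \o (fwd (B (f z)) \o f))}.
  apply: continuous_comp => //; apply: (atlas_bwd aB); exists (f z) => //.
  exact: atlas_dom.
rewrite /prop_for /continuous_at /= atlas_bwdK //; last exact: atlas_dom.
apply: cvg_trans; apply: near_eq_cvg.
by apply: filterS Df => w; exact: atlas_bwdK.
Qed.

End smooth.

(** * Chain rules *)

Section smooth_comp.
Context {V W E : normedModType R} {S T M : Type}.
Context {A : charted S V} {B : charted T W} {C : charted M E}.

Section within.
Variables (f : S -> T) (g : T -> M) (x : S).
Hypothesis xK : bwd (A x) (fwd (A x) x) = x.
Hypothesis BK : \forall z \near fwd (A x) x,
  bwd (B (f x)) (fwd (B (f x)) (f (bwd (A x) z))) = f (bwd (A x) z).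

Let smooth_comp_center :
  (fwd (B (f x)) \o f \o bwd (A x)) (fwd (A x) x) = fwd (B (f x)) (f x).
Proof. by rewrite /= xK. Qed.

Let smooth_comp_near : \forall z \near fwd (A x) x,
  ((fwd (C (g (f x))) \o g \o bwd (B (f x))) \o (fwd (B (f x)) \o f \o bwd (A x))) z
  = (fwd (C (g (f x))) \o (g \o f) \o bwd (A x)) z.
Proof. by apply: filterS BK => z /= ->. Qed.

(** Inversion of the middle chart is required along [f] only ([BK]): a slice chart inverts on the
    submanifold but not on its whole open domain. *)
Lemma smooth_comp_within : finite_dim W ->
  smooth_at A B f x -> smooth_at B C g (f x) -> smooth_at A C (g \o f) x.
Proof.
move=> fW [Df Cf] [Dg Cg]; split; last first.
  apply: (Coo_at_eq smooth_comp_near).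
  by apply: (Coo_comp fW Cf); rewrite smooth_comp_center; exact: Cg.
have /Coo_at_continuous := Cf; rewrite /prop_for /continuous_at smooth_comp_center.
by move=> /(_ _ Dg); apply: filterS2 BK => z /= ->.
Qed.

Lemma tangent_comp_within u : smooth_at A B f x -> smooth_at B C g (f x) ->
  tangent_map A C (g \o f) x u = tangent_map B C g (f x) (tangent_map A B f x u).
Proof.
move=> [Df Cf] [Dg Cg]; have df := Coo_at_diff Cf.
have dg : differentiable (fwd (C (g (f x))) \o g \o bwd (B (f x)))
    ((fwd (B (f x)) \o f \o bwd (A x)) (fwd (A x) x)).
  by rewrite smooth_comp_center; exact: Coo_at_diff.
rewrite /tangent_map (near_eq_diff smooth_comp_near (differentiable_comp df dg)).2.
by rewrite (diff_comp df dg) /= xK.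
Qed.

End within.

Lemma smooth_comp (f : S -> T) (g : T -> M) x : finite_dim W ->
  bwd (A x) (fwd (A x) x) = x ->
  (forall y, dom (B (f x)) y -> bwd (B (f x)) (fwd (B (f x)) y) = y) ->
  smooth_at A B f x -> smooth_at B C g (f x) -> smooth_at A C (g \o f) x.
Proof.
move=> fW xK BK sf; apply: smooth_comp_within => //.
by have [Df _] := sf; apply: filterS Df => z; exact: BK.
Qed.

Lemma tangent_comp (f : S -> T) (g : T -> M) x u :
  bwd (A x) (fwd (A x) x) = x ->
  (forall y, dom (B (f x)) y -> bwd (B (f x)) (fwd (B (f x)) y) = y) ->
  smooth_at A B f x -> smooth_at B C g (f x) ->
  tangent_map A C (g \o f) x u = tangent_map B C g (f x) (tangent_map A B f x u).
Proof.
move=> xK BK sf; apply: tangent_comp_within => //.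
by have [Df _] := sf; apply: filterS Df => z; exact: BK.
Qed.

Lemma smooth_center (f : S -> M) x : bwd (A x) (fwd (A x) x) = x ->
  smooth_at A C f x <-> smooth_at (id_charts V) C (f \o bwd (A x)) (fwd (A x) x).
Proof. by move=> xK; rewrite /smooth_at /= xK. Qed.

Lemma tangent_center (f : S -> M) x u : bwd (A x) (fwd (A x) x) = x ->
  tangent_map A C f x u = tangent_map (id_charts V) C (f \o bwd (A x)) (fwd (A x) x) u.
Proof. by move=> xK; rewrite /tangent_map /= xK. Qed.

End smooth_comp.

Lemma smooth_eq V T' (B : charted T' V) E (f g : E -> T') z :
  (\forall w \near z, f w = g w) -> smooth_at (id_charts E) B f z ->
  smooth_at (id_charts E) B g z.
Proof.
move=> fg [/= D C]; have fgz := nbhs_singleton fg; split => /=; rewrite -fgz.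
  by apply: filterS2 fg D => w ->.
by apply: Coo_at_eq C; apply: filterS fg => w /= ->.
Qed.

Lemma tangent_eq V T' (B : charted T' V) E (f g : E -> T') z u :
  (\forall w \near z, f w = g w) -> smooth_at (id_charts E) B f z ->
  tangent_map (id_charts E) B g z u = tangent_map (id_charts E) B f z u.
Proof.
move=> fg [/= D C]; have fgz := nbhs_singleton fg.
rewrite /tangent_map /= -fgz.
have fE : \forall w \near z, (fwd (B (f z)) \o f \o idfun) w = (fwd (B (f z)) \o g \o idfun) w.
  by apply: filterS fg => w /= ->.
by rewrite (near_eq_diff fE (Coo_at_diff C)).2.
Qed.

Lemma smooth_id V W (f : V -> W) z :
  smooth_at (id_charts V) (id_charts W) f z <-> Coo_at f z.
Proof. by split => [[]|Cf] //; split => //; near=> w.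
Unshelve. all: by end_near. Qed.

End atlas.

(** * Exterior derivatives and pull-backs *)

Section exterior.
Context {R : realType}.
Implicit Types (V E : normedModType R).

Lemma derive_bigsum V E I (r : seq I) (F : I -> E -> V) z :
  (forall i, differentiable (F i) z) ->
  differentiable (fun x => \sum_(i <- r) F i x) z /\
  forall u, 'D_u (fun x => \sum_(i <- r) F i x) z = \sum_(i <- r) 'D_u (F i) z.
Proof.
move=> dF; elim: r => [|i r [IH1 IH2]].
  have -> : (fun x => \sum_(i <- [::]) F i x) = cst (0 : V).
    by apply/funext => x; rewrite big_nil.
  by split => // u; rewrite derive_cst big_nil.
have -> : (fun x => \sum_(j <- i :: r) F j x) = F i + (fun x => \sum_(j <- r) F j x).
  by apply/funext => x; rewrite big_cons.
split => [|u]; first exact: differentiableD.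
by rewrite big_cons deriveD ?IH2 //; exact: diff_derivable.
Qed.

(** The relation d d h = 0 in coordinates, by symmetry of second derivatives. The differentiability
    is kept for splitting the derivative of a sum of such terms. *)
Lemma exterior_exact E (h : E -> R) z u v : Coo_at h z ->
  'D_u (fun x => 'd h x v) z - 'D_v (fun x => 'd h x u) z = 0 /\
  differentiable (fun x => 'd h x v) z.
Proof.
move=> Ch.
have dE w : \forall x \near z, 'D_w h x = 'd h x w.
  by apply: filterS (Coo_at_near Ch) => x /Coo_at_diff; exact: deriveE.
split; last exact: (near_eq_diff (dE v) (Coo_at_diff (Coo_at_derive v Ch))).1.
rewrite -(near_eq_derive _ (dE v)) -(near_eq_derive _ (dE u)).
by rewrite (schwarz _ _ finite_dimR Ch) subrr.
Qed.

Lemma smooth_coordinates V E (T : topologicalType) (B : charted T V) (g : E -> T) z0 :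
  atlas B -> smooth_at (id_charts E) B g z0 ->
  \forall z \near z0, \forall w \near z, (bwd (B (g z0)) \o (fwd (B (g z0)) \o g)) w = g w.
Proof.
move=> aB [/= D _]; apply: near_join; apply: filterS D => w; exact: atlas_bwdK.
Qed.

(** The tangent map at [z] uses the chart preferred at [g z], which moves. Passing through the chart
    fixed at [g z0] confines this motion to the tangent map of [bwd], which the form read in the
    fixed chart absorbs. *)
Lemma tangent_coordinates V E (T : topologicalType) (B : charted T V) (g : E -> T) z0 :
  finite_dim V -> atlas B -> (\forall z \near z0, smooth_at (id_charts E) B g z) ->
  \forall z \near z0, forall v, tangent_map (id_charts E) B g z v =
    tangent_map (id_charts V) B (bwd (B (g z0))) (fwd (B (g z0)) (g z))
      ('D_v (fwd (B (g z0)) \o g) z).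
Proof.
move=> fV aB sg; have sg0 := nbhs_singleton sg; have [/= D Cg] := sg0.
apply: filterS3 (smooth_coordinates aB sg0) (filterI D sg) (Coo_at_near Cg).
move=> z zE [Dz sz] Cz v; have dz := Coo_at_diff Cz.
have sgz : smooth_at (id_charts E) (id_charts V) (fwd (B (g z0)) \o g) z.
  exact/smooth_id.
have sb : smooth_at (id_charts V) B (bwd (B (g z0))) ((fwd (B (g z0)) \o g) z).
  by apply: smooth_chart_inv => //; exists (g z).
have sc : smooth_at (id_charts E) B (bwd (B (g z0)) \o (fwd (B (g z0)) \o g)) z.
  by apply: (smooth_comp (B := id_charts V)).
rewrite (tangent_eq v zE sc) (tangent_comp (B := id_charts V)) //.
by rewrite deriveE.
Qed.

(* The second derivatives of the chart expression of [g] cancel by symmetry. *)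
Lemma extd_pull1 V E (T : topologicalType) (B : charted T V) (g : E -> T) z0
    (a : form1 R T V) :
  finite_dim V -> atlas B -> (\forall z \near z0, smooth_at (id_charts E) B g z) ->
  (forall t, linear (a t : V -> R)) ->
  (forall w, differentiable
     ((pull1 (id_charts V) B (bwd (B (g z0))) a)^~ w : V -> R)
     (fwd (B (g z0)) (g z0))) ->
  let b := pull1 (id_charts E) B g a in
  (forall v, differentiable (b^~ v : E -> R) z0) /\
  forall u v, 'D_u (b^~ v : E -> R) z0 - 'D_v (b^~ u : E -> R) z0 =
    pull2 (id_charts E) B g (extd B a) z0 u v.
Proof.
move=> fV aB sg la da b; have [m [e [c [cc ec]]]] := fV.
have [/= D Cg] := nbhs_singleton sg.
set t0 := g z0 in da D Cg *; set x0 := fwd (B t0) t0 in da *.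
set G := fwd (B t0) \o g.
have {}Cg : Coo_at G z0 by exact: Cg.
pose a0 := pull1 (id_charts V) B (bwd (B t0)) a.
have la0 x : linear (a0 x : V -> R).
  by move=> k u v; rewrite /a0 /pull1 /tangent_map linearP la.
have a0E x w : a0 x w = \sum_i c i w *: a0 x (e i).
  pose L : {linear V -> R} := HB.pack (a0 x : V -> R) (GRing.isLinear.Build _ _ _ _ _ (la0 x)).
  rewrite -[a0 x w]/(L w) [in LHS](ec w) linear_sum; apply: eq_bigr => i _.
  by rewrite linearZ.
(* By linearity of the form, its pull-back is a finite sum of products of a coordinate of ['D_v G]
   and a coefficient of [a0] along [G], to which the Leibniz rule applies. *)
pose F v i z := c i ('D_v G z) *: a0 (G z) (e i).
have bE v : \forall z \near z0, \sum_i F v i z = b z v.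
  apply: filterS2 (tangent_coordinates fV aB sg) D => z Tz Dz.
  rewrite -a0E /b /a0 /pull1 Tz -/t0 /G /= atlas_bwdK //.
have dF v i : differentiable (F v i) z0 /\ forall u, 'D_u (F v i) z0 =
    c i ('D_u ('D_v G) z0) *: a0 x0 (e i) +
    c i ('D_v G z0) *: 'D_('D_u G z0) (a0^~ (e i) : V -> R) x0.
  have dG := Coo_at_diff Cg.
  have dDG := Coo_at_diff (Coo_at_derive v Cg).
  have dc x : differentiable (c i) x by exact: linear_differentiable.
  have d1 := differentiable_comp dDG (dc _).
  have d2 := differentiable_comp dG (da (e i)).
  have [dF dFE] := diff_scale d1 d2; split => // u.
  rewrite [LHS](deriveE _ dF) dFE (diff_comp dDG (dc _)) (diff_comp dG (da (e i))) /=.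
  by rewrite (diff_lin _ (cc i)) -!deriveE //; exact: da.
split => [v|u v].
  apply: (near_eq_diff (bE v) _).1.
  by apply: (derive_bigsum _ _).1 => i; exact: (dF v i).1.
have bDE u' v' : 'D_u' (b^~ v' : E -> R) z0 =
    \sum_i c i ('D_u' ('D_v' G) z0) *: a0 x0 (e i) +
    \sum_i c i ('D_v' G z0) *: 'D_('D_u' G z0) (a0^~ (e i) : V -> R) x0.
  rewrite -(near_eq_derive _ (bE v')) (derive_bigsum _ _).2; last by move=> i; exact: (dF v' i).1.
  by rewrite -big_split /=; apply: eq_bigr => i _; rewrite (dF v' i).2.
have TE w : tangent_map (id_charts E) B g z0 w = 'D_w G z0.
  by rewrite deriveE //; exact: Coo_at_diff.
have aDE u' w : \sum_i c i w *: 'D_u' (a0^~ (e i) : V -> R) x0 = 'D_u' (a0^~ w : V -> R) x0.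
  have -> : (a0^~ w : V -> R) = fun x => \sum_i c i w *: a0 x (e i).
    by apply/funext => x; exact: a0E.
  have dca i : differentiable (fun x => c i w *: a0 x (e i)) x0.
    by apply: (@differentiableZ _ _ _ (a0^~ (e i))); exact: da.
  rewrite (derive_bigsum _ dca).2; apply: eq_bigr => i _.
  rewrite [RHS](@deriveZ _ _ _ (a0^~ (e i))) //.
  by apply: diff_derivable; exact: da.
have cancel (p q s : R) : (p + q) - (p + s) = q - s.
  by rewrite opprD addrACA subrr add0r.
have {bDE}bDE u' v' := etrans (bDE u' v') (congr1 _ (aDE ('D_u' G z0) ('D_v' G z0))).
rewrite (bDE u v) (bDE v u) (schwarz u v fV Cg) cancel.
by rewrite /pull2 (TE u) (TE v).
Qed.

(** A directional derivative sees only the restriction to a line, so partial derivatives taken with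
    the other variables frozen can be read on functions of all variables. *)
Lemma derive_line_eq V E (W : normedModType R) (f : V -> W) (g : E -> W) a v b w :
  (forall h : R, f (h *: v + a) = g (h *: w + b)) -> 'D_v f a = 'D_w g b.
Proof.
move=> H.
have H0 : f a = g b by have := H 0; rewrite !scale0r !add0r.
have HE : (fun h : R => h^-1 *: ((f \o shift a) (h *: v) - f a)) =
    (fun h : R => h^-1 *: ((g \o shift b) (h *: w) - g b)).
  by apply/funext => h /=; rewrite H H0.
by rewrite /derive HE.
Qed.

Lemma linear_row n (f : 'rV[R]_n -> R) u : linear f ->
  f u = \sum_i u 0 i * f (basis_vec R i).
Proof.
move=> lf; pose fL : {linear 'rV[R]_n -> R} := HB.pack f (GRing.isLinear.Build _ _ _ _ _ lf).
rewrite -[f u]/(fL u) [in LHS](row_sum_delta u) linear_sum.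
by apply: eq_bigr => i _; rewrite linearZ.
Qed.

End exterior.

(** * Partial derivatives in the charts of the discrete states *)

Section charts_of_states.
Context {R : realType} {n : nat} {Q : topologicalType} {A : charted Q 'rV[R]_n}.
Hypothesis aA : atlas A.
Local Notation V := 'rV[R]_n.
Local Notation E := (dmodel R n).
Local Notation dch := (dcharts A : charted (dstate R Q) E).
Implicit Types (r y : dstate R Q) (x w : E) (L : dstate R Q -> R).

Lemma finite_dim_dmodel : finite_dim (E : normedModType R).
Proof.
by apply: finite_dim_prod; apply: finite_dim_prod;
  [exact: finite_dim_mx|exact: finite_dim_mx|exact: finite_dimR|exact: finite_dimR].
Qed.
Local Notation fE := finite_dim_dmodel.
Let fV : finite_dim (V : normedModType R) := @finite_dim_mx R 1 n.

Lemma dcharts_atlas : atlas dch.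
Proof.
apply: prod_atlas; [| |apply: prod_atlas|apply: prod_atlas] => //.
- exact: finite_dim_prod.
- by apply: finite_dim_prod; exact: finite_dimR.
- exact: finite_dimR.
- exact: finite_dimR.
- exact: id_atlas.
- exact: id_atlas.
Qed.
Local Notation aD := dcharts_atlas.

Lemma chartK r : bwd (dch r) (fwd (dch r) r) = r.
Proof. by apply: (atlas_bwdK aD); exact: (atlas_dom aD). Qed.

Lemma baseK (q : Q) : bwd (A q) (fwd (A q) q) = q.
Proof. by apply: (atlas_bwdK aA); exact: (atlas_dom aA). Qed.

Lemma linear_dmodel (f : E -> R) w : linear f -> f w =
  \sum_i w.1.1 0 i * f ((basis_vec R i, 0), (0, 0)) +
  \sum_i w.1.2 0 i * f ((0, basis_vec R i), (0, 0)) +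
  w.2.1 * f ((0, 0), (1, 0)) + w.2.2 * f ((0, 0), (0, 1)).
Proof.
move=> lf; have lD u v : f (u + v) = f u + f v by have := lf 1 u v; rewrite !scale1r.
have f0 : f 0 = 0 by apply: (addrI (f 0)); rewrite -lD !addr0.
have lZ k u : f (k *: u) = k * f u by have := lf k u 0; rewrite f0 !addr0.
have -> : w = ((w.1.1, 0), (0, 0)) + ((0, w.1.2), (0, 0)) +
    w.2.1 *: ((0, 0), (1, 0)) + w.2.2 *: ((0, 0), (0, 1)) :> E.
  apply: injective_projections; apply: injective_projections => /=.
  - by rewrite !scaler0 !addr0.
  - by rewrite !scaler0 !addr0 add0r.
  - by rewrite scaler0 addr0 !add0r [RHS]mulr1.
  - by rewrite scaler0 !add0r [RHS]mulr1.
rewrite !lD !lZ /= !addr0 !add0r !scaler0 !addr0 !add0r ![_ *: 1]mulr1.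
congr (_ + _ + _ + _).
- apply: (@linear_row _ _ (fun u => f ((u, 0), (0, 0)))) => k u v /=.
  rewrite -lf; congr f.
  by apply: injective_projections; apply: injective_projections => /=; rewrite ?scaler0 ?addr0.
- apply: (@linear_row _ _ (fun u => f ((0, u), (0, 0)))) => k u v /=.
  rewrite -lf; congr f.
  by apply: injective_projections; apply: injective_projections => /=; rewrite ?scaler0 ?addr0.
Qed.

Lemma derive_D1 L r i : D1 A L r 0 i =
  'D_(((basis_vec R i, 0), (0, 0)) : E) (L \o bwd (dch r)) (fwd (dch r) r).
Proof.
rewrite mxE; apply: derive_line_eq => h /=.
by rewrite !scaler0 !add0r !baseK.
Qed.

Lemma derive_D2 L r i : D2 A L r 0 i =
  'D_(((0, basis_vec R i), (0, 0)) : E) (L \o bwd (dch r)) (fwd (dch r) r).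
Proof.
rewrite mxE; apply: derive_line_eq => h /=.
by rewrite !scaler0 !add0r !baseK.
Qed.

Lemma derive_D3 L r : D3 L r =
  'D_(((0, 0), (1, 0)) : E) (L \o bwd (dch r)) (fwd (dch r) r).
Proof.
rewrite /D3 derive1E; apply: derive_line_eq => h /=.
by rewrite !scaler0 !add0r !baseK.
Qed.

Lemma derive_D4 L r : D4 L r =
  'D_(((0, 0), (0, 1)) : E) (L \o bwd (dch r)) (fwd (dch r) r).
Proof.
rewrite /D4 derive1E; apply: derive_line_eq => h /=.
by rewrite !scaler0 !add0r !baseK.
Qed.

Lemma tangent_function L r w : smooth_at dch (id_charts R) L r ->
  tangent_map dch (id_charts R) L r w =
  pairing (D1 A L r) w.1.1 + pairing (D2 A L r) w.1.2
  + D3 L r * w.2.1 + D4 L r * w.2.2.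
Proof.
move=> [_ CL]; have dL := Coo_at_diff CL.
rewrite [LHS](@linear_dmodel (tangent_map dch (id_charts R) L r)); last first.
  by move=> a u v; rewrite /tangent_map linearP.
rewrite /tangent_map -!deriveE // -[_ \o L \o _]/(L \o bwd (dch r)).
rewrite -derive_D3 -derive_D4 (mulrC (D3 _ _)) (mulrC (D4 _ _)).
congr (_ + _ + _ + _); apply: eq_bigr => i _; rewrite mulrC -deriveE //.
  by rewrite derive_D1.
by rewrite derive_D2.
Qed.

End charts_of_states.

(** * Discrete forms in coordinates *)

Section pairing.
Context {R : realType} {n : nat}.
Implicit Types xi v : 'rV[R]_n.

Lemma pairing0r xi : pairing xi 0 = 0.
Proof. by rewrite /pairing big1 // => i _; rewrite mxE mulr0. Qed.

Lemma pairing0l v : pairing 0 v = 0.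
Proof. by rewrite /pairing big1 // => i _; rewrite mxE mul0r. Qed.

Lemma pairing_linearr xi : linear (pairing xi : 'rV[R]_n -> R).
Proof.
move=> a u v; rewrite /pairing scaler_sumr -big_split /=.
by apply: eq_bigr => i _; rewrite !mxE mulrDr mulrCA.
Qed.

Lemma pairing_linearl v : linear (fun xi : 'rV[R]_n => pairing xi v : R).
Proof.
move=> a u w; rewrite /pairing scaler_sumr -big_split /=.
by apply: eq_bigr => i _; rewrite !mxE mulrDl -mulrA.
Qed.

Lemma pairingDl xi eta v : pairing (xi + eta) v = pairing xi v + pairing eta v.
Proof. by have := pairing_linearl v 1 xi eta; rewrite !scale1r. Qed.

Lemma pairing_basis xi i : pairing xi (basis_vec R i) = xi 0 i.
Proof.
rewrite /pairing (bigD1 i) //= big1 ?addr0 => [|j ji].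
  by rewrite mxE !eqxx mulr1.
by rewrite mxE (negbTE ji) andbF mulr0.
Qed.

(** The row is the pull-back of [xi] by [f], in the form in which [cotangent_charts] changes
    components. *)
Lemma pairing_row (f : 'rV[R]_n -> 'rV[R]_n) xi v : linear f ->
  pairing (\row_i pairing xi (f (basis_vec R i))) v = pairing xi (f v).
Proof.
move=> lf; have lpf : linear (fun v => pairing xi (f v) : R).
  by move=> a u w; rewrite lf pairing_linearr.
rewrite (linear_row v lpf); apply: eq_bigr => i _.
by rewrite mxE mulrC.
Qed.

End pairing.

Lemma diff_prod (R : realType) (V W V' W' : normedModType R)
    (f : V -> V') (g : W -> W') (z w : V * W) :
  finite_dim V -> finite_dim W -> differentiable f (z.1) -> differentiable g (z.2) ->
  differentiable (fun p : V * W => (f p.1, g p.2)) z /\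
  'd (fun p : V * W => (f p.1, g p.2)) z w = ('d f (z.1) w.1, 'd g (z.2) w.2).
Proof.
move=> fV fW df dg; have fVW := finite_dim_prod fV fW.
have lfst : linear (@fst V W) by [].
have lsnd : linear (@snd V W) by [].
have d1 := Coo_at_diff (Coo_lin z fVW lfst).
have d2 := Coo_at_diff (Coo_lin z fVW lsnd).
have df1 := differentiable_comp d1 df.
have dg2 := differentiable_comp d2 dg.
split; first exact: (differentiable_pair df1 dg2).
rewrite (diff_pair df1 dg2) (diff_comp d1 df) (diff_comp d2 dg) /=.
by rewrite (diff_linear z fVW lfst) (diff_linear z fVW lsnd).
Qed.

Section coordinate_expressions.
Context {R : realType} {n : nat} {Q : topologicalType} {A : charted Q 'rV[R]_n}.
Hypothesis aA : atlas A.
Local Notation V := 'rV[R]_n.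
Local Notation E := (dmodel R n).
Local Notation dch := (dcharts A : charted (dstate R Q) E).
Local Notation image r := (fwd (dch r) @` dom (dch r)).
Implicit Types (r y : dstate R Q) (x w : E) (L : dstate R Q -> R) (F : force R n Q).
Let aD := dcharts_atlas aA.
Let fE : finite_dim (E : normedModType R) := finite_dim_dmodel.
Let fV : finite_dim (V : normedModType R) := @finite_dim_mx R 1 n.

Lemma center_image r : image r (fwd (dch r) r).
Proof. by exists r => //; exact: (atlas_dom aD). Qed.

Lemma change_Coo (q0 q q' : Q) : dom (A q0) q' -> dom (A q) q' ->
  Coo_at (fwd (A q) \o bwd (A q0)) (fwd (A q0) q').
Proof. by move=> h1 h2; apply: (atlas_change aA); exists q'. Qed.

(** The vector is re-expressed from the chart preferred at [r] to the one preferred at [y]: a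
    transition Jacobian for each position, nothing to change for the entropies. *)
Lemma tangent_bwd r x w : image r x -> let y := bwd (dch r) x in
  tangent_map (id_charts E) dch (bwd (dch r)) x w =
  ((coord_jac A (pos0 r) (pos0 y) (pos0 y) w.1.1,
    coord_jac A (pos1 r) (pos1 y) (pos1 y) w.1.2), w.2).
Proof.
move=> [y' dy' <-] y; have -> : y = y' by exact: (atlas_bwdK aD).
have Ey : bwd (dch r) (fwd (dch r) y') = y' by exact: (atlas_bwdK aD).
rewrite /tangent_map Ey /coord_jac.
have [[d0 d1] _] := dy'.
have c0 := Coo_at_diff (change_Coo d0 (atlas_dom aA (pos0 y'))).
have c1 := Coo_at_diff (change_Coo d1 (atlas_dom aA (pos1 y'))).
have fR2 : finite_dim (R * R : normedModType R)%type.
  by apply: finite_dim_prod; exact: finite_dimR.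
have fV2 : finite_dim (V * V : normedModType R)%type by exact: finite_dim_prod.
have [dd dE] := @diff_prod _ _ _ _ _ _ _ (fwd (A (pos0 r)) (pos0 y'), fwd (A (pos1 r)) (pos1 y')) w.1 fV fV c0 c1.
have li : linear (fun p : R * R => (p.1, p.2)) by [].
have di := Coo_at_diff (Coo_lin (y'.2.1, y'.2.2) fR2 li).
have [_] := @diff_prod _ _ _ _ _ _ _ ((fwd (A (pos0 r)) (pos0 y'), fwd (A (pos1 r)) (pos1 y')), (y'.2.1, y'.2.2)) w fV2 fR2 dd di.
rewrite dE (diff_linear _ fR2 li) => H; apply: (etrans H).
by case: (w.2).
Qed.

Lemma smooth_bwd r x : image r x -> smooth_at (id_charts E) dch (bwd (dch r)) x.
Proof. exact: smooth_chart_inv. Qed.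

Lemma smooth_function_comp (X : normedModType R) (g : X -> dstate R Q) L z : smooth_function A L ->
  smooth_at (id_charts X) dch g z -> Coo_at (L \o g) z.
Proof.
move=> sL sg; apply/smooth_id; apply: (smooth_comp (B := dch)) => //.
by move=> y; exact: (atlas_bwdK aD).
Qed.

Lemma diff_function_comp (X : normedModType R) (g : X -> dstate R Q) L z u : smooth_function A L ->
  smooth_at (id_charts X) dch g z ->
  let w := tangent_map (id_charts X) dch g z u in
  'd (L \o g) z u =
  pairing (D1 A L (g z)) w.1.1 + pairing (D2 A L (g z)) w.1.2
  + D3 L (g z) * w.2.1 + D4 L (g z) * w.2.2.
Proof.
move=> sL sg w; rewrite -(tangent_function aA) //.
have := @tangent_comp _ _ _ _ _ _ _ (id_charts X) dch (id_charts R) g L z u.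
rewrite -/w => <- //.
by move=> y; exact: (atlas_bwdK aD).
Qed.

Lemma chart_function_Coo L r x : smooth_function A L -> image r x ->
  Coo_at (L \o bwd (dch r)) x.
Proof. by move=> sL ix; apply: smooth_function_comp => //; exact: smooth_bwd. Qed.

Lemma coord_jac_linear (p q q' : Q) : linear (coord_jac A p q q').
Proof. by move=> a u v; rewrite /coord_jac linearP. Qed.

Lemma coord_jac0 (p q q' : Q) : coord_jac A p q q' 0 = 0.
Proof. by rewrite /coord_jac linear0. Qed.

Lemma D1_chart L r x (v : V) : smooth_function A L -> image r x ->
  let y := bwd (dch r) x in
  pairing (D1 A L y) (coord_jac A (pos0 r) (pos0 y) (pos0 y) v) =
  'D_((v, 0), (0, 0)) (L \o bwd (dch r)) x.
Proof.
move=> sL ix y; rewrite deriveE; last exact: Coo_at_diff (chart_function_Coo sL ix).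
rewrite (diff_function_comp _ sL (smooth_bwd ix)) tangent_bwd //=.
by rewrite coord_jac0 pairing0r !mulr0 !addr0.
Qed.

Lemma D2_chart L r x (v : V) : smooth_function A L -> image r x ->
  let y := bwd (dch r) x in
  pairing (D2 A L y) (coord_jac A (pos1 r) (pos1 y) (pos1 y) v) =
  'D_((0, v), (0, 0)) (L \o bwd (dch r)) x.
Proof.
move=> sL ix y; rewrite deriveE; last exact: Coo_at_diff (chart_function_Coo sL ix).
rewrite (diff_function_comp _ sL (smooth_bwd ix)) tangent_bwd //=.
by rewrite coord_jac0 pairing0r !mulr0 !addr0 add0r.
Qed.

(** The covector in the cotangent chart fixed at [F r]: unlike [(F y).2], it varies smoothly near
    the centre. *)
Definition force_chart F r x : V :=
  (fwd (cotangent_charts A (F r)) (F (bwd (dch r) x))).2.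

Lemma force_chart_Coo F r : smooth_force A F -> Coo_at (force_chart F r) (fwd (dch r) r).
Proof.
move=> sF; have [_ CF] := sF r.
apply: (@Coo_lin_comp _ _ (V * V)%type V _ (@snd V V)) CF => //.
exact: finite_dim_prod.
Qed.

Lemma force_chartE F r x (v : V) : let y := bwd (dch r) x in
  pairing (force_chart F r x) v =
  pairing (F y).2 (coord_jac A (F r).1 (F y).1 (F y).1 v).
Proof. by move=> y; rewrite -(pairing_row _ _ (@coord_jac_linear _ _ _)). Qed.

Lemma force_chart_minus F r x (v : V) : force_minus A F -> let y := bwd (dch r) x in
  pairing (force_chart F r x) v =
  pairing (F y).2 (coord_jac A (pos0 r) (pos0 y) (pos0 y) v).
Proof. by move=> [_ HF] y; rewrite force_chartE HF HF. Qed.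

Lemma force_chart_plus F r x (v : V) : force_plus A F -> let y := bwd (dch r) x in
  pairing (force_chart F r x) v =
  pairing (F y).2 (coord_jac A (pos1 r) (pos1 y) (pos1 y) v).
Proof. by move=> [_ HF] y; rewrite force_chartE HF HF. Qed.

Section forms.
Variables (L : dstate R Q -> R) (Ffrm Ffrp Fextm Fextp : force R n Q).
Hypotheses (sL : smooth_function A L).
Hypotheses (hFfrm : force_minus A Ffrm) (hFfrp : force_plus A Ffrp).
Hypotheses (hFextm : force_minus A Fextm) (hFextp : force_plus A Fextp).
Local Notation Thm := (Theta_minus A L Ffrm Fextm).
Local Notation Thp := (Theta_plus A L Ffrp Fextp).

Lemma Theta_minus_chart r x w : image r x ->
  pull1 (id_charts E) dch (bwd (dch r)) Thm x w =
  - 'D_((w.1.1, 0), (0, 0)) (L \o bwd (dch r)) x -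
  (pairing (force_chart Ffrm r x) w.1.1 + pairing (force_chart Fextm r x) w.1.1).
Proof.
move=> ix; rewrite /pull1 /Theta_minus (tangent_bwd w ix) -(D1_chart _ sL ix).
congr (_ + _); congr (- _); apply: (etrans (pairingDl _ _ _)).
congr (_ + _); apply: esym.
  exact: (force_chart_minus r x w.1.1 hFfrm).
exact: (force_chart_minus r x w.1.1 hFextm).
Qed.

Lemma Theta_plus_chart r x w : image r x ->
  pull1 (id_charts E) dch (bwd (dch r)) Thp x w =
  'D_((0, w.1.2), (0, 0)) (L \o bwd (dch r)) x +
  (pairing (force_chart Ffrp r x) w.1.2 + pairing (force_chart Fextp r x) w.1.2).
Proof.
move=> ix; rewrite /pull1 /Theta_plus (tangent_bwd w ix) -(D2_chart _ sL ix).
congr (_ + _); apply: (etrans (pairingDl _ _ _)).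
congr (_ + _); apply: esym.
  exact: (force_chart_plus r x w.1.2 hFfrp).
exact: (force_chart_plus r x w.1.2 hFextp).
Qed.

Lemma Theta_minus_linear r : linear (Thm r : E -> R).
Proof.
by move=> a u v; rewrite /Theta_minus /= !pairing_linearr !opprD addrACA scalerBr !scalerN.
Qed.

Lemma Theta_plus_linear r : linear (Thp r : E -> R).
Proof.
by move=> a u v; rewrite /Theta_plus /= !pairing_linearr addrACA scalerDr.
Qed.

Lemma pairing_chart_Coo F r (v : V) : smooth_force A F ->
  Coo_at (fun x => pairing (force_chart F r x) v) (fwd (dch r) r).
Proof.
move=> sF; apply: (@Coo_lin_comp _ _ V R _ (fun xi => pairing xi v)) => //.
  exact: pairing_linearl.
exact: force_chart_Coo.
Qed.

Lemma near_image r : \forall x \near fwd (dch r) r, image r x.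
Proof. by apply: (atlas_near_image aD); exact: center_image. Qed.

(** In the fixed chart the form involves only derivatives of [L] and [force_chart], both smooth;
    this is the hypothesis under which [extd_pull1] applies. *)
Lemma Theta_minus_diff r w : differentiable
  ((pull1 (id_charts E) dch (bwd (dch r)) Thm)^~ w : E -> R) (fwd (dch r) r).
Proof.
apply: Coo_at_diff.
have C1 := Coo_at_derive ((w.1.1, 0), (0, 0)) (chart_function_Coo sL (center_image r)).
have C2 := pairing_chart_Coo r w.1.1 hFfrm.1.
have C3 := pairing_chart_Coo r w.1.1 hFextm.1.
have := CooZ (Coo_cst (-1 : R) _) (CooD C1 (CooD C2 C3)).
apply: Coo_at_eq; apply: filterS (near_image r) => x ix.
by rewrite Theta_minus_chart // scaleN1r opprD.
Qed.

Lemma Theta_plus_diff r w : differentiable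
  ((pull1 (id_charts E) dch (bwd (dch r)) Thp)^~ w : E -> R) (fwd (dch r) r).
Proof.
apply: Coo_at_diff.
have C1 := Coo_at_derive ((0, w.1.2), (0, 0)) (chart_function_Coo sL (center_image r)).
have C2 := pairing_chart_Coo r w.1.2 hFfrp.1.
have C3 := pairing_chart_Coo r w.1.2 hFextp.1.
have := CooD C1 (CooD C2 C3).
apply: Coo_at_eq; apply: filterS (near_image r) => x ix.
by rewrite Theta_plus_chart.
Qed.

Lemma omega_decomposition (X : normedModType R) (g : X -> dstate R Q) z u :
  smooth_at (id_charts X) dch g z ->
  let w := tangent_map (id_charts X) dch g z u in
  omega_force Ffrm Ffrp (g z) w + omega_force Fextm Fextp (g z) w
  + omega_tau L (g z) w = Thp (g z) w - Thm (g z) w - 'd (L \o g) z u.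
Proof.
move=> sg w; rewrite (diff_function_comp u sL sg) -/w.
rewrite /omega_force /omega_tau /Theta_plus /Theta_minus /total_force.
rewrite (pairingDl (Ffrm (g z)).2) (pairingDl (Ffrp (g z)).2).
move: (pairing (D1 A L _) _) (pairing (D2 A L _) _) (pairing (Ffrm _).2 _)
  (pairing (Ffrp _).2 _) (pairing (Fextm _).2 _) (pairing (Fextp _).2 _)
  (D3 _ _ * _) (D4 _ _ * _) => p1 p2 p3 p4 p5 p6 p7 p8; ring.
Qed.

End forms.
End coordinate_expressions.

(** * Local solution of the scheme *)

Section local_flow.
Context {R : realType} {n : nat} {Q : topologicalType} {A : charted Q 'rV[R]_n}.
Hypothesis aA : atlas A.
Local Notation V := 'rV[R]_n.
Local Notation E := (dmodel R n).
Local Notation Y := 'rV[R]_(n + 1).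
Local Notation dch := (dcharts A : charted (dstate R Q) E).
Local Notation image r := (fwd (dch r) @` dom (dch r)).
Variables (L P : dstate R Q -> R) (Ffrm Ffrp Fextm Fextp : force R n Q).
Hypotheses (sL : smooth_function A L) (sP : smooth_function A P).
Hypotheses (hFfrm : force_minus A Ffrm) (hFfrp : force_plus A Ffrp).
Hypotheses (hFextm : force_minus A Fextm) (hFextp : force_plus A Fextp).
Implicit Types (r s : dstate R Q) (x w z : E).
Let aD := dcharts_atlas aA.
Let fE : finite_dim (E : normedModType R) := finite_dim_dmodel.
Let fV : finite_dim (V : normedModType R) := @finite_dim_mx R 1 n.
Let fY : finite_dim (Y : normedModType R) := @finite_dim_mx R 1 (n + 1).
Let fEY : finite_dim (E * Y : normedModType R)%type := finite_dim_prod fE fY.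

Lemma pairing_add6 (a b c d e f a' b' c' d' e' f' v w : V) :
  pairing a v = pairing a' w -> pairing b v = pairing b' w ->
  pairing c v = pairing c' w -> pairing d v = pairing d' w ->
  pairing e v = pairing e' w -> pairing f v = pairing f' w ->
  pairing (a + b + (c + d) + (e + f)) v =
  pairing (a' + b' + (c' + d') + (e' + f')) w.
Proof. by rewrite !pairingDl => -> -> -> -> -> ->. Qed.

Lemma row_add4 (a b c d : V) i :
  (a + b + c + d) 0 i = a 0 i + b 0 i + c 0 i + d 0 i.
Proof. by rewrite !mxE. Qed.

Lemma Coo_at_ext (U W : normedModType R) (f g : U -> W) (z : U) :
  f =1 g -> Coo_at f z -> Coo_at g z.
Proof. by move=> /funext ->. Qed.

Lemma coord_jac_id (q : Q) v : coord_jac A q q q v = v.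
Proof.
have E1 : \forall z \near fwd (A q) q, id z = (fwd (A q) \o bwd (A q)) z.
  have iq : (fwd (A q) @` dom (A q)) (fwd (A q) q).
    by exists q => //; exact: (atlas_dom aA).
  apply: filterS (atlas_near_image aA iq) => _ [q' dq' <-] /=.
  by rewrite (atlas_bwdK aA).
by rewrite /coord_jac (near_eq_diff E1 _).2 //; rewrite diff_val.
Qed.

(** The reverse transition provides a preimage, the composite of the two transitions being the
    identity near the point. *)
Lemma coord_jac_surj (p q : Q) u : dom (A p) q -> exists v, coord_jac A p q q v = u.
Proof.
move=> pq; have qq := atlas_dom aA q.
have c1 := Coo_at_diff (change_Coo aA qq pq).
have c2 := Coo_at_diff (change_Coo aA pq qq).
exists ('d (fwd (A p) \o bwd (A q)) (fwd (A q) q) u).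
rewrite /coord_jac.
have pE : (fwd (A p) \o bwd (A q)) (fwd (A q) q) = fwd (A p) q.
  by rewrite /= (atlas_bwdK aA).
rewrite -pE in c2 *.
have := diff_comp c1 c2 => /(congr1 (fun f => f u)) /= <-.
have E1 : \forall z \near fwd (A q) q,
    id z = ((fwd (A q) \o bwd (A p)) \o (fwd (A p) \o bwd (A q))) z.
  have iq : (fwd (A q) @` dom (A q)) (fwd (A q) q) by exists q.
  have cb := atlas_bwd aA iq.
  have : \forall z \near fwd (A q) q, dom (A p) (bwd (A q) z).
    by apply: cb; rewrite (atlas_bwdK aA) //; exact: (atlas_near_dom aA).
  apply: filterS2 (atlas_near_image aA iq) => _ [q' dq' <-] /=.
  by rewrite (atlas_bwdK aA dq') => dp; rewrite (atlas_bwdK aA dp).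
by rewrite (near_eq_diff E1 _).2 //; rewrite diff_val.
Qed.

Definition D1_row r x : V := \row_i 'D_((basis_vec R i, 0), (0, 0)) (L \o bwd (dch r)) x.
Definition D2_row r x : V := \row_i 'D_((0, basis_vec R i), (0, 0)) (L \o bwd (dch r)) x.

Lemma D1_row_pairing r x v : image r x -> let y := bwd (dch r) x in
  pairing (D1_row r x) v = pairing (D1 A L y) (coord_jac A (pos0 r) (pos0 y) (pos0 y) v).
Proof.
move=> ix y; rewrite -(pairing_row _ _ (@coord_jac_linear _ _ _ _ _ _ _)).
congr (pairing _ _); apply/rowP => i; rewrite !mxE.
exact: (esym (D1_chart aA _ sL ix)).
Qed.

Lemma D2_row_pairing r x v : image r x -> let y := bwd (dch r) x in
  pairing (D2_row r x) v = pairing (D2 A L y) (coord_jac A (pos1 r) (pos1 y) (pos1 y) v).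
Proof.
move=> ix y; rewrite -(pairing_row _ _ (@coord_jac_linear _ _ _ _ _ _ _)).
congr (pairing _ _); apply/rowP => i; rewrite !mxE.
exact: (esym (D2_chart aA _ sL ix)).
Qed.

(* The left-hand side of the discrete Euler-Lagrange equation in the chart
   preferred at [s0]; [D1] and [D2] themselves are expressed in moving charts and
   need not be continuous. *)
Definition momentum r0 s0 x z : V :=
  D1_row s0 z + D2_row r0 x + (force_chart (A := A) Ffrm s0 z + force_chart (A := A) Fextm s0 z)
  + (force_chart (A := A) Ffrp r0 x + force_chart (A := A) Fextp r0 x).

(** Both expressions are one covector at the common position, in a fixed chart and in the preferred
    one. Its vanishing is tested on vectors, and the transition Jacobian reaches all of them. *)
Lemma momentum0 r0 s0 x z : pos0 s0 = pos1 r0 -> image r0 x -> image s0 z ->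
  let r := bwd (dch r0) x in let s := bwd (dch s0) z in pos0 s = pos1 r ->
  (momentum r0 s0 x z = 0 <->
   D1 A L s + D2 A L r + total_force Ffrm Fextm s + total_force Ffrp Fextp r = 0).
Proof.
move=> rs0 ix iz r s rs.
set q := D1 A L s + _ + _ + _.
have pE v : pairing (momentum r0 s0 x z) v =
    pairing q (coord_jac A (pos0 s0) (pos0 s) (pos0 s) v).
  apply: pairing_add6.
  - exact: (D1_row_pairing v iz).
  - by rewrite rs rs0; exact: (D2_row_pairing v ix).
  - exact: (force_chart_minus s0 z v hFfrm).
  - exact: (force_chart_minus s0 z v hFextm).
  - by rewrite rs rs0; exact: (force_chart_plus r0 x v hFfrp).
  - by rewrite rs rs0; exact: (force_chart_plus r0 x v hFextp).
split => [m0|q0].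
  apply/rowP => i; rewrite [RHS]mxE -pairing_basis.
  have ds : dom (A (pos0 s0)) (pos0 s).
    have [s' ds' sE] := iz.
    have -> : s = s' by rewrite /s -sE; exact: (atlas_bwdK aD).
    by case: ds' => -[].
  have [v <-] := coord_jac_surj (basis_vec R i) ds.
  by rewrite -pE m0 pairing0l.
by apply/rowP => i; rewrite [RHS]mxE -pairing_basis pE q0 pairing0l.
Qed.

(* The unknown [p.2] collects the coordinates of q_(k+1) and S_(k+1), while those
   of q_k and S_k are read off [p.1]. *)
Definition next_coord (p : E * Y) : E :=
  ((p.1.1.2, lsubmx p.2), (p.1.2.2, rsubmx p.2 0 0)).

Definition next_unknown z : Y := row_mx z.1.2 z.2.2%:M.

Lemma next_coord_linear : linear next_coord.
Proof.
move=> a u v; rewrite /next_coord /=; congr ((_, _), (_, _)).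
  by rewrite linearP.
by rewrite linearP !mxE.
Qed.

Lemma next_unknownK x z : x.1.2 = z.1.1 -> x.2.2 = z.2.1 ->
  next_coord (x, next_unknown z) = z.
Proof.
move=> h1 h2; rewrite /next_coord /next_unknown /= row_mxKl row_mxKr mxE eqxx h1 h2.
by case: z {h1 h2} => [[? ?] [? ?]].
Qed.

Lemma next_coordK x (y : Y) : next_unknown (next_coord (x, y)) = y.
Proof.
rewrite /next_unknown /next_coord /= -[RHS]hsubmxK; congr row_mx.
by apply/rowP => k; rewrite !mxE !ord1 eqxx.
Qed.

(** The n momentum equations and the constraint on the next state match the n + 1 unknowns. The
    constraint on the current state is left out, so the system also makes sense off the
    hypersurface. *)
Definition scheme_eq r0 s0 (p : E * Y) : Y :=
  row_mx (momentum r0 s0 p.1 (next_coord p)) ((P \o bwd (dch s0)) (next_coord p))%:M.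

Lemma scheme_eq0 r0 s0 p : scheme_eq r0 s0 p = 0 <->
  momentum r0 s0 p.1 (next_coord p) = 0 /\ P (bwd (dch s0) (next_coord p)) = 0.
Proof.
rewrite /scheme_eq; split => [|[-> /= ->]]; last by rewrite raddf0 row_mx0.
rewrite -[X in _ = X]row_mx0 => /eq_row_mx[-> H]; split => //.
by have := congr1 (fun M : 'rV_1 => M 0 0) H; rewrite !mxE eqxx.
Qed.

Lemma D1_row_Coo r x : image r x -> Coo_at (D1_row r) x.
Proof.
move=> ix; apply: Coo_mx => i j.
have := Coo_at_derive ((basis_vec R j, 0), (0, 0)) (chart_function_Coo aA sL ix).
by apply: Coo_at_ext => z; rewrite mxE.
Qed.

Lemma D2_row_Coo r x : image r x -> Coo_at (D2_row r) x.
Proof.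
move=> ix; apply: Coo_mx => i j.
have := Coo_at_derive ((0, basis_vec R j), (0, 0)) (chart_function_Coo aA sL ix).
by apply: Coo_at_ext => z; rewrite mxE.
Qed.

(** * The Jacobian of the scheme *)

Section at_pair.
Variables (r0 s0 : dstate R Q).
Hypotheses (pos_rs : pos0 s0 = pos1 r0) (ent_rs : ent0 s0 = ent1 r0).
Let x0 : E := fwd (dch r0) r0.
Let z0 : E := fwd (dch s0) s0.
Let y0 : Y := next_unknown z0.

Lemma next_coord0 : next_coord (x0, y0) = z0.
Proof.
apply: next_unknownK; last exact: esym ent_rs.
exact: (congr1 (fun q => fwd (A q) q) (esym pos_rs)).
Qed.

Let comp_fst (W : normedModType R) (f : E -> W) : Coo_at f x0 ->
  Coo_at (fun p : E * Y => f p.1) (x0, y0).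
Proof.
move=> Cf; apply: (@Coo_comp _ _ _ _ (@fst E Y) f) => //.
exact: Coo_lin.
Qed.

Let comp_next (W : normedModType R) (f : E -> W) : Coo_at f z0 ->
  Coo_at (fun p : E * Y => f (next_coord p)) (x0, y0).
Proof.
move=> Cf; apply: (@Coo_comp _ _ _ _ next_coord f) => //.
  by apply: Coo_lin => //; exact: next_coord_linear.
by rewrite next_coord0.
Qed.

Let fc_minus z := force_chart (A := A) Ffrm s0 z + force_chart (A := A) Fextm s0 z.
Let fc_plus x := force_chart (A := A) Ffrp r0 x + force_chart (A := A) Fextp r0 x.

Let C1 : Coo_at (fun p : E * Y => D1_row s0 (next_coord p)) (x0, y0).
Proof. by apply: comp_next; apply: D1_row_Coo; exact: center_image. Qed.
Let C2 : Coo_at (fun p : E * Y => D2_row r0 p.1) (x0, y0).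
Proof. by apply: comp_fst; apply: D2_row_Coo; exact: center_image. Qed.
Let C3 : Coo_at (fun p : E * Y => fc_minus (next_coord p)) (x0, y0).
Proof.
apply: comp_next; apply: CooD; apply: force_chart_Coo; [exact: hFfrm.1|exact: hFextm.1].
Qed.
Let C4 : Coo_at (fun p : E * Y => fc_plus p.1) (x0, y0).
Proof.
apply: comp_fst; apply: CooD; apply: force_chart_Coo; [exact: hFfrp.1|exact: hFextp.1].
Qed.
Let C5 : Coo_at (fun p : E * Y => (P \o bwd (dch s0)) (next_coord p)) (x0, y0).
Proof. by apply: comp_next; apply: chart_function_Coo => //; exact: center_image. Qed.

Lemma scheme_eq_Coo : Coo_at (scheme_eq r0 s0) (x0, y0).
Proof.
have Cm : Coo_at (fun p : E * Y => momentum r0 s0 p.1 (next_coord p)) (x0, y0).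
  by have := CooD (CooD (CooD C1 C2) C3) C4.
have lrow : linear (fun q : V * R => row_mx q.1 q.2%:M : Y).
  move=> a u v /=; rewrite raddfD /= scale_row_mx add_row_mx; congr (row_mx _ (_ + _)).
  by rewrite -mul_scalar_mx -scalar_mxM.
have fVR : finite_dim (V * R : normedModType R)%type.
  by apply: finite_dim_prod => //; exact: finite_dimR.
exact: (Coo_lin_comp fVR lrow (Coo_pair Cm C5)).
Qed.

Lemma next_coord_line (h : R) (e : Y) :
  next_coord (h *: ((0, e) : E * Y) + (x0, y0)) =
  ((z0.1.1, h *: lsubmx e + z0.1.2), (z0.2.1, h * rsubmx e 0 0 + z0.2.2)).
Proof.
have := next_coord_linear h (0, e) (x0, y0); rewrite next_coord0 => ->.
rewrite /next_coord /=.
apply: injective_projections; apply: injective_projections => //=.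
  by rewrite scaler0 add0r.
by rewrite scaler0 add0r.
Qed.

(** While q_0 stays at the centre of the chart, the moving chart for q_0 is the fixed one. Hence
    differentiating the fixed-chart expression in q_1 and S_1 yields the entries of the regularity
    matrix. *)
Lemma D1_row_line (y2 : V) (S2 : R) i :
  D1_row s0 ((z0.1.1, y2), (z0.2.1, S2)) 0 i =
  D1 A L ((pos0 s0, bwd (A (pos1 s0)) y2), (ent0 s0, S2)) 0 i.
Proof.
rewrite !mxE; apply: derive_line_eq => h /=.
by rewrite !scaler0 !add0r.
Qed.

Lemma force_chart_line (F : force R n Q) (y2 : V) (S2 : R) i : force_minus A F ->
  force_chart (A := A) F s0 ((z0.1.1, y2), (z0.2.1, S2)) 0 i =
  (F ((pos0 s0, bwd (A (pos1 s0)) y2), (ent0 s0, S2))).2 0 i.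
Proof.
move=> hF; rewrite -pairing_basis (force_chart_minus _ _ _ hF) /= -pairing_basis.
have bK : bwd (A (pos0 s0)) (fwd (A (pos0 s0)) (pos0 s0)) = pos0 s0 by exact: baseK.
by rewrite /pos0 /= in bK *; rewrite bK coord_jac_id.
Qed.

Lemma D2cov_line (xi : dstate R Q -> V) (f : E -> V) i j :
  (forall y2 S2 i, f ((z0.1.1, y2), (z0.2.1, S2)) 0 i =
    xi ((pos0 s0, bwd (A (pos1 s0)) y2), (ent0 s0, S2)) 0 i) ->
  'D_((0, delta_mx 0 (lshift 1 j)) : E * Y) (fun p => f (next_coord p) 0 i) (x0, y0) =
  D2cov A xi s0 i j.
Proof.
move=> H; rewrite mxE mxE; apply: derive_line_eq => h.
rewrite next_coord_line H; congr (xi ((_, bwd _ (_ + _)), (_, _)) 0 i).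
  congr (_ *: _); apply/rowP => k; rewrite !mxE /=.
  by rewrite (inj_eq (@lshift_inj _ _)).
by rewrite !mxE /= eq_rlshift mulr0 add0r.
Qed.

Lemma D4cov_line (xi : dstate R Q -> V) (f : E -> V) i k :
  (forall y2 S2 i, f ((z0.1.1, y2), (z0.2.1, S2)) 0 i =
    xi ((pos0 s0, bwd (A (pos1 s0)) y2), (ent0 s0, S2)) 0 i) ->
  'D_((0, delta_mx 0 (rshift n k)) : E * Y) (fun p => f (next_coord p) 0 i) (x0, y0) =
  D4cov xi s0 i 0.
Proof.
move=> H; rewrite mxE /D4 derive1E; apply: derive_line_eq => h.
rewrite next_coord_line H; congr (xi ((_, _), (_, _)) 0 i).
  rewrite (_ : lsubmx _ = 0) ?scaler0 ?add0r ?baseK //.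
  by apply/rowP => j; rewrite !mxE /= eq_lrshift.
by rewrite !mxE /= (inj_eq (@rshift_inj _ _)) !ord1 !eqxx.
Qed.

Lemma D2_P_line j :
  'D_((0, delta_mx 0 (lshift 1 j)) : E * Y)
    (fun p => (P \o bwd (dch s0)) (next_coord p)) (x0, y0) = D2 A P s0 0 j.
Proof.
rewrite mxE; apply: derive_line_eq => h.
rewrite next_coord_line; apply: (congr1 P).
apply: injective_projections; apply: injective_projections => //=.
- exact: baseK.
- congr (bwd _ (_ *: _ + _)); apply/rowP => k; rewrite !mxE /=.
  by rewrite (inj_eq (@lshift_inj _ _)).
- by rewrite !mxE /= eq_rlshift mulr0 add0r.
Qed.

Lemma D4_P_line k :
  'D_((0, delta_mx 0 (rshift n k)) : E * Y)
    (fun p => (P \o bwd (dch s0)) (next_coord p)) (x0, y0) = D4 P s0.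
Proof.
rewrite /D4 derive1E; apply: derive_line_eq => h.
rewrite next_coord_line; apply: (congr1 P).
apply: injective_projections; apply: injective_projections => //=.
- exact: baseK.
- rewrite (_ : lsubmx _ = 0) ?scaler0 ?add0r ?baseK //.
  by apply/rowP => j; rewrite !mxE /= eq_lrshift.
- by rewrite !mxE /= (inj_eq (@rshift_inj _ _)) !ord1 !eqxx.
Qed.

(** The two terms evaluated at the current state depend on [p.1] alone and are constant in the
    direction [(0, e)]. *)
Lemma momentum_derive (e : Y) i :
  'D_((0, e) : E * Y) (fun p => momentum r0 s0 p.1 (next_coord p) 0 i) (x0, y0) =
  'D_((0, e) : E * Y) (fun p => D1_row s0 (next_coord p) 0 i) (x0, y0) +
  'D_((0, e) : E * Y) (fun p => fc_minus (next_coord p) 0 i) (x0, y0).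
Proof.
have constE (f : E -> V) : 'D_((0, e) : E * Y) (fun p => f p.1 0 i) (x0, y0) = 0.
  rewrite -[RHS](@derive_cst _ (E * Y)%type R (f x0 0 i) (x0, y0) (0, e)).
  by apply: derive_line_eq => h /=; rewrite scaler0 add0r.
have dv (f : E * Y -> V) : Coo_at f (x0, y0) ->
    derivable (fun p => f p 0 i) (x0, y0) ((0, e) : E * Y).
  by move=> Cf; apply: diff_derivable; apply: Coo_at_diff; exact: coord_Coo.
pose f1 (p : E * Y) := D1_row s0 (next_coord p) 0 i.
pose f2 (p : E * Y) := D2_row r0 p.1 0 i.
pose f3 (p : E * Y) := fc_minus (next_coord p) 0 i.
pose f4 (p : E * Y) := fc_plus p.1 0 i.
have -> : (fun p => momentum r0 s0 p.1 (next_coord p) 0 i) = f1 + f2 + f3 + f4.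
  by apply/funext => p; exact: row_add4.
have d1 : derivable f1 (x0, y0) ((0, e) : E * Y) := dv _ C1.
have d2 : derivable f2 (x0, y0) ((0, e) : E * Y) := dv _ C2.
have d3 : derivable f3 (x0, y0) ((0, e) : E * Y) := dv _ C3.
have d4 : derivable f4 (x0, y0) ((0, e) : E * Y) := dv _ C4.
have d12 := derivableD d1 d2; have d123 := derivableD d12 d3.
rewrite (deriveD d123 d4) (deriveD d12 d3) (deriveD d1 d2).
have sum4 (a b c d : R) : b = 0 -> d = 0 -> a + b + c + d = a + c.
  by move=> -> ->; rewrite !addr0.
exact: (sum4 _ _ _ _ (constE (D2_row r0)) (constE fc_plus)).
Qed.

(** The transpose reflects the row-vector convention of [partial_jacobian], whose rows are indexed
    by directions. *)
Lemma scheme_jacobian : partial_jacobian (scheme_eq r0 s0) (x0, y0) =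
  (regularity_matrix A L P Ffrm Fextm s0)^T.
Proof.
have dG := Coo_at_diff scheme_eq_Coo.
have f1E y2 S2 i : D1_row s0 ((z0.1.1, y2), (z0.2.1, S2)) 0 i =
  D1 A L ((pos0 s0, bwd (A (pos1 s0)) y2), (ent0 s0, S2)) 0 i by exact: D1_row_line.
have f2E y2 S2 i : fc_minus ((z0.1.1, y2), (z0.2.1, S2)) 0 i =
  total_force Ffrm Fextm ((pos0 s0, bwd (A (pos1 s0)) y2), (ent0 s0, S2)) 0 i.
  rewrite /fc_minus /total_force [LHS]mxE [RHS]mxE.
  exact: (congr2 +%R (force_chart_line y2 S2 i hFfrm) (force_chart_line y2 S2 i hFextm)).
apply/matrixP => j i; rewrite [RHS]mxE [LHS]mxE -(derive_coord i _ dG).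
case: (split_ordP i) => {i} i ->.
  have -> : (fun p => scheme_eq r0 s0 p 0 (lshift 1 i)) =
      (fun p => momentum r0 s0 p.1 (next_coord p) 0 i).
    by apply/funext => p; rewrite /scheme_eq row_mxEl.
  rewrite momentum_derive /regularity_matrix.
  case: (split_ordP j) => {j} j ->.
    rewrite block_mxEul [RHS]mxE; congr (_ + _); first exact: (D2cov_line _ _ f1E).
    exact: (D2cov_line _ _ f2E).
  rewrite block_mxEur ord1 [RHS]mxE; congr (_ + _); first exact: (D4cov_line _ _ f1E).
  exact: (D4cov_line _ _ f2E).
have -> : (fun p => scheme_eq r0 s0 p 0 (rshift n i)) =
    (fun p => (P \o bwd (dch s0)) (next_coord p)).
  by apply/funext => p; rewrite /scheme_eq row_mxEr mxE !ord1 eqxx.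
case: (split_ordP j) => {j} j ->.
  by rewrite /regularity_matrix block_mxEdl ord1; exact: D2_P_line.
by rewrite /regularity_matrix block_mxEdr [RHS]mxE !ord1 eqxx; exact: D4_P_line.
Qed.

End at_pair.

Hypothesis regular : forall r, regularity_matrix A L P Ffrm Fextm r \in unitmx.

(* The implicit function theorem, applied in the charts preferred at two
   consecutive states, solves the scheme for the last two coordinates. *)
Lemma local_flow r0 s0 : scheme A L P Ffrm Ffrp Fextm Fextp r0 s0 ->
  exists (U W : set (dstate R Q)) (F : dstate R Q -> dstate R Q),
  [/\ open U /\ U r0, open W /\ W s0,
      forall r, U r -> smooth_at dch dch F r,
      forall r, U r -> W (F r) &
      forall r, constraint P r -> U r -> forall s, W s ->
        (scheme A L P Ffrm Ffrp Fextm Fextp r s <-> s = F r)].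
Proof.
move=> [[pos_rs ent_rs] mom [Pr0 Ps0]].
pose x0 : E := fwd (dch r0) r0; pose z0 : E := fwd (dch s0) s0.
pose y0 : Y := next_unknown z0.
have nc0 : next_coord (x0, y0) = z0 by exact: next_coord0.
have ix0 : image r0 x0 by exact: center_image.
have iz0 : image s0 z0 by exact: center_image.
have rK : bwd (dch r0) x0 = r0 by exact: chartK.
have sK : bwd (dch s0) z0 = s0 by exact: chartK.
have G0 : scheme_eq r0 s0 (x0, y0) = 0.
  apply/scheme_eq0; rewrite nc0 sK; split => //.
  by apply/(momentum0 pos_rs ix0 iz0); rewrite rK sK.
have uJ : partial_jacobian (scheme_eq r0 s0) (x0, y0) \in unitmx.
  by rewrite (scheme_jacobian pos_rs ent_rs) unitmx_tr.
have CG : Coo_at (scheme_eq r0 s0) (x0, y0) by exact: scheme_eq_Coo.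
have [A0 [B0 [g [[oA0 A0x] [oB0 B0y] _ Cg gP]]]] :=
  implicit_function fE CG G0 uJ filterT.
have Cg' x : A0 x -> Coo_at g x by move=> A0'; apply/Coo_atP; exists A0.
pose J x := next_coord (x, g x).
have CJ x : A0 x -> Coo_at J x.
  move=> A0'; apply: (@Coo_lin_comp _ _ (E * Y)%type E (fun x => (x, g x)) next_coord) => //.
    exact: next_coord_linear.
  by apply: Coo_pair; [exact: Coo_id|exact: Cg'].
(* The last condition keeps the solution in the image of the chart at [s0], where [bwd] is inverted
   by [fwd]. *)
pose U := [set r | [/\ dom (dch r0) r, A0 (fwd (dch r0) r) & image s0 (J (fwd (dch r0) r))]].
pose W := [set s | dom (dch s0) s /\ B0 (next_unknown (fwd (dch s0) s))].
pose F r := bwd (dch s0) (J (fwd (dch r0) r)).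
have gx0 : g x0 = y0 by have [_ H] := gP x0 A0x; apply/esym/(H y0 B0y).
exists U, W, F; split.
- split; last by split; [exact: (atlas_dom aD)|exact: A0x|rewrite /J -/x0 gx0 nc0].
  rewrite openE => r [dr Ar iJ]; have cf := atlas_fwd aD dr.
  have nA : \forall x \near fwd (dch r0) r, A0 x by exact: open_nbhs_nbhs.
  have nJ : \forall x \near fwd (dch r0) r, image s0 (J x).
    by apply: (Coo_at_continuous (CJ _ Ar)); exact: (atlas_near_image aD).
  have nr : \forall r' \near r, dom (dch r0) r' by exact: (atlas_near_dom aD).
  by apply: filterS3 nr (cf _ nA) (cf _ nJ) => r' ? ? ?; split.
- split; last by split; [exact: (atlas_dom aD)|exact: B0y].
  rewrite openE => s [ds Bs]; have cf := atlas_fwd aD ds.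
  have cu : {for fwd (dch s0) s, continuous (@next_unknown)}.
    apply: Coo_at_continuous; apply: Coo_lin => // a u v.
    rewrite /next_unknown /= scale_row_mx add_row_mx raddfD /=; congr (row_mx _ (_ + _)).
    by rewrite -mul_scalar_mx -scalar_mxM.
  have nB : \forall y \near next_unknown (fwd (dch s0) s), B0 y by exact: open_nbhs_nbhs.
  have ns : \forall s' \near s, dom (dch s0) s' by exact: (atlas_near_dom aD).
  by apply: filterS2 ns (cf _ (cu _ nB)) => s' ? ?; split.
- move=> r [dr Ar iJ].
  have s1 : smooth_at dch (id_charts E) (fwd (dch r0)) r by exact: (smooth_chart aD).
  have s2 : smooth_at (id_charts E) (id_charts E) J (fwd (dch r0) r).
    by apply/smooth_id; exact: CJ.
  have s3 : smooth_at (id_charts E) dch (bwd (dch s0)) (J (fwd (dch r0) r)) by exact: smooth_bwd.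
  have s23 : smooth_at (id_charts E) dch (bwd (dch s0) \o J) (fwd (dch r0) r).
    exact: (smooth_comp (B := id_charts E)).
  by apply: (smooth_comp (B := id_charts E) (g := bwd (dch s0) \o J)) => //; exact: chartK.
- move=> r [dr Ar [s ds sE]].
  have -> : F r = s by rewrite /F -sE (atlas_bwdK aD ds).
  split; first exact: ds.
  have -> : next_unknown (fwd (dch s0) s) = g (fwd (dch r0) r).
    by rewrite sE; exact: next_coordK.
  exact: (gP _ Ar).1.
- move=> r Pr [dr Ar iJ] s [ds Bs]; set x := fwd (dch r0) r in Ar iJ *.
  have [gB gU] := gP x Ar.
  have ix : image r0 x by exists r.
  have rxK : bwd (dch r0) x = r by exact: (atlas_bwdK aD).
  have iz : image s0 (fwd (dch s0) s) by exists s.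
  have szK : bwd (dch s0) (fwd (dch s0) s) = s by exact: (atlas_bwdK aD).
  split.
    (* A successor shares q_k and S_k with [r], so its coordinates are determined by its unknown
       part, which uniqueness identifies with the value of [g]. *)
    move=> [[ps es] ms [_ Ps]].
    have nE : next_coord (x, next_unknown (fwd (dch s0) s)) = fwd (dch s0) s.
      apply: next_unknownK; last exact: (esym es).
      exact: (esym (congr2 (fun q q' => fwd (A q) q') pos_rs ps)).
    have : scheme_eq r0 s0 (x, next_unknown (fwd (dch s0) s)) = 0.
      apply/scheme_eq0; rewrite nE szK; split => //.
      by apply/(momentum0 pos_rs ix iz); rewrite rxK szK.
    by move=> /gU -/(_ Bs) gE; rewrite /F -/x /J -gE nE szK.
  have [mJ PJ] := (scheme_eq0 _ _ _).1 ((gU (g x) gB).2 erefl).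
  move=> sE; have sJ : bwd (dch s0) (J x) = s by rewrite sE.
  have ps : pos0 s = pos1 r.
    rewrite -sJ /J /next_coord /pos0 /= -/(pos0 s0) pos_rs.
    by apply: (atlas_bwdK aA); have [[_ ?] _] := dr.
  have es : ent0 s = ent1 r by rewrite -sJ.
  split => //; last by split => //; rewrite /constraint /= -sJ.
  move: mJ => /(momentum0 pos_rs ix iJ); rewrite rxK sJ; exact.
Qed.

End local_flow.

(** * The constraint hypersurface *)

Section splitting.
Context {R : realType}.

Definition insert_coord m (j : 'I_m.+1) (z : 'rV[R]_m) : 'rV[R]_m.+1 :=
  \row_k oapp (z 0) 0 (unlift j k).

Lemma insert_coord_linear m (j : 'I_m.+1) : linear (insert_coord j).
Proof.
move=> a u v; apply/rowP => k; rewrite !mxE.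
by case: (unlift j k) => [i|] /=; rewrite ?mxE ?mulr0 ?addr0.
Qed.

Lemma insert_coordK m (j : 'I_m.+1) z : col' j (insert_coord j z) = z.
Proof. by apply/rowP => k; rewrite !mxE liftK. Qed.

Lemma insert_coord_at m (j : 'I_m.+1) z : insert_coord j z 0 j = 0.
Proof. by rewrite mxE unlift_none. Qed.

Lemma insert_coord_split m (j : 'I_m.+1) (v : 'rV[R]_m.+1) :
  v = insert_coord j (col' j v) + v 0 j *: delta_mx 0 j.
Proof.
apply/rowP => k; rewrite !mxE; case: unliftP => [i ->|->] /=.
  by rewrite mxE eq_sym (negbTE (neq_lift _ _)) mulr0 addr0.
by rewrite eqxx mulr1 add0r.
Qed.

Context {n : nat}.
Local Notation E := (dmodel R n).

(** Flattening to a row allows one coordinate to be deleted; the dimension is written so as to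
    compute to the successor of that of [cmodel]. *)
Definition pack_model (w : E) : 'rV[R]_(1 + (n + n + 1)) :=
  row_mx (w.2.2)%:M (row_mx (row_mx w.1.1 w.1.2) (w.2.1)%:M).

Definition unpack_model (v : 'rV[R]_(1 + (n + n + 1))) : E :=
  ((lsubmx (lsubmx (rsubmx v)), rsubmx (lsubmx (rsubmx v))),
   (rsubmx (rsubmx v) 0 0, lsubmx v 0 0)).

Lemma pack_modelK : cancel pack_model unpack_model.
Proof.
move=> [[a b] [s t]]; rewrite /unpack_model /pack_model /=.
by rewrite !(row_mxKl, row_mxKr) !mxE !eqxx.
Qed.

Lemma unpack_modelK : cancel unpack_model pack_model.
Proof.
move=> v; rewrite /pack_model /= hsubmxK.
have scalar1 (M : 'M[R]_1) : (M 0 0)%:M = M by rewrite -mx11_scalar.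
by rewrite !scalar1 !hsubmxK.
Qed.

Lemma unpack_model_linear : linear unpack_model.
Proof.
move=> a u v; rewrite /unpack_model !linearP /=.
by apply: injective_projections; apply: injective_projections; rewrite /= ?mxE.
Qed.

Lemma pack_model_linear : linear pack_model.
Proof.
move=> a u v; apply: (can_inj unpack_modelK).
by rewrite unpack_model_linear !pack_modelK.
Qed.

(** A nonzero functional is nonzero on some coordinate vector [d]. Then [kappa] and [lambda] are the
    inclusion of, and projection to, the complementary coordinate hyperplane, and [c] is the deleted
    coordinate. *)
Lemma functional_splitting (l : E -> R) w : linear l -> l w != 0 ->
  exists (kappa : cmodel R n -> E) (lambda : E -> cmodel R n) (c : E -> R) (d : E),
  [/\ [/\ linear kappa, linear lambda & linear c],
      l d != 0,
      forall v, v = kappa (lambda v) + c v *: d,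
      forall z t, lambda (kappa z + t *: d) = z &
      forall z t, c (kappa z + t *: d) = t].
Proof.
move=> ll lw.
have lp := pack_model_linear; have lu := unpack_model_linear.
have lul : linear (fun v => l (unpack_model v)) by move=> a u v; rewrite lu ll.
have [j lj] : exists j, l (unpack_model (delta_mx 0 j)) != 0.
  apply/existsP; apply: contra_neqT lw => /existsPn H.
  rewrite -(pack_modelK w) (linear_row _ lul) big1 // => j _.
  by have /negPn/eqP-> := H j; rewrite mulr0.
have li := insert_coord_linear (j : 'I_(n + n + 1).+1).
exists (fun z => unpack_model (insert_coord (j : 'I_(n + n + 1).+1) z)),
  (fun v => col' (j : 'I_(n + n + 1).+1) (pack_model v)),
  (fun v => pack_model v 0 j), (unpack_model (delta_mx 0 j)).
have packE z t : pack_model (unpack_model (insert_coord (j : 'I_(n + n + 1).+1) z) +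
    t *: unpack_model (delta_mx 0 j)) = insert_coord (j : 'I_(n + n + 1).+1) z + t *: delta_mx 0 j.
  by rewrite addrC -lu addrC unpack_modelK.
split.
- split => a u v.
  + by rewrite li lu.
  + by rewrite lp; apply/rowP => k; rewrite !mxE.
  + by rewrite lp !mxE.
- exact: lj.
- move=> v; apply: (can_inj pack_modelK); rewrite packE.
  exact: insert_coord_split.
- move=> z t; rewrite packE -[RHS](insert_coordK (j : 'I_(n + n + 1).+1)).
  by apply/rowP => k; rewrite !mxE eqxx /= eq_sym (negbTE (neq_lift _ _)) mulr0 addr0.
- move=> z t; rewrite packE mxE insert_coord_at add0r !mxE !eqxx; exact: mulr1.
Qed.

End splitting.

Section submanifold.
Context {R : realType} {n : nat} {Q : topologicalType} {A : charted Q 'rV[R]_n}.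
Hypothesis aA : atlas A.
Local Notation V := 'rV[R]_n.
Local Notation E := (dmodel R n).
Local Notation X := (cmodel R n).
Local Notation T := (dstate R Q).
Local Notation dch := (dcharts A : charted T E).
Local Notation image r := (fwd (dch r) @` dom (dch r)).
Let aD := dcharts_atlas aA.
Let fE : finite_dim (E : normedModType R) := finite_dim_dmodel.
Let fX : finite_dim (X : normedModType R) := @finite_dim_mx R 1 (n + n + 1).
Variable P : T -> R.
Hypothesis sP : smooth_function A P.

(** If dP vanished at [r], so would the last row of the matrix, made of [D2 P] and [D4 P]. *)
Lemma regular_submersion (L : T -> R) (Ffrm Fextm : force R n Q) r :
  regularity_matrix A L P Ffrm Fextm r \in unitmx ->
  exists w, 'd (P \o bwd (dch r)) (fwd (dch r) r) w != 0.
Proof.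
move=> reg; have dP := Coo_at_diff (chart_function_Coo aA sP (center_image aA r)).
apply: contrapT => H.
have H0 w : 'd (P \o bwd (dch r)) (fwd (dch r) r) w = 0.
  by apply/eqP; apply: contra_notT H => Hw; exists w.
have D2P : D2 A P r = 0.
  by apply/rowP => i; rewrite (derive_D2 aA) (deriveE _ dP) H0 mxE.
have D4P : D4 P r = 0 by rewrite (derive_D4 aA) (deriveE _ dP) H0.
have : row (rshift n ord0) (regularity_matrix A L P Ffrm Fextm r) = 0.
  apply/rowP => k; rewrite [LHS]mxE /regularity_matrix [RHS]mxE.
  case: (split_ordP k) => i ->; first by rewrite block_mxEdl D2P mxE.
  by rewrite block_mxEdr D4P mxE mul0rn.
rewrite rowE => /(congr1 (mulmx^~ (invmx (regularity_matrix A L P Ffrm Fextm r)))).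
rewrite mulmxK // mul0mx => /rowP/(_ (rshift n ord0)).
by rewrite !mxE !eqxx => /eqP; rewrite oner_eq0.
Qed.

(* The chart projects along a direction [d] on which dP does not vanish; its
   inverse is the graph map given by the implicit function theorem. *)
Lemma slice_chart x : P x = 0 ->
  (exists w, 'd (P \o bwd (dch x)) (fwd (dch x) x) w != 0) ->
  exists B : chart T X,
    [/\ open (dom B) /\ dom B x,
        forall y, dom B y -> smooth_at dch (id_charts X) (fwd B) y,
        open (fwd B @` (dom B `&` constraint P)),
        forall z, (fwd B @` (dom B `&` constraint P)) z ->
          smooth_at (id_charts X) dch (bwd B) z &
        forall y, (dom B `&` constraint P) y -> bwd B (fwd B y) = y].
Proof.
move=> Px [w dw]; pose Ph := P \o bwd (dch x); set x0 := fwd (dch x) x in dw.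
have ldP : linear ('d Ph x0 : E -> R) by move=> a u v; rewrite linearP.
have [kappa [lambda [c [d [[lk ll lc] dd wE lamK cK]]]]] := functional_splitting ldP dw.
have CP : Coo_at Ph x0 := chart_function_Coo aA sP (center_image aA x).
pose Y := 'rV[R]_1.
have fY : finite_dim (Y : normedModType R) := @finite_dim_mx R 1 1.
pose psi (p : X * Y) : E := kappa p.1 + p.2 0 0 *: d.
have lpsi : linear psi.
  by move=> a u v; rewrite /psi /= lk !mxE scalerDl scalerDr scalerA addrACA.
have lscal : linear (fun s : R => s%:M : Y).
  by move=> a u v; rewrite raddfD /= -mul_scalar_mx -scalar_mxM.
(* P = 0 as a 1 x 1 system for the coordinate along [d]; its Jacobian entry at the base point is dP
   applied to [d]. *)
pose G (p : X * Y) : Y := (Ph (psi p))%:M.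
pose x1 := lambda x0; pose y1 : Y := (c x0)%:M.
have psi1 : psi (x1, y1) = x0 by rewrite /psi /= mxE eqxx mulr1n -wE.
have fXY : finite_dim (X * Y : normedModType R)%type by exact: finite_dim_prod.
have CG1 : Coo_at (Ph \o psi) (x1, y1).
  by apply: (Coo_comp fE); [exact: Coo_lin|rewrite psi1].
have CG : Coo_at G (x1, y1).
  by apply: (@Coo_lin_comp _ _ R Y (Ph \o psi) (fun s : R => s%:M : Y)) => //; exact: finite_dimR.
have PhK y : dom (dch x) y -> Ph (fwd (dch x) y) = P y.
  by move=> dy; exact: (congr1 P (atlas_bwdK aD dy)).
have xx : dom (dch x) x by exact: (atlas_dom aD).
have G0 : G (x1, y1) = 0 by rewrite /G psi1 (PhK x xx) Px raddf0.
have uJ : partial_jacobian G (x1, y1) \in unitmx.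
  rewrite unitmxE det_mx11 unitfE mxE -(derive_coord _ _ (Coo_at_diff CG)).
  have -> : (fun p => G p 0 0) = Ph \o psi.
    by apply/funext => p; rewrite /G mxE eqxx mulr1n.
  rewrite (_ : 'D_ _ _ _ = 'd Ph x0 d) // -deriveE; last exact: Coo_at_diff.
  have psi0 : psi (0, delta_mx 0 0) = d.
    have k0 : kappa 0 = 0 by have := lk (-1) 0 0; rewrite scaleN1r !oppr0 !addr0 scaleN1r addNr.
    by rewrite /psi /= k0 mxE !eqxx scale1r add0r.
  by apply: derive_line_eq => h; rewrite [LHS]/= lpsi psi1 psi0.
have [A0 [B0 [g [[oA0 A0x] [oB0 B0y] _ Cg gP]]]] :=
  implicit_function fX CG G0 uJ filterT.
have Cg' z : A0 z -> Coo_at g z by move=> A0'; apply/Coo_atP; exists A0.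
pose J z := psi (z, g z).
have CJ z : A0 z -> Coo_at J z.
  move=> A0'; apply: (@Coo_lin_comp _ _ (X * Y)%type E (fun z => (z, g z)) psi) => //.
  by apply: Coo_pair; [exact: Coo_id|exact: Cg'].
have Clam z : Coo_at lambda z by exact: Coo_lin.
pose cY (w : E) : Y := (c w)%:M.
have lcY : linear cY by move=> a u v; rewrite /cY lc lscal.
have CcY z : Coo_at cY z by exact: Coo_lin.
have cYK z : cY (J z) = g z.
  by rewrite /cY /J /psi cK; apply/matrixP => i j; rewrite !ord1 mxE eqxx mulr1n.
(* [A0] and [B0] confine the domain to where the graph of [g] is the whole zero set. *)
pose D := [set y | [/\ dom (dch x) y, A0 (lambda (fwd (dch x) y)) & B0 (cY (fwd (dch x) y))]].
have psiK v : psi (lambda v, cY v) = v by rewrite /psi /= mxE eqxx mulr1n -wE.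
have JE y : D y -> P y = 0 -> J (lambda (fwd (dch x) y)) = fwd (dch x) y.
  move=> [dy Ay By] Py; have [_ gU] := gP _ Ay.
  have : G (lambda (fwd (dch x) y), cY (fwd (dch x) y)) = 0.
    by rewrite /G psiK (PhK y dy) Py raddf0.
  by move=> /(gU _ By) gE; rewrite /J -gE psiK.
have imE : (lambda \o fwd (dch x)) @` (D `&` constraint P) =
    [set z | A0 z /\ image x (J z)].
  apply/seteqP; split => [_ [y [Dy Py] <-]|z [Az [y dy yE]]].
    by have [dy Ay _] := Dy; split => //; exists y => //; rewrite /= JE.
  have [Bg /(_ _ (gP z Az).1) gU] := gP z Az.
  have lJ : lambda (J z) = z by exact: lamK.
  exists y; last exact: (etrans (congr1 lambda yE) lJ).
  split; first by split => //; rewrite yE ?lJ ?cYK.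
  have := gU.2 erefl; rewrite /G -/(J z) -yE (PhK y dy).
  by move=> /matrixP/(_ 0 0); rewrite !mxE eqxx mulr1n.
exists (Chart D (lambda \o fwd (dch x)) (bwd (dch x) \o J)); split.
- split; last by split; [exact: (atlas_dom aD)|exact: A0x|exact: B0y].
  rewrite openE => y [dy Ay By]; have cf := atlas_fwd aD dy.
  have nA : \forall z \near lambda (fwd (dch x) y), A0 z by exact: open_nbhs_nbhs.
  have nB : \forall z \near cY (fwd (dch x) y), B0 z by exact: open_nbhs_nbhs.
  have ny : \forall y' \near y, dom (dch x) y' by exact: (atlas_near_dom aD).
  apply: filterS3 ny (cf _ (Coo_at_continuous (Clam _) nA))
    (cf _ (Coo_at_continuous (CcY _) nB)) => y' ? ? ?; split => //.
- move=> y [dy _ _].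
  apply: (smooth_comp (B := id_charts E)) => //; first exact: chartK.
    exact: (smooth_chart aD).
  exact/smooth_id.
- rewrite imE openE => z [Az iJ].
  have nA : \forall z' \near z, A0 z' by exact: open_nbhs_nbhs.
  have nJ : \forall z' \near z, image x (J z').
    by apply: (Coo_at_continuous (CJ _ Az)); exact: (atlas_near_image aD).
  by apply: filterS2 nA nJ => z' ? ?; split.
- move=> z; rewrite imE => -[Az iJ].
  apply: (smooth_comp (B := id_charts E)) => //; last exact: smooth_bwd.
  by apply/smooth_id; exact: CJ.
- move=> y [Dy Py]; have [dy _ _] := Dy.
  exact: (etrans (congr1 (bwd (dch x)) (JE y Dy Py)) (atlas_bwdK aD dy)).
Qed.

Lemma submanifold_exists :
  (forall x, P x = 0 -> exists w, 'd (P \o bwd (dch x)) (fwd (dch x) x) w != 0) ->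
  exists cC : charted T X, is_submanifold dch (constraint P) cC.
Proof.
move=> sub.
have H x : exists B : chart T X, P x = 0 ->
    [/\ open (dom B) /\ dom B x,
        forall y, dom B y -> smooth_at dch (id_charts X) (fwd B) y,
        open (fwd B @` (dom B `&` constraint P)),
        forall z, (fwd B @` (dom B `&` constraint P)) z ->
          smooth_at (id_charts X) dch (bwd B) z &
        forall y, (dom B `&` constraint P) y -> bwd B (fwd B y) = y].
  have [Px|Px] := pselect (P x = 0).
    by have [B HB] := slice_chart Px (sub x Px); exists B.
  (* Off the hypersurface the chart is only a filler for the choice function. *)
  by exists (Chart set0 (fun=> 0) (fun=> x)) => /Px.
by have [cC HC] := choice H; exists cC => x /HC.
Qed.

End submanifold.

(** * The flow on the hypersurface *)

Section submanifold_maps.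
Context {R : realType} {V X : normedModType R} {T : topologicalType}.
Context {D : charted T V} {K : set T} {B : charted T X}.
Hypotheses (aD : atlas D) (fV : finite_dim V).
Hypothesis sub : is_submanifold D K B.
Local Notation image x := (fwd (B x) @` (dom (B x) `&` K)).

Lemma submanifold_center x : K x -> image x (fwd (B x) x).
Proof. by move=> Kx; have [[_ dx] _ _ _ _] := sub Kx; exists x. Qed.

Lemma submanifoldK x : K x -> bwd (B x) (fwd (B x) x) = x.
Proof. by move=> Kx; have [[_ dx] _ _ _ BK] := sub Kx; exact: BK. Qed.

Lemma submanifold_near x z : K x -> image x z -> \forall z' \near z, image x z'.
Proof. by move=> Kx iz; apply: open_nbhs_nbhs; split => //; have [] := sub Kx. Qed.

Lemma submanifold_mem x z : K x -> image x z -> K (bwd (B x) z).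
Proof.
move=> Kx [y [dy Ky] <-]; have [_ _ _ _ BK] := sub Kx.
by rewrite BK.
Qed.

Lemma submanifold_bwd x z : K x -> image x z ->
  smooth_at (id_charts X) D (bwd (B x)) z.
Proof. by move=> Kx; have [_ _ _ sb _] := sub Kx; exact: sb. Qed.

Lemma smooth_inclusion x : K x -> smooth_at B D id x.
Proof.
move=> Kx; apply/(smooth_center _ (submanifoldK Kx)).
exact: (submanifold_bwd Kx (submanifold_center Kx)).
Qed.

(** The slice chart is smooth on an open subset of [T], so it can be composed with the map regarded
    as going into [T]. *)
Lemma smooth_into_submanifold (E : normedModType R) (h : E -> T) z : K (h z) ->
  smooth_at (id_charts E) D h z -> smooth_at (id_charts E) B h z.
Proof.
move=> Kh sh; have [[oB dB] sB _ _ _] := sub Kh.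
have near_dom : \forall w \near z, dom (B (h z)) (h w).
  by apply: (smooth_continuous aD sh); exact: open_nbhs_nbhs.
split; first exact: near_dom.
apply/(smooth_id (fwd (B (h z)) \o h)).
apply: (smooth_comp (B := D)) => //; last exact: sB.
by move=> y; exact: (atlas_bwdK aD).
Qed.

Lemma near_submanifoldK (E : normedModType R) (h : E -> T) z : K (h z) ->
  smooth_at (id_charts E) D h z -> (\forall w \near z, K (h w)) ->
  \forall w \near z, bwd (B (h z)) (fwd (B (h z)) (h w)) = h w.
Proof.
move=> Kh sh nK; have [near_dom _] := smooth_into_submanifold Kh sh.
have [_ _ _ _ BK] := sub Kh.
by apply: filterS2 nK near_dom => w Kw dw; exact: BK.
Qed.

Lemma smooth_on_submanifold (f : T -> T) x : K x -> K (f x) ->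
  smooth_at (id_charts X) D (f \o bwd (B x)) (fwd (B x) x) -> smooth_at B B f x.
Proof.
move=> Kx Kf sf; apply/(smooth_center _ (submanifoldK Kx)).
by apply: smooth_into_submanifold => //; rewrite /= submanifoldK.
Qed.

(** Lets forms restricted to the submanifold be pulled back along [f] as a map into the ambient
    space; the chart of [K] at [f x] inverts along [f] since [f] stays in [K] nearby. *)
Lemma tangent_inclusion (f : T -> T) x w : K x -> K (f x) ->
  smooth_at (id_charts X) D (f \o bwd (B x)) (fwd (B x) x) ->
  (\forall z \near fwd (B x) x, K (f (bwd (B x) z))) ->
  tangent_map B D id (f x) (tangent_map B B f x w) = tangent_map B D f x w.
Proof.
move=> Kx Kf sf nK; rewrite -(tangent_comp_within (C := D) (submanifoldK Kx)) //.
- have := @near_submanifoldK _ (f \o bwd (B x)) (fwd (B x) x).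
  by rewrite /= (submanifoldK Kx); apply.
- exact: smooth_on_submanifold.
- exact: smooth_inclusion.
Qed.

Lemma tangent_curve (f : T -> T) r z u : K r -> image r z ->
  let y := bwd (B r) z in
  smooth_at (id_charts X) D (f \o bwd (B y)) (fwd (B y) y) ->
  tangent_map B D f y (tangent_map (id_charts X) B (bwd (B r)) z u) =
  tangent_map (id_charts X) D (f \o bwd (B r)) z u.
Proof.
move=> Kr iz y sf; have Ky : K y := submanifold_mem Kr iz.
have sb := submanifold_bwd Kr iz.
have nK : \forall w \near z, K (bwd (B r) w).
  by apply: filterS (submanifold_near Kr iz) => w; exact: submanifold_mem.
rewrite -(tangent_comp_within (C := D) (A := id_charts X)) //.
- exact: (near_submanifoldK Ky sb nK).
- exact: smooth_into_submanifold.
- exact/(smooth_center _ (submanifoldK Ky)).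
Qed.

End submanifold_maps.

Section flow.
Context {R : realType} {n : nat} {Q : topologicalType} {A : charted Q 'rV[R]_n}.
Hypothesis aA : atlas A.
Local Notation V := 'rV[R]_n.
Local Notation E := (dmodel R n).
Local Notation X := (cmodel R n).
Local Notation T := (dstate R Q).
Local Notation dch := (dcharts A : charted T E).
Variables (L P : T -> R) (Ffrm Ffrp Fextm Fextp : force R n Q).
Hypotheses (sL : smooth_function A L) (sP : smooth_function A P).
Hypotheses (hFfrm : force_minus A Ffrm) (hFfrp : force_plus A Ffrp).
Hypotheses (hFextm : force_minus A Fextm) (hFextp : force_plus A Fextp).
Hypothesis regular : forall r, regularity_matrix A L P Ffrm Fextm r \in unitmx.
Let aD := dcharts_atlas aA.
Let fE : finite_dim (E : normedModType R) := finite_dim_dmodel.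
Local Notation C := (constraint P).
Local Notation sch := (scheme A L P Ffrm Ffrp Fextm Fextp).
Variable B : charted T X.
Hypothesis sub : is_submanifold dch C B.
Local Notation image x := (fwd (B x) @` (dom (B x) `&` C)).

Lemma submanifold_flow : well_defined_flow A L P Ffrm Ffrp Fextm Fextp B.
Proof.
move=> r s /(local_flow aA sL sP hFfrm hFfrp hFextm hFextp regular).
move=> [U [W [F [oU oW sF FW Fsch]]]]; exists U, W, F; split => // x Cx Ux.
  by split; [exact: FW|exact: Fsch].
have CF : C (F x) by have [_ _ []] := (Fsch x Cx Ux (F x) (FW x Ux)).2 erefl.
apply: (smooth_on_submanifold aD fE sub) => //.
apply: (smooth_comp (B := dch)) => //.
- by move=> y; exact: (atlas_bwdK aD).
- exact: (submanifold_bwd sub Cx (submanifold_center sub Cx)).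
- by rewrite (submanifoldK sub Cx); exact: sF.
Qed.

Section given_flow.
Variables (U : set T) (F : T -> T).
Hypothesis flow : discrete_flow A L P Ffrm Ffrp Fextm Fextp U F.

(** Continuity within the domain brings [F y] into the open set [W] where the scheme has a single
    solution, so [F] is there the smooth local solution. *)
Lemma flow_local_extension p : C p -> U p -> exists F' : T -> T,
  smooth_at dch dch F' p /\ \forall y \near p, C y -> U y -> F y = F' y.
Proof.
have [oU cF Fsch] := flow => Cp Up.
have [U' [W [F' [[oU' U'p] [oW WF] sF' _ F'sch]]]] :=
  local_flow aA sL sP hFfrm hFfrp hFextm hFextp regular (Fsch p Cp Up).
exists F'; split; first exact: sF'.
have nU : \forall y \near p, U' y by exact: open_nbhs_nbhs.
have nW : \forall y \near p, (C `&` U) y -> W (F y).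
  have := cF p W (open_nbhs_nbhs (conj oW WF)).
  by rewrite /nbhs /= -nbhs_subspace_in.
apply: filterS2 nU nW => y U'y Wy Cy Uy.
by apply/(F'sch y Cy U'y _ (Wy (conj Cy Uy))); exact: Fsch.
Qed.

Lemma iter_constraint k r : C r -> (forall j, (j < k)%N -> U (iter j F r)) ->
  C (iter k F r).
Proof.
have [_ _ Fsch] := flow => Cr; elim: k => [//|k IH] HU.
have Ck : C (iter k F r) by apply: IH => j jk; apply: HU; exact: ltnW.
by have [_ _ []] := Fsch _ Ck (HU k (ltnSn k)).
Qed.

(** [F] is only controlled on the hypersurface, so its last application is replaced by a smooth
    local extension, which agrees with it along the curve. The second conclusion, openness of the
    domain of the iterates, feeds the induction. *)
Lemma curve_smooth k r z : C r -> image r z ->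
  (forall j, (j < k)%N -> U (iter j F (bwd (B r) z))) ->
  smooth_at (id_charts X) dch (iter k F \o bwd (B r)) z /\
  \forall w \near z, image r w /\ forall j, (j < k)%N -> U (iter j F (bwd (B r) w)).
Proof.
move=> Cr iz; have [oU _ _] := flow; elim: k => [_|k IH HU].
  split; first exact: (submanifold_bwd sub Cr iz).
  by apply: filterS (submanifold_near sub Cr iz) => w iw.
have [|sk nk] := IH; first by move=> j jk; apply: HU; exact: ltnW.
have Cz : C (bwd (B r) z) := submanifold_mem sub Cr iz.
have Uk : U (iter k F (bwd (B r) z)) by exact: HU.
have Ck : C (iter k F (bwd (B r) z)).
  by apply: iter_constraint => // j jk; apply: HU; exact: ltnW.
have ck := smooth_continuous aD sk.
have nU : \forall w \near z, U ((iter k F \o bwd (B r)) w).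
  by apply: ck; exact: open_nbhs_nbhs.
split; last first.
  apply: filterS2 nk nU => w [iw Hw] Uw; split => // j.
  by rewrite ltnS leq_eqVlt => /predU1P[->//|]; exact: Hw.
have [F' [sF' F'E]] := flow_local_extension Ck Uk.
apply: (@smooth_eq _ _ _ _ _ (F' \o (iter k F \o bwd (B r)))).
  have nF : \forall w \near z, C ((iter k F \o bwd (B r)) w) ->
      U ((iter k F \o bwd (B r)) w) ->
      F ((iter k F \o bwd (B r)) w) = F' ((iter k F \o bwd (B r)) w).
    exact: (ck _ F'E).
  apply: filterS3 nk nU nF => w [iw Hw] Uw FE; apply/esym/FE => //.
  by apply: iter_constraint => //; exact: (submanifold_mem sub Cr iw).
apply: (smooth_comp (B := dch)) => //.
by move=> y; exact: (atlas_bwdK aD).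
Qed.

Lemma flow_smooth r : C r -> U r -> smooth_at B B F r.
Proof.
have [_ _ Fsch] := flow => Cr Ur.
have CF : C (F r) by have [_ _ []] := Fsch r Cr Ur.
apply: (smooth_on_submanifold aD fE sub) => //.
have := @curve_smooth 1 r _ Cr (submanifold_center sub Cr).
by rewrite (submanifoldK sub Cr) => -[[|//]|] //.
Qed.

End given_flow.
End flow.

(** * The identity between the discrete forms *)

Lemma diff_linear_comp (R : realType) (U V W : normedModType R) (f : U -> V)
    (p : V -> W) z u : finite_dim V -> linear p -> differentiable f z ->
  'd (p \o f) z u = p ('d f z u).
Proof.
move=> fV lp df; have dp := Coo_at_diff (Coo_lin (f z) fV lp).
by rewrite (diff_comp df dp) /= (diff_linear _ fV lp).
Qed.

(** The relation is limited to [k < N] because the last iterate may lie outside the domain of the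
    flow. *)
Lemma telescoping_sum (R : realType) (p m l : nat -> R) N :
  (forall k, (k < N)%N -> m k.+1 = p k) ->
  \sum_(0 <= k < N.+1) (p k - m k - l k) =
  p N - m 0%N - \sum_(0 <= k < N.+1) l k.
Proof.
elim: N => [|N IH] pm; first by rewrite !big_nat1.
rewrite big_nat_recr // [in RHS]big_nat_recr //= IH; last first.
  by move=> k kN; apply: pm; exact: ltnW.
have cancel (a b c d e : R) : a - b - c + (d - a - e) = d - b - (c + e) by ring.
by rewrite pm //; exact: cancel.
Qed.

Lemma pairing_add4 (R : realType) n (a b c d v : 'rV[R]_n) : a + b + c + d = 0 ->
  - pairing a v - pairing c v = pairing b v + pairing d v.
Proof.
move=> /(congr1 (fun xi => pairing xi v)); rewrite !pairingDl pairing0l.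
by move: (pairing a v) (pairing b v) (pairing c v) (pairing d v) => p q s t; lra.
Qed.

Section identity.
Context {R : realType} {n : nat} {Q : topologicalType} {A : charted Q 'rV[R]_n}.
Hypothesis aA : atlas A.
Local Notation V := 'rV[R]_n.
Local Notation E := (dmodel R n).
Local Notation X := (cmodel R n).
Local Notation T := (dstate R Q).
Local Notation dch := (dcharts A : charted T E).
Variables (L P : T -> R) (Ffrm Ffrp Fextm Fextp : force R n Q).
Hypotheses (sL : smooth_function A L) (sP : smooth_function A P).
Hypotheses (hFfrm : force_minus A Ffrm) (hFfrp : force_plus A Ffrp).
Hypotheses (hFextm : force_minus A Fextm) (hFextp : force_plus A Fextp).
Hypothesis regular : forall r, regularity_matrix A L P Ffrm Fextm r \in unitmx.
Let aD := dcharts_atlas aA.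
Let fE : finite_dim (E : normedModType R) := finite_dim_dmodel.
Local Notation C := (constraint P).
Local Notation sch := (scheme A L P Ffrm Ffrp Fextm Fextp).
Local Notation Thm := (Theta_minus A L Ffrm Fextm).
Local Notation Thp := (Theta_plus A L Ffrp Fextp).

(** The shared position moves with the same velocity seen from either state: the two base positions
    are equal at [z], hence so are their preferred charts. *)
Lemma tangent_pos (g h : X -> T) z u :
  (\forall w \near z, pos0 (h w) = pos1 (g w)) ->
  smooth_at (id_charts X) dch g z -> smooth_at (id_charts X) dch h z ->
  (tangent_map (id_charts X) dch h z u).1.1 =
  (tangent_map (id_charts X) dch g z u).1.2.
Proof.
move=> gh [_ /Coo_at_diff dg] [_ /Coo_at_diff dh].
have l0 : linear (fun w : E => w.1.1) by [].
have l1 : linear (fun w : E => w.1.2) by [].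
have d1 := differentiable_comp dg (Coo_at_diff (Coo_lin _ fE l1)).
apply: (etrans (esym (diff_linear_comp u fE l0 dh))).
apply: (etrans _ (diff_linear_comp u fE l1 dg)).
apply: (congr1 (fun f : X -> V => f u)).
refine (near_eq_diff _ d1).2.
have pz := nbhs_singleton gh.
apply: filterS gh => w /= ghw.
exact: (esym (congr2 (fun q q' => fwd (A q) q') pz ghw)).
Qed.

(* Along the flow, the scheme says that [Theta^-] at the next state is
   [Theta^+] at the current one. *)
Lemma scheme_Theta (g h : X -> T) z u : (\forall w \near z, sch (g w) (h w)) ->
  smooth_at (id_charts X) dch g z -> smooth_at (id_charts X) dch h z ->
  pull1 (id_charts X) dch h Thm z u = pull1 (id_charts X) dch g Thp z u.
Proof.
move=> nsch sg sh; have [[_ _] mom _] := nbhs_singleton nsch.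
have gh : \forall w \near z, pos0 (h w) = pos1 (g w).
  by apply: filterS nsch => w [[]].
rewrite /pull1 /Theta_minus /Theta_plus (tangent_pos u gh sg sh).
move: (tangent_map _ _ _ _ _).1.2 => v.
exact: (pairing_add4 v mom).
Qed.

Variable B : charted T X.
Hypothesis sub : is_submanifold dch C B.
Variables (U : set T) (F : T -> T).
Hypothesis flow : discrete_flow A L P Ffrm Ffrp Fextm Fextp U F.

Section at_state.
Variables (M : nat) (r : T).
Hypotheses (Cr : C r) (Ur : forall k, (k < M)%N -> U (iter k F r)).
Local Notation z0 := (fwd (B r) r).
Local Notation image x := (fwd (B x) @` (dom (B x) `&` C)).
Definition curve k : X -> T := iter k F \o bwd (B r).

Let rK : bwd (B r) z0 = r := submanifoldK sub Cr.

Lemma near_curve : \forall z \near z0, image r z /\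
  forall j, (j < M)%N -> U (curve j z).
Proof.
have := @curve_smooth _ _ _ _ aA _ _ _ _ _ _ sL sP hFfrm hFfrp hFextm hFextp regular
  B sub U F flow M r z0 Cr (submanifold_center sub Cr).
by rewrite rK => -[].
Qed.

Lemma curve_smooth_near : \forall z \near z0, forall k, (k <= M)%N ->
  smooth_at (id_charts X) dch (curve k) z.
Proof.
apply: filterS near_curve => z [iz HU] k kM.
apply: (curve_smooth aA sL sP hFfrm hFfrp hFextm hFextp regular sub flow Cr iz _).1.
by move=> j jk; apply: HU; exact: leq_trans kM.
Qed.

Lemma curve_constraint : \forall z \near z0, forall k, (k <= M)%N -> C (curve k z).
Proof.
apply: filterS near_curve => z [iz HU] k kM.
apply: (iter_constraint flow (submanifold_mem sub Cr iz)) => j jk.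
by apply: HU; exact: leq_trans kM.
Qed.

(** The neighbourhoods are nested because the telescoped identity is differentiated at the centre,
    while at each nearby [z] comparing tangent vectors requires the scheme around [z]. *)
Lemma curve_scheme : \forall z \near z0, \forall w \near z, forall k, (k < M)%N ->
  sch (curve k w) (curve k.+1 w).
Proof.
apply: near_join; apply: filterS2 near_curve curve_constraint => z [_ HU] HC k kM.
by have [_ _] := flow; apply; [exact: HC (ltnW kM)|exact: HU].
Qed.

(** The vector passes through the chart of the hypersurface preferred at the moving point [y]; the
    chain rule eliminates this chart and leaves the tangent map of g_k. *)
Lemma tangent_iter : \forall z \near z0, forall k, (k <= M)%N -> forall u,
  let y := bwd (B r) z in
  tangent_map B dch id (iter k F y)
    (tangent_map B B (iter k F) y (tangent_map (id_charts X) B (bwd (B r)) z u)) =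
  tangent_map (id_charts X) dch (curve k) z u.
Proof.
apply: filterS2 near_curve curve_constraint => z [iz HU] HC k kM u y.
have Cy : C y := submanifold_mem sub Cr iz.
have iy := submanifold_center sub Cy.
have HU' j : (j < k)%N -> U (iter j F (bwd (B y) (fwd (B y) y))).
  by move=> jk; rewrite (submanifoldK sub Cy); apply: HU; exact: leq_trans kM.
have [sk nk] := curve_smooth aA sL sP hFfrm hFfrp hFextm hFextp regular sub flow Cy iy HU'.
rewrite (tangent_inclusion aD fE sub) //.
- exact: (tangent_curve aD fE sub u Cr iz sk).
- exact: HC.
- apply: filterS nk => w [iw Hw].
  by apply: (iter_constraint flow (submanifold_mem sub Cy iw)).
Qed.

Let omega : form1 R T E := fun r u =>
  omega_force Ffrm Ffrp r u + omega_force Fextm Fextp r u + omega_tau L r u.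

Lemma pullback_sum : \forall z \near z0, forall u,
  pull1 (id_charts X) B (bwd (B r)) (fun s w =>
    \sum_(0 <= k < M.+1) pull1 B B (iter k F) (pull1 B dch id omega) s w) z u =
  pull1 (id_charts X) dch (curve M) Thp z u -
  pull1 (id_charts X) dch (curve 0) Thm z u -
  \sum_(0 <= k < M.+1) 'd (L \o curve k) z u.
Proof.
apply: filterS3 curve_smooth_near curve_scheme tangent_iter => z sk schk Tk u.
rewrite -(telescoping_sum (p := fun k => pull1 (id_charts X) dch (curve k) Thp z u)
  (m := fun k => pull1 (id_charts X) dch (curve k) Thm z u)); last first.
  move=> k kM; apply: scheme_Theta; [|exact: sk (ltnW kM)|exact: sk].
  by apply: filterS schk => w; apply.
rewrite [LHS]/pull1; apply: eq_big_nat => k /andP[_ kM].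
apply: (etrans (congr1 (omega _) (Tk k kM u))).
exact: (omega_decomposition aA Ffrm Ffrp Fextm Fextp sL u (sk k kM)).
Qed.

Lemma identity_at u v :
  pull2 B B (iter M F) (pull2 B dch id (Omega_plus A L Ffrp Fextp)) r u v
    - pull2 B dch id (Omega_minus A L Ffrm Fextm) r u v =
  - extd B (fun s w =>
      \sum_(0 <= k < M.+1) pull1 B B (iter k F) (pull1 B dch id omega) s w) r u v.
Proof.
have sk k : (k <= M)%N -> \forall z \near z0, smooth_at (id_charts X) dch (curve k) z.
  by move=> kM; apply: filterS curve_smooth_near => z; apply.
have sk0 k (kM : (k <= M)%N) := nbhs_singleton (sk k kM).
have CL k : (k <= M)%N -> Coo_at (L \o curve k) z0.
  by move=> kM; exact: (smooth_function_comp aA sL (sk0 k kM)).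
(* Pull-back commutes with d for the two boundary terms, which produces Omega^+ and Omega^- up to
   sign. *)
have [dp pE] := extd_pull1 fE aD (sk M (leqnn M)) (Theta_plus_linear L Ffrp Fextp)
  (fun w => Theta_plus_diff aA sL hFfrp hFextp (curve M z0) w).
have [dm mE] := extd_pull1 fE aD (sk 0%N (leq0n M)) (Theta_minus_linear L Ffrm Fextm)
  (fun w => Theta_minus_diff aA sL hFfrm hFextm (curve 0 z0) w).
pose p := pull1 (id_charts X) dch (curve M) Thp.
pose m := pull1 (id_charts X) dch (curve 0) Thm.
pose S (v' : X) z := \sum_(k < M.+1) 'd (L \o curve k) z v'.
have dS (v' : X) (k : 'I_M.+1) : differentiable (fun z => 'd (L \o curve k) z v') z0.
  exact: (exterior_exact v' v' (CL k (ltn_ord k))).2.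
have SE u' v' : 'D_u' (S v') z0 = \sum_(k < M.+1) 'D_u' (fun z => 'd (L \o curve k) z v') z0.
  exact: (derive_bigsum _ (dS v')).2.
(* The differentials of L_d along the curves are closed and drop out. *)
have S0 : 'D_u (S v) z0 - 'D_v (S u) z0 = 0.
  rewrite !SE -sumrB big1 // => k _.
  exact: (exterior_exact u v (CL k (ltn_ord k))).1.
have bE u' v' : 'D_u' ((pull1 (id_charts X) B (bwd (B r)) (fun s w =>
    \sum_(0 <= k < M.+1) pull1 B B (iter k F) (pull1 B dch id omega) s w))^~ v') z0 =
    'D_u' (p^~ v') z0 - 'D_u' (m^~ v') z0 - 'D_u' (S v') z0.
  have nE : \forall z \near z0, ((p^~ v' - m^~ v') - S v') z =
      pull1 (id_charts X) B (bwd (B r)) (fun s w =>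
      \sum_(0 <= k < M.+1) pull1 B B (iter k F) (pull1 B dch id omega) s w) z v'.
    apply: filterS pullback_sum => z ->.
    by rewrite big_mkord.
  rewrite -(near_eq_derive _ nE).
  have dS' : derivable (S v') z0 u'.
    by apply: diff_derivable; exact: (derive_bigsum _ (dS v')).1.
  have dp' : derivable (p^~ v') z0 u' by apply: diff_derivable; exact: dp.
  have dm' : derivable (m^~ v') z0 u' by apply: diff_derivable; exact: dm.
  by rewrite (deriveB (derivableB dp' dm') dS') (deriveB dp' dm').
have cancel (a b c a' b' c' : R) : c - c' = 0 ->
    (a - b - c) - (a' - b' - c') = (a - a') - (b - b').
  by move=> /subr0_eq ->; ring.
have opp (a b : R) : - a - - b = - (a - b) by ring.
have RE := etrans (congr2 (fun a b => a - b) (bE u v) (bE v u)) (cancel _ _ _ _ _ _ S0).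
have Cz := iter_constraint flow Cr Ur.
have [cM HM] : smooth_at (id_charts X) dch (curve M) z0 /\
    \forall w \near z0, C (curve M w).
  by split; [exact: sk0|apply: filterS curve_constraint => w; apply].
have TM w : tangent_map B dch id (iter M F r) (tangent_map B B (iter M F) r w) =
    tangent_map (id_charts X) dch (curve M) z0 w.
  rewrite (tangent_inclusion aD fE sub w Cr Cz cM HM).
  exact: (tangent_center _ _ rK).
have T0 w : tangent_map B dch id r w = tangent_map (id_charts X) dch (curve 0) z0 w.
  exact: (tangent_center _ _ rK).
have LP : pull2 B B (iter M F) (pull2 B dch id (Omega_plus A L Ffrp Fextp)) r u v =
    - pull2 (id_charts X) dch (curve M) (extd dch Thp) z0 u v.
  rewrite /pull2 /Omega_plus !TM.
  exact: (congr1 (fun t => - extd dch Thp (iter M F t) _ _) (esym rK)).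
have LM : pull2 B dch id (Omega_minus A L Ffrm Fextm) r u v =
    - pull2 (id_charts X) dch (curve 0) (extd dch Thm) z0 u v.
  rewrite /pull2 /Omega_minus !T0.
  exact: (congr1 (fun t => - extd dch Thm t _ _) (esym rK)).
rewrite LP LM; apply: (etrans _ (congr1 -%R (esym RE))).
rewrite /p /m pE mE.
exact: opp.
Qed.

End at_state.

Lemma submanifold_flow_identity N : (0 < N)%N ->
  flow_identity A L P Ffrm Ffrp Fextm Fextp B U F N.
Proof. by case: N => [//|M] _ r Cr Ur u v; exact: identity_at. Qed.

End identity.

Theorem theorem4p3 (R : realType) (n : nat) (Q : topologicalType)
    (cQ : charted Q 'rV[R]_n) (manQ : is_manifold cQ)
    (L P : dstate R Q -> R) (Ffrm Ffrp Fextm Fextp : force R n Q)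
    (smoothL : smooth_function cQ L) (smoothP : smooth_function cQ P)
    (hFfrm : force_minus cQ Ffrm) (hFfrp : force_plus cQ Ffrp)
    (hFextm : force_minus cQ Fextm) (hFextp : force_plus cQ Fextp)
    (regular : forall r, regularity_matrix cQ L P Ffrm Fextm r \in unitmx) :
  (exists cC : charted (dstate R Q) (cmodel R n),
     is_submanifold (dcharts cQ) (constraint P) cC) /\
  forall cC : charted (dstate R Q) (cmodel R n),
    is_submanifold (dcharts cQ) (constraint P) cC ->
    well_defined_flow cQ L P Ffrm Ffrp Fextm Fextp cC /\
    forall (U : set (dstate R Q)) (F : dstate R Q -> dstate R Q),
      discrete_flow cQ L P Ffrm Ffrp Fextm Fextp U F ->
      (forall r, constraint P r -> U r -> smooth_at cC cC F r) /\
      forall N, (0 < N)%N ->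
        flow_identity cQ L P Ffrm Ffrp Fextm Fextp cC U F N.

Proof.
have aA := manifold_atlas manQ.
split.
  apply: (submanifold_exists aA smoothP) => x _.
  exact: (regular_submersion aA smoothP (regular x)).
move=> cC sub; split.
  exact: (submanifold_flow aA smoothL smoothP hFfrm hFfrp hFextm hFextp regular sub).
move=> U F flow; split.
  exact: (flow_smooth aA smoothL smoothP hFfrm hFfrp hFextm hFextp regular sub flow).
exact: (submanifold_flow_identity aA smoothL smoothP hFfrm hFfrp hFextm hFextp regular sub flow).
Qed.
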